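(* Let $(\mathbb P^{s,x})_{(s,x)\in[0,T]\times E}$ be a canonical Markov class associated to a transition kernel measurable in time, solving the martingale problem associated to $(\mathcal D(a),a,V)$. Let $\psi=(\psi_1,\dots,\psi_d)\in\mathcal D(a)^d$ be such that for every $i$: $\langle M[\psi_i]^{s,x}\rangle$ is absolutely continuous with respect to $V$ under every $\mathbb P^{s,x}$; $a(\psi_i)\in\mathcal L^2_X$; and $\mathfrak G^{\psi_i}(\psi_i)$ is bounded. Let $\zeta,\eta:E\to\mathbb R_+$ be Borel such that the class satisfies $H^{mom}(\zeta,\eta)$, and let $(f,g)$ satisfy $H^{growth}(\zeta,\eta)$. Let $u$ be a martingale solution of $Pseudo\text{-}PDE(f,g)$. Then $(u,\mathfrak G^\psi(u))$ is a solution of $IP(f,g)$ and, in particular, $u$ is a decoupled mild solution of $Pseudo\text{-}PDE(f,g)$.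
   Context: **Canonical Markov class.** $E$ is a Polish space, $\Omega$ the space of càdlàg functions $[0,T]\to E$, $X$ the canonical process, $\mathcal F=\sigma(X_r:r\in[0,T])$, $\mathcal F_t=\bigcap_{u\in]t,T]}\sigma(X_r:r\le u)$ for $t<T$, $\mathcal F_T=\mathcal F$. A transition kernel $P=(P_{s,t})$ is a family of Markov kernels on $E$ with $P_{s,t}(x,A)=\mathbf 1_A(x)$ if $t\le s$ and $\int P_{s,t}(x,dy)P_{t,u}(y,A)=P_{s,u}(x,A)$ for $s<t<u$; it is measurable in time if $(s,x)\mapsto P_{s,t}(x,A)$ is Borel for all $t,A$. A canonical Markov class associated to $P$ is a family of probabilities $\mathbb P^{s,x}$ on $(\Omega,\mathcal F)$ with $\mathbb P^{s,x}(X_t\in A)=P_{s,t}(x,A)$ for all $t,A$, and $\mathbb P^{s,x}(X_u\in A\mid\mathcal F_t)=P_{t,u}(X_t,A)$ $\mathbb P^{s,x}$-a.s. for $s\le t\le u$. $(\mathcal F^{s,x},(\mathcal F^{s,x}_t))$ are the $\mathbb P^{s,x}$-completions; martingales under $\mathbb P^{s,x}$ refer to this basis. $P_{s,t}[\phi](x)=\int\phi(y)P_{s,t}(x,dy)$. **Martingale problem.** $V:[0,T]\to\mathbb R_+$ is non-decreasing, continuous, $V_0=0$; $\mathcal D(a)$ is a linear space of Borel functions $[0,T]\times E\to\mathbb R$ and $a$ a linear operator from $\mathcal D(a)$ to the Borel functions. The class solves the martingale problem for $(\mathcal D(a),a,V)$ if for all $(s,x)$: $\mathbb P^{s,x}(X_t=x\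 \forall t\in[0,s])=1$, and for every $\phi\in\mathcal D(a)$, $\phi(\cdot,X_\cdot)-\int_s^\cdot a(\phi)(r,X_r)dV_r$ on $[s,T]$ is a càdlàg square integrable $\mathbb P^{s,x}$-martingale. $M[\phi]^{s,x}:=\mathbf 1_{[s,T]}(\phi(\cdot,X_\cdot)-\phi(s,x)-\int_s^\cdot a(\phi)(r,X_r)dV_r)$. $\mathcal H^2_0$: square integrable martingales vanishing at $0$. $\langle\cdot,\cdot\rangle$: predictable angle bracket. **Extended operators.** A Borel set $A\subset[0,T]\times E$ is of zero potential if $\mathbb E^{s,x}[\int_s^T\mathbf 1_{\{(t,X_t)\in A\}}dV_t]=0$ for all $(s,x)$. For $p>0$, $\mathcal L^p_X$ is the set of Borel $\phi:[0,T]\times E\to\mathbb R$ with $\mathbb E^{s,x}[\int_s^T|\phi|^p(r,X_r)dV_r]<\infty$ for all $(s,x)$; $\mathcal L^0_X$ the set of those with $\int_s^T|\phi|(r,X_r)dV_r<\infty$ $\mathbb P^{s,x}$-a.s. for all $(s,x)$; $L^p_X$ is the quotient by functions vanishing outside a zero potential set. $\mathcal D(\mathfrak a)$ is the set of Borel $\phi$ for which there is $\chi\in\mathcal L^0_X$ such that under every $\mathbb P^{s,x}$ the process $\mathbf 1_{[s,T]}(\phi(\cdot,X_\cdot)-\phi(s,x)-\int_s^\cdot\chi(r,X_r)dV_r)$ has a càdlàg modification in $\mathcal H^2_0$; $\chi$ is unique up to zero potential sets, $\mathfrak a(\phi)\in L^0_X$ denotes its class, and $M[\phi]^{s,x}$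 that càdlàg modification (if $\phi\in\mathcal D(a)$, then $\chi=a(\phi)$ up to zero potential sets and this modification is the process $\mathbf 1_{[s,T]}(\phi(\cdot,X_\cdot)-\phi(s,x)-\int_s^\cdot a(\phi)(r,X_r)dV_r)$, so the notation $M[\phi]^{s,x}$ is unambiguous). Under the absolute continuity of the $\langle M[\psi_i]^{s,x}\rangle$ with respect to $V$, for $\phi\in\mathcal D(\mathfrak a)$, $\mathfrak G^{\psi_i}(\phi)$ is the Borel function, unique up to zero potential sets, with $\langle M[\phi]^{s,x},M[\psi_i]^{s,x}\rangle=\int_s^{\cdot\vee s}\mathfrak G^{\psi_i}(\phi)(r,X_r)dV_r$ under every $\mathbb P^{s,x}$; $\mathfrak G^\psi=(\mathfrak G^{\psi_1},\dots,\mathfrak G^{\psi_d})$. **Hypotheses.** $H^{mom}(\zeta,\eta)$: $\mathbb E^{s,x}[\zeta^2(X_T)]<\infty$ and $\mathbb E^{s,x}[\int_0^T\eta^2(X_r)dV_r]<\infty$ for all $(s,x)$. $H^{growth}(\zeta,\eta)$: $f:[0,T]\times E\times\mathbb R\times\mathbb R^d\to\mathbb R$, $g:E\to\mathbb R$ are Borel and for some positive constants, $|g(x)|\le C(1+\zeta(x))$ and $|f(t,x,y,z)|\le C'(1+\eta(x)+|y|+\|z\|)$. **Notions of solution.** $Pseudo\text{-}PDE(f,g)$ is the equation $a(u)+f(\cdot,\cdot,u,\Gamma^\psi(u))=0$ on $[0,T]\times E$, $u(T,\cdot)=g$, where $\Gamma^\psi(u)=(a(u\psi_i)-ua(\psi_i)-\psi_ia(u))_{i\le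 d}$. A Borel function $u$ is a martingale solution if $u\in\mathcal D(\mathfrak a)$, $\mathfrak a(u)=-f(\cdot,\cdot,u,\mathfrak G^\psi(u))$ in $L^0_X$, and $u(T,\cdot)=g$ pointwise. A couple of Borel functions $u:[0,T]\times E\to\mathbb R$, $v=(v_1,\dots,v_d):[0,T]\times E\to\mathbb R^d$ is a solution of $IP(f,g)$ if $u,v_1,\dots,v_d\in\mathcal L^2_X$ and for every $(s,x)$ and every $i\in\{1,\dots,d\}$, $$u(s,x)=P_{s,T}[g](x)+\int_s^TP_{s,r}[f(\cdot,\cdot,u,v)(r,\cdot)](x)dV_r,$$ $$u\psi_i(s,x)=P_{s,T}[g\psi_i(T,\cdot)](x)-\int_s^TP_{s,r}[(v_i+ua(\psi_i)-\psi_if(\cdot,\cdot,u,v))(r,\cdot)](x)dV_r,$$ where $f(\cdot,\cdot,u,v)(t,x)=f(t,x,u(t,x),v(t,x))$. $u$ is a decoupled mild solution of $Pseudo\text{-}PDE(f,g)$ if there is $v$ such that $(u,v)$ solves $IP(f,g)$. *)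

(* Defs.v *)
From HB Require Import structures.
From mathcomp Require Import all_boot all_order all_algebra.
From mathcomp Require Import all_classical all_reals all_analysis.
From mathcomp Require Import measurable_realfun.

Set Implicit Arguments.
Unset Strict Implicit.
Unset Printing Implicit Defensive.
Import Order.TTheory GRing.Theory Num.Theory.
Import numFieldNormedType.Exports.

Local Open Scope classical_set_scope.
Local Open Scope ring_scope.

Record timeI (R : realType) (T : {posnum R}) :=
  TimeI { tval :> R ; _ : 0 <= tval <= T%:num }.

Section time_interval.
Context {R : realType} (T : {posnum R}).

HB.instance Definition _ := [isSub for @tval R T].
HB.instance Definition _ := [Choice of timeI T by <:].

Lemma tmin_subproof : (0 : R) <= 0 <= T%:num. Proof. by rewrite lexx/=. Qed.
Lemma tmax_subproof : 0 <= T%:num <= T%:num. Proof. by rewrite lexx andbT. Qed.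

Definition tmin : timeI T := TimeI tmin_subproof.
Definition tmax : timeI T := TimeI tmax_subproof.

HB.instance Definition _ := isPointed.Build (timeI T) tmin.
HB.instance Definition _ :=
  Measurable.copy (timeI T) (g_sigma_algebra_preimageType (@tval R T)).

Lemma clamp_subproof (r : R) :
  0 <= Num.max 0 (Num.min r T%:num) <= T%:num.
Proof. by rewrite le_max lexx/= ge_max ge_min lexx orbT andbT. Qed.

(* The nearest-point retraction of R onto [0, T]; it is the identity on [0, T].
   A function h on [0, T] is extended to R as h \o clamp, i.e. by h 0 on the
   left and by h T on the right. *)
Definition clamp (r : R) : timeI T := TimeI (clamp_subproof r).

End time_interval.
Arguments tmin {R T}.
Arguments tmax {R T}.
Arguments clamp {R T}.

(* Since h \o clamp is constant outside [0, T], the condition on the right is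
   vacuous at T. *)
Definition cadlag_from {R : realType} {T : {posnum R}} {U : topologicalType}
    (s : timeI T) (h : timeI T -> U) : Prop :=
  forall t : timeI T, tval s <= tval t ->
    (h (clamp r) @[r --> (tval t)^'+] --> h t) /\
    (tval s < tval t -> exists l : U, h (clamp r) @[r --> (tval t)^'-] --> l).

Definition polish (R : realType) (E : topologicalType) : Prop :=
  (exists2 D : set E, countable D & dense D) /\
  exists d : E -> E -> R,
    [/\ forall x y, d x y = 0 <-> x = y,
        forall x y, d x y = d y x,
        forall x y z, d x z <= d x y + d y z,
        forall (x : E) (A : set E),
          nbhs x A <-> exists2 e : R, 0 < e & [set y | d x y < e] `<=` A &
        forall w : nat -> E,
          (forall e : R, 0 < e -> exists N : nat, forall m n : nat,
            (N <= m)%N -> (N <= n)%N -> d (w m) (w n) < e) ->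
          exists l : E, w @ \oo --> l].

Definition borel (E : ptopologicalType) := g_sigma_algebraType (@open E).
HB.instance Definition _ (E : ptopologicalType) :=
  Measurable.on (borel E).

Record cpath (R : realType) (T : {posnum R}) (E : ptopologicalType) :=
  CPath { pval :> timeI T -> E ; _ : cadlag_from tmin pval }.

Section path_space.
Context {R : realType} {T : {posnum R}} {E : ptopologicalType}.

HB.instance Definition _ := gen_eqMixin (cpath T E).
HB.instance Definition _ := gen_choiceMixin (cpath T E).

Lemma cst_cadlag (x : E) : cadlag_from (T := T) tmin (fun=> x).
Proof. by move=> t _; split=> [|_]; [|exists x]; exact: cvg_cst. Qed.

HB.instance Definition _ :=
  isPointed.Build (cpath T E) (CPath (cst_cadlag point)).

Definition cylinders (t : timeI T) : set (set (cpath T E)) :=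
  [set A | exists r : timeI T, exists B : set (borel E),
    [/\ tval r <= tval t, measurable B & A = [set w : cpath T E | B (w r)]]].

HB.instance Definition _ :=
  Measurable.copy (cpath T E) (g_sigma_algebraType (cylinders tmax)).

Definition canonical_filtration (t : timeI T) : set (set (cpath T E)) :=
  if tval t < T%:num
  then \bigcap_(r in [set r : timeI T | tval t < tval r]) <<s cylinders r >>
  else measurable.

End path_space.

Record clock (R : realType) (T : {posnum R}) := Clock {
  cval :> timeI T -> R ;
  clock_nd : forall r t : timeI T, tval r <= tval t -> cval r <= cval t ;
  clock_continuous : continuous (fun r : R => cval (clamp r)) ;
  clock0 : cval tmin = 0 }.

Section clock_measure.
Context {R : realType} {T : {posnum R}}.

Definition clock_ext (V : clock T) (r : R) : R := V (clamp r).

Lemma clock_ext_nd (V : clock T) : nondecreasing (clock_ext V).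
Proof.
move=> r t rt; apply: clock_nd => /=.
by rewrite ge_max !le_max lexx/= le_min !ge_min rt lexx !orbT.
Qed.

Lemma clock_ext_rc (V : clock T) : right_continuous (clock_ext V).
Proof. by apply: right_continuousW; exact: clock_continuous. Qed.

HB.instance Definition _ (V : clock T) := isCumulative.Build R _ R
  (clock_ext V) (@clock_ext_nd V) (@clock_ext_rc V).

(* dV; it does not charge the complement of [0, T]. *)
Definition dclock (V : clock T) := lebesgue_stieltjes_measure (clock_ext V).

(* \int_s^t h(r) dV_r; it is 0 when t <= s. *)
Definition clock_int (V : clock T) (s t : timeI T) (h : timeI T -> \bar R)
    : \bar R :=
  (\int[dclock V]_(r in `[tval s, tval t]%classic) h (clamp r))%E.

End clock_measure.

Section processes.
Context {R : realType} {T : {posnum R}} d {U : measurableType d}.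
Variables (mu : {measure set U -> \bar R}) (F : timeI T -> set (set U)).
Implicit Types (M N B : timeI T -> U -> R) (s : timeI T).

Definition measurable_wrt {S : pointedType} (G : set (set S)) (Y : S -> R) :=
  measurable_fun [set: g_sigma_algebraType G]
    (Y : g_sigma_algebraType G -> R).

(* Z is a version of the conditional expectation of Y given <<s G >>. *)
Definition is_condexp (G : set (set U)) (Y Z : U -> R) : Prop :=
  [/\ mu.-integrable setT (EFin \o Y), mu.-integrable setT (EFin \o Z),
      measurable_wrt G Z &
      forall A, <<s G >> A ->
        (\int[mu]_(w in A) (Y w)%:E = \int[mu]_(w in A) (Z w)%:E)%E].

Definition martingale_from s M : Prop :=
  (forall t, tval s <= tval t ->
    measurable_wrt (F t) (M t) /\ mu.-integrable setT (EFin \o M t)) /\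
  (forall q t, tval s <= tval q -> tval q <= tval t ->
    is_condexp (F q) (M t) (M q)).

Definition cadlag_sq_martingale_from s M : Prop :=
  [/\ {ae mu, forall w, cadlag_from s (M ^~ w)},
      martingale_from s M &
      forall t, tval s <= tval t -> (\int[mu]_w ((M t w) ^+ 2)%:E < +oo)%E].

Definition H20 M : Prop :=
  cadlag_sq_martingale_from tmin M /\ {ae mu, forall w, M tmin w = 0}.

Definition predictable_rectangles : set (set (timeI T * U)) :=
  [set [set tmin] `*` A | A in F tmin] `|`
  [set C | exists p q : timeI T, exists2 A, F p A &
     C = [set r | tval p < tval r <= tval q] `*` A].

Definition predictable B : Prop :=
  measurable_wrt predictable_rectangles (fun z => B z.1 z.2).

(* B is the angle bracket <M, N> of M, N in H20: the predictable process of
   integrable variation, null at 0, such that M N - B is a martingale. *)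
Definition is_bracket M N B : Prop :=
  [/\ predictable B,
      {ae mu, forall w, B tmin w = 0 /\ cadlag_from tmin (B ^~ w)},
      (\int[mu]_w total_variation 0%R T%:num (fun r => B (clamp r) w) < +oo)%E &
      martingale_from tmin (fun t w => M t w * N t w - B t w)].

End processes.

(* The measure on [0, T] with cumulative function h is absolutely continuous
   with respect to dV. *)
Definition path_ac {R : realType} {T : {posnum R}} (V : clock T)
    (h : timeI T -> R) : Prop :=
  exists H : cumulative R R,
    (forall r, H r = h (clamp r)) /\
    lebesgue_stieltjes_measure H `<< dclock V.

Section markov_class.
Context {R : realType} {T : {posnum R}} {E : ptopologicalType}.
Implicit Types (phi chi psi G u : timeI T * borel E -> R).

Definition is_transition_kernel
    (P : timeI T -> timeI T -> R.-pker (borel E) ~> (borel E)) : Prop :=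
  (forall (s t : timeI T) (x : borel E) (A : set (borel E)), measurable A ->
    tval t <= tval s -> P s t x A = (\1_A x)%:E) /\
  (forall (s t r : timeI T) (x : borel E) (A : set (borel E)), measurable A ->
    tval s < tval t -> tval t < tval r ->
    (\int[P s t x]_y P t r y A = P s r x A)%E).

Definition measurable_in_time
    (P : timeI T -> timeI T -> R.-pker (borel E) ~> (borel E)) : Prop :=
  forall (t : timeI T) (A : set (borel E)), measurable A ->
    measurable_fun [set: timeI T * borel E] (fun z => P z.1 t z.2 A).

Variable Pr : timeI T -> E -> probability (cpath T E) R.

Definition is_canonical_markov_class
    (P : timeI T -> timeI T -> R.-pker (borel E) ~> (borel E)) : Prop :=
  (forall s x (t : timeI T) (A : set (borel E)), measurable A ->
    Pr s x [set w | A (w t)] = P s t x A) /\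
  (forall s x (t r : timeI T) (A : set (borel E)), measurable A ->
    tval s <= tval t -> tval t <= tval r ->
    is_condexp (Pr s x) (canonical_filtration t)
      (fun w => \1_A (w r : borel E)) (fun w => fine (P t r (w t) A))).

(* The completion of (Omega, F, P^{s,x}) is the Caratheodory extension; its
   sigma-algebra consists of the sets that differ from an element of F by a
   P^{s,x}-negligible set. *)
Definition Prc s x := @completed_measure_extension _ _ _ (Pr s x).
#[local] Arguments Prc s x A : clear implicits.
HB.instance Definition _ (s : timeI T) (x : E) := Measure.on (Prc s x).

Definition completed_filtration s x (t : timeI T) : set (set (cpath T E)) :=
  <<s canonical_filtration t `|` (Pr s x).-negligible >>.

Definition cadlag_sq_martingale s x (M : timeI T -> cpath T E -> R) : Prop :=
  cadlag_sq_martingale_from (Prc s x) (completed_filtration s x) s M.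

Definition H20_sx s x (M : timeI T -> cpath T E -> R) : Prop :=
  H20 (Prc s x) (completed_filtration s x) M.

Definition bracket_sx s x (M N B : timeI T -> cpath T E -> R) : Prop :=
  is_bracket (Prc s x) (completed_filtration s x) M N B.

Variable V : clock T.

Definition is_operator (Da : set (timeI T * borel E -> R))
    (a : (timeI T * borel E -> R) -> (timeI T * borel E -> R)) : Prop :=
  [/\ forall phi, Da phi -> measurable_fun setT phi,
      Da (fun=> 0),
      forall (c : R) phi phi', Da phi -> Da phi' ->
        Da (fun z => c * phi z + phi' z),
      forall phi, Da phi -> measurable_fun setT (a phi) &
      forall (c : R) phi phi', Da phi -> Da phi' ->
        a (fun z => c * phi z + phi' z) = (fun z => c * a phi z + a phi' z)].

(* \int_s^t chi(r, X_r) dV_r, for chi(., X) dV-integrable on [s, t]. *)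
Definition drift_int chi (s t : timeI T) (w : cpath T E) : R :=
  fine (clock_int V s t (fun r => (chi (r, w r))%:E)).

Definition drift_finite chi s x : Prop :=
  {ae Pr s x, forall w : cpath T E,
    (clock_int V s tmax (fun r => `|chi (r, w r)|%:E) < +oo)%E}.

Definition solves_martingale_problem (Da : set (timeI T * borel E -> R))
    (a : (timeI T * borel E -> R) -> (timeI T * borel E -> R)) : Prop :=
  forall s x,
    Pr s x [set w | forall t : timeI T, tval t <= tval s -> w t = x] = 1%E /\
    forall phi, Da phi ->
      drift_finite (a phi) s x /\
      cadlag_sq_martingale s x
        (fun t w => phi (t, w t) - drift_int (a phi) s t w).

Definition zero_potential (A : set (timeI T * borel E)) : Prop :=
  measurable A /\
  forall s x, (\int[Pr s x]_w
    clock_int V s tmax (fun r => (\1_A (r, w r : borel E))%:E) = 0)%E.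

Definition eq_zero_potential phi chi : Prop :=
  exists2 A, zero_potential A & forall z, ~ A z -> phi z = chi z.

Definition calL (p : R) phi : Prop :=
  measurable_fun setT phi /\
  forall s x, (\int[Pr s x]_w
    clock_int V s tmax (fun r => (`|phi (r, w r)| `^ p)%:E) < +oo)%E.

Definition calL0 phi : Prop :=
  measurable_fun setT phi /\ forall s x, drift_finite phi s x.

Definition compensated phi chi (s : timeI T) (x : E) (t : timeI T)
    (w : cpath T E) : R :=
  if tval s <= tval t
  then phi (t, w t) - phi (s, x) - drift_int chi s t w else 0.

Definition cadlag_modification phi chi s x (M : timeI T -> cpath T E -> R)
    : Prop :=
  H20_sx s x M /\
  forall t, {ae Pr s x, forall w, M t w = compensated phi chi s x t w}.

(* chi is a representative of the class frak-a(phi) *)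
Definition is_frak_a phi chi : Prop :=
  [/\ measurable_fun setT phi, calL0 chi &
      forall s x, exists M, cadlag_modification phi chi s x M].

Definition dom_frak_a phi : Prop := exists chi, is_frak_a phi chi.

(* M is M[phi]^{s,x} *)
Definition is_Mart phi s x (M : timeI T -> cpath T E -> R) : Prop :=
  exists2 chi, is_frak_a phi chi & cadlag_modification phi chi s x M.

(* d<M[psi]^{s,x}> << dV almost surely, under every P^{s,x} *)
Definition bracket_ac psi : Prop :=
  forall s x M, is_Mart psi s x M ->
    exists2 B, bracket_sx s x M M B &
      {ae Pr s x, forall w, path_ac V (B ^~ w)}.

(* G is a representative of frak-G^psi(phi) *)
Definition is_frak_G psi phi G : Prop :=
  [/\ dom_frak_a psi, dom_frak_a phi, measurable_fun setT G &
      forall s x M N, is_Mart phi s x M -> is_Mart psi s x N ->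
        drift_finite G s x /\
        exists2 B, bracket_sx s x M N B &
          {ae Pr s x, forall w t, B t w = drift_int G s t w}].

Definition Hmom (zeta eta : borel E -> R) : Prop :=
  forall s x,
    (\int[Pr s x]_w ((zeta (w tmax)) ^+ 2)%:E < +oo)%E /\
    (\int[Pr s x]_w
       clock_int V tmin tmax (fun r => ((eta (w r)) ^+ 2)%:E) < +oo)%E.

End markov_class.
Arguments Prc {R T E} Pr s x A.

Definition euclidean_norm {R : realType} {n : nat} (z : n.-tuple R) : R :=
  Num.sqrt (\sum_(i < n) (tnth z i) ^+ 2).

Section pde.
Context {R : realType} {T : {posnum R}} {E : ptopologicalType} {n : nat}.
Variable f : timeI T * borel E * R * n.-tuple R -> R.
Variable g : borel E -> R.
Implicit Types (u : timeI T * borel E -> R)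
  (v psi : 'I_n -> timeI T * borel E -> R).

Definition Hgrowth (zeta eta : borel E -> R) : Prop :=
  [/\ measurable_fun setT f, measurable_fun setT g,
      exists2 C : R, 0 < C & forall x, `|g x| <= C * (1 + zeta x) &
      exists2 C' : R, 0 < C' & forall t x y z,
        `|f (t, x, y, z)| <= C' * (1 + eta x + `|y| + euclidean_norm z)].

Definition fcomp u v (z : timeI T * borel E) : R :=
  f (z.1, z.2, u z, [tuple v i z | i < n]).

Variables (Pr : timeI T -> E -> probability (cpath T E) R) (V : clock T).
Variable psi : 'I_n -> timeI T * borel E -> R.

Definition martingale_solution u : Prop :=
  [/\ measurable_fun setT u,
      exists chi v, [/\ is_frak_a Pr V u chi,
        forall i, is_frak_G Pr V (psi i) u (v i) &
        eq_zero_potential Pr V chi (fun z => - fcomp u v z)] &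
      forall x, u (tmax, x) = g x].

Variable P : timeI T -> timeI T -> R.-pker (borel E) ~> (borel E).
Variable a : (timeI T * borel E -> R) -> (timeI T * borel E -> R).

Definition solution_IP u v : Prop :=
  [/\ calL Pr V 2 u, forall i, calL Pr V 2 (v i) &
      forall s x,
        ((u (s, x))%:E = \int[P s tmax x]_y (g y)%:E +
          clock_int V s tmax (fun r =>
            \int[P s r x]_y (fcomp u v (r, y))%:E))%E /\
        (forall i, (u (s, x) * psi i (s, x))%:E =
          \int[P s tmax x]_y (g y * psi i (tmax, y))%:E -
          clock_int V s tmax (fun r =>
            \int[P s r x]_y (v i (r, y) + u (r, y) * a (psi i) (r, y)
                             - psi i (r, y) * fcomp u v (r, y))%:E))%E].

Definition decoupled_mild_solution u : Prop := exists v, solution_IP u v.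

End pde.

(* Main.v *)
(** Fix (s, x), let lambda be the product of dV on [s, T] and P^{s,x}, and write
    M = M[u]^{s,x}, N = M[psi_i]^{s,x}, beta = a(psi_i), v = G^{psi_i}(u) and
    chi = frak-a(u).

    A bracket density is square integrable.  For an elementary predictable h,
    E \int h v dV is the expectation of the sum of h dM dN over a dyadic grid;
    by Young's inequality and the bound K on the density of <N>,
    2 E \int h v dV <= K E[M_T^2] + E \int h^2 dV.  The inequality extends to
    h = H(r, X_r) with H simple, because (r, X_r) coincides with its left limit
    except for countably many r, which dV does not charge; H increasing to the
    positive and the negative part of v then gives v in L^2(lambda).
    The same approximation shows that v is unique lambda-almost everywhere.
    That \int |v| dV is integrable to begin with comes from the integrable
    variation of the bracket.

    The solution u is square integrable.  Pathwise, u(t, X_t) = u(s, x) + M_t +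
    \int_s^t chi dV with |chi| <= C (1 + eta + |v| + |u|), so Gronwall's lemma
    bounds u(t, X_t) by M_t and time integrals that lie in L^2.

    The first equation is E[M_T] = 0.  For the second, expand
    u(T, X_T) psi_i(T, X_T) with u = u(s, x) + M + A and
    psi_i = psi_i(s, x) + N + B, where A = \int chi dV and B = \int beta dV, using
    E[M_T N_T] = E \int v dV, E[M_T B_T] = E \int M beta dV,
    E[N_T A_T] = E \int N chi dV and A_T B_T = \int (A beta + B chi) dV. *)
From HB Require Import structures.
Require Import Defs.
From mathcomp Require Import all_boot all_order all_algebra.
From mathcomp Require Import all_classical all_reals all_analysis.
From mathcomp Require Import measurable_realfun.
From mathcomp Require Import ring lra.
(* Restores the tval of Defs, shadowed by that of tuple. *)
Import Defs.

Set Implicit Arguments.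
Unset Strict Implicit.
Unset Printing Implicit Defensive.
Import Order.TTheory GRing.Theory Num.Theory.
Import numFieldNormedType.Exports.

Local Open Scope classical_set_scope.
Local Open Scope ring_scope.

(** * The clock measure on the time interval *)

(** A modification M agrees with the explicit process Y = [compensated] only almost surely at each
    fixed time, on the completed space. All identities are therefore moved to Y at fixed times on
    the uncompleted space, where Y is jointly measurable in time and path. What remains of the
    bracket is then a family of identities tested against bounded weights known at the left end of
    an increment ([bracket_density]). Hence only elementary predictable integrands are available at
    first, and the engine of the proof is the approximation of the sets {(r, X_r) in C} by
    elementary ones. It holds for any law on path space and is used three times: with a Dirac mass,
    where it recovers the sign of v along one path; for the uniqueness of v; for the L^2 bound. In
    that bound the coefficient 1 of \int h^2 matters: for 0 <= h <= v^+ one has \int h^2 <= \int h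
    v, so the factor 2 on the left absorbs it. Uniqueness is needed because a martingale solution
    comes with its own representative of G^psi(u), while the conclusion concerns an arbitrary
    one. *)

Section clock_measure_theory.
Context {R : realType} {T : {posnum R}}.
Implicit Types (V : clock T) (s t : timeI T).

Lemma tvalP t : 0 <= tval t <= T%:num.
Proof. by case: t. Qed.

Lemma tval_ge0 t : 0 <= tval t.
Proof. by have /andP[] := tvalP t. Qed.

Lemma tval_le t : tval t <= T%:num.
Proof. by have /andP[] := tvalP t. Qed.

Lemma clamp_val (r : R) : 0 <= r <= T%:num -> tval (clamp r : timeI T) = r.
Proof.
by move=> /andP[r0 rT] /=; rewrite (min_idPl rT) (max_idPr r0).
Qed.

Lemma tval_inj : injective (@tval R T).
Proof. exact: val_inj. Qed.

Lemma clampK t : clamp (tval t) = t.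
Proof. by apply: tval_inj; rewrite clamp_val// tvalP. Qed.

Lemma clamp_le0 (r : R) : r <= 0 -> clamp r = tmin :> timeI T.
Proof.
move=> r0; apply: tval_inj => /=.
by rewrite (min_idPl _) ?(max_idPl _)// (le_trans r0).
Qed.

Lemma clamp_geT (r : R) : T%:num <= r -> clamp r = tmax :> timeI T.
Proof.
move=> rT; apply: tval_inj => /=.
by rewrite (min_idPr _) ?(max_idPr _).
Qed.

Lemma clamp_nd (p q : R) : p <= q -> tval (clamp p : timeI T) <= tval (clamp q : timeI T).
Proof.
by move=> pq /=; rewrite ge_max !le_max lexx/= le_min !ge_min pq lexx !orbT.
Qed.

Lemma measurable_tval : measurable_fun setT (@tval R T).
Proof. by move=> _ B mB; rewrite setTI; exists B => //; rewrite setTI. Qed.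

Lemma measurable_clamp :
  measurable_fun (setT : set (measurableTypeR R)) (@clamp R T).
Proof.
move=> _ _ [B mB <-]; rewrite !setTI.
have mc : measurable_fun setT (fun r : R => Num.max 0 (Num.min r T%:num)).
  apply: measurable_maxr; first exact: measurable_cst.
  apply: measurable_minr; first exact: measurable_id.
  exact: measurable_cst.
by have := mc measurableT _ mB; rewrite setTI.
Qed.

HB.instance Definition _ V := Measure.on (dclock V).

Lemma dclock_oc V (p q : R) : p <= q ->
  dclock V `]p, q]%classic = (clock_ext V q - clock_ext V p)%:E.
Proof.
move=> pq; rewrite /dclock /lebesgue_stieltjes_measure/= /measure_extension/=.
by rewrite measurable_mu_extE/= ?wlength_itv_bnd//; exact: is_ocitv.
Qed.

Lemma clock_ext_continuous V : continuous (clock_ext V).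
Proof. exact: clock_continuous. Qed.

Lemma measurable_real1 (r : R) : measurable ([set r] : set (measurableTypeR R)).
Proof. by rewrite -set_itv1; exact: measurable_itv. Qed.

(** Continuity of [V]: the intervals ]r - d/2, r] carry the increment of [V], which tends to 0.
    Every later exchange of a path value with its left limit rests on this absence of atoms. *)
Lemma dclock_set1 V (r : R) : dclock V [set r] = 0%E.
Proof.
apply/eqP; rewrite eq_le measure_ge0 andbT.
apply/lee_addgt0Pr => e e0; rewrite add0e.
have := @clock_ext_continuous V r.
move=> /cvgrPdist_lt /(_ e e0) /nbhs_ballP[d /= d0 dP].
apply: (@le_trans _ _ (dclock V `]r - d / 2, r]%classic)).
  apply: le_measure; rewrite ?inE.
  - exact: measurable_real1.
  - exact: measurable_itv.
  - by move=> x /= ->; rewrite in_itv/= lexx andbT ltrBlDr ltrDl divr_gt0.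
rewrite dclock_oc; last by rewrite lerBlDr lerDl divr_ge0// ltW.
rewrite lee_fin.
have /dP : ball r d (r - d / 2).
  by rewrite /ball/= opprB addrC subrK ger0_norm ?divr_ge0 ?ltW//; lra.
by move=> h; rewrite (le_trans (ler_norm _))// ltW.
Qed.

Lemma dclock_cc V (p q : R) : p <= q ->
  dclock V `[p, q]%classic = (clock_ext V q - clock_ext V p)%:E.
Proof.
move=> pq; rewrite -dclock_oc// -(@setU1itv _ _ _ _ false) ?bnd_simp//.
rewrite measureU; last first.
- by apply/seteqP; split => // x [/= ->]; rewrite in_itv/= ltxx.
- exact: measurable_itv.
- exact: measurable_real1.
- by rewrite [X in (X + _)%E]dclock_set1 add0e.
Qed.

Lemma measurable_time_itv s : measurable (`[tval s, T%:num]%classic : set (measurableTypeR R)).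
Proof. exact: measurable_itv. Qed.

(** [dV] on [s, T] as a finite measure on the time type itself, so that products with laws on path
    space and Fubini apply. Restricting before pushing forward discards the reals outside [s, T]
    instead of letting [clamp] move them to the ends. *)
Definition clk V s : set (timeI T) -> \bar R :=
  pushforward (mrestr (dclock V) (measurable_time_itv s)) (@clamp R T).

Section clk_measure.
Variables (V : clock T) (s : timeI T).

Let clk0 : clk V s set0 = 0%E.
Proof. by rewrite /clk /pushforward preimage_set0 measure0. Qed.

Let measurable_preimage_clamp (A : set (timeI T)) : measurable A ->
  measurable (@clamp R T @^-1` A : set (measurableTypeR R)).
Proof. by move=> mA; rewrite -[X in measurable X]setTI; exact: measurable_clamp. Qed.

Let clk_ge0 A : (0 <= clk V s A)%E.
Proof. by rewrite /clk /pushforward; exact: measure_ge0. Qed.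

Let clk_sigma_additive : semi_sigma_additive (clk V s).
Proof.
move=> F mF tF mUF; rewrite /clk /pushforward preimage_bigcup.
apply: measure_semi_sigma_additive.
- by move=> n; exact: measurable_preimage_clamp.
- apply/trivIsetP => /= i j _ _ ij; rewrite -preimage_setI.
  by move/trivIsetP : tF => /(_ _ _ _ _ ij) ->//; rewrite preimage_set0.
- by rewrite -preimage_bigcup; exact: measurable_preimage_clamp.
Qed.

HB.instance Definition _ := isMeasure.Build _ _ _ (clk V s)
  clk0 clk_ge0 clk_sigma_additive.

Let clk_fin : fin_num_fun (clk V s).
Proof.
apply: lty_fin_num_fun; rewrite /= /clk /pushforward /mrestr preimage_setT setTI.
by rewrite dclock_cc ?ltry// tval_le.
Qed.

HB.instance Definition _ := Measure_isFinite.Build _ _ _ (clk V s) clk_fin.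

End clk_measure.

Definition upto t : set (timeI T) := [set r | tval r <= tval t].

Lemma measurable_time_ray (c : R) :
  [/\ measurable [set r : timeI T | tval r <= c], measurable [set r : timeI T | tval r < c],
   measurable [set r : timeI T | c <= tval r] & measurable [set r : timeI T | c < tval r]].
Proof.
have H (i : interval R) : measurable (@tval R T @^-1` [set` i]).
  by rewrite -[X in measurable X]setTI; apply: measurable_tval => //; exact: measurable_itv.
split.
- by have := H `]-oo, c]; congr measurable; apply/seteqP; split => x /=; rewrite in_itv.
- by have := H `]-oo, c[; congr measurable; apply/seteqP; split => x /=; rewrite in_itv.
- by have := H `[c, +oo[; congr measurable; apply/seteqP; split => x /=; rewrite in_itv/= andbT.
- by have := H `]c, +oo[; congr measurable; apply/seteqP; split => x /=; rewrite in_itv/= andbT.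
Qed.

Lemma measurable_upto t : measurable (upto t).
Proof. by have [] := measurable_time_ray (tval t). Qed.

Lemma upto_tmax : upto (@tmax R T) = setT.
Proof. by apply/seteqP; split => // r _; exact: tval_le. Qed.

Lemma clk_set1 V s r : clk V s [set r] = 0%E.
Proof.
rewrite /clk /pushforward /mrestr; apply/eqP; rewrite eq_le measure_ge0 andbT.
rewrite -(dclock_set1 V (tval r)); apply: le_measure; rewrite ?inE.
- apply: measurableI; last exact: measurable_itv.
  rewrite -[X in measurable X]setTI; apply: measurable_clamp => //.
  exists [set tval r]; first exact: measurable_real1.
  by rewrite setTI; apply/seteqP; split => x /= => [/tval_inj//|->].
- exact: measurable_real1.
- move=> x [/= <-]; rewrite in_itv/= => /andP[sx xT].
  by apply/esym/clamp_val; rewrite xT (le_trans (tval_ge0 s)).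
Qed.

Lemma clk_lt V s : clk V s [set r | tval r < tval s] = 0%E.
Proof.
rewrite /clk /pushforward /mrestr [X in dclock _ X](_ : _ = set0) ?measure0//.
apply/seteqP; split => // x [/=]; rewrite in_itv/= => + /andP[sx xT].
by rewrite (min_idPl xT) (max_idPr (le_trans (tval_ge0 s) sx)) ltNge sx.
Qed.

Lemma ge0_clock_intE V s t (h : timeI T -> \bar R) : measurable_fun setT h ->
  (forall r, 0 <= h r)%E -> clock_int V s t h = (\int[clk V s]_(r in upto t) h r)%E.
Proof.
move=> mh h0; rewrite /clock_int /clk ge0_integral_pushforward//; last 3 first.
- exact: measurable_clamp.
- exact: measurable_upto.
- exact: measurable_funTS.
have mU : measurable (@clamp R T @^-1` upto t : set (measurableTypeR R)).
  by rewrite -[X in measurable X]setTI; apply: measurable_clamp => //; exact: measurable_upto.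
have mD := measurable_time_itv s.
rewrite [RHS](@ge0_negligible_integral _ (measurableTypeR R) R
  (mrestr (dclock V) (measurable_time_itv s)) _ (~` `[tval s, T%:num]%classic))//.
- rewrite setDE setCK; set D := _ `&` _.
  have -> : `[tval s, tval t]%classic = D.
    apply/seteqP; split => x; rewrite /D /upto /= !in_itv/=.
      move=> /andP[sx xt]; rewrite sx (le_trans xt (tval_le t)); split => //.
      by rewrite ge_max tval_ge0/= ge_min xt.
    move=> [+ /andP[sx xT]]; rewrite sx (min_idPl xT) (max_idPr _)//.
    exact: le_trans (tval_ge0 s) sx.
  apply: eq_measure_integral => A mA AD; rewrite /mrestr; congr dclock.
  by apply/esym/setIidPl; apply: (subset_trans AD); rewrite /D => x [].
- exact: measurableC.
- apply: measurable_funTS; apply: measurableT_comp => //; exact: measurable_clamp.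
- by move=> x _; exact: h0.
- by rewrite /= /mrestr setICl measure0.
Qed.

Lemma clock_intE V s t (h : timeI T -> \bar R) : measurable_fun setT h ->
  clock_int V s t h = (\int[clk V s]_(r in upto t) h r)%E.
Proof.
move=> mh; rewrite [RHS]integralE -!ge0_clock_intE//.
- rewrite /clock_int [LHS]integralE.
  by congr (_ - _)%E; apply: eq_integral => x _; rewrite ?funeposE ?funenegE.
- exact: measurable_funeneg.
- exact: measurable_funepos.
Qed.

Lemma clk_le V s t : tval s <= tval t -> clk V s (upto t) = (V t - V s)%:E.
Proof.
move=> st; rewrite -[LHS]mul1e -integral_cst; last exact: measurable_upto.
rewrite -(@clock_intE _ _ _ (cst 1%E))//.
rewrite /clock_int integral_cst; last exact: measurable_itv.
by rewrite mul1e [LHS]dclock_cc// /clock_ext !clampK.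
Qed.

(** Only an inequality, since p may lie before s, where [clk V s] has no mass. *)
Lemma clk_oc V s (p q : timeI T) : tval p <= tval q ->
  (clk V s [set r | (tval p < tval r)%R && (tval r <= tval q)%R] <= (V q - V p)%:E)%E.
Proof.
move=> pq; rewrite /clk /pushforward /mrestr.
have -> : (V q - V p)%:E = dclock V `]tval p, tval q]%classic.
  by rewrite dclock_oc// /clock_ext !clampK.
apply: le_measure; rewrite ?inE; last 2 first.
- exact: measurable_itv.
- move=> x [/=]; rewrite !in_itv/= => + /andP[sx xT].
  by rewrite (min_idPl xT) (max_idPr (le_trans (tval_ge0 s) sx)).
- apply: measurableI; last exact: measurable_itv.
  rewrite -[X in measurable X]setTI; apply: measurable_clamp => //.
  have [_ _ _ h1] := measurable_time_ray (tval p); have [h2 _ _ _] := measurable_time_ray (tval q).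
  rewrite (_ : mkset _ = [set r : timeI T | tval p < tval r] `&` [set r : timeI T | tval r <= tval q]); first exact: measurableI.
  by apply/seteqP; split => x /= => [/andP[]|[-> ->]].
Qed.

End clock_measure_theory.

(** * Approximation of predictable sets by elementary ones *)

Section approximation.
Context d (X : measurableType d) {R : realType} (mu : {measure set X -> \bar R}).
Implicit Types (A B C : set X) (D : set (set X)).

Definition sdiff A B := (A `\` B) `|` (B `\` A).

Definition approximable D C :=
  measurable C /\ forall e : R, 0 < e -> exists2 B, D B & (mu (sdiff C B) < e%:E)%E.

Lemma measurable_sdiff A B : measurable A -> measurable B -> measurable (sdiff A B).
Proof. by move=> mA mB; apply: measurableU; exact: measurableD. Qed.

Lemma sdiff_setC A B : sdiff (~` A) (~` B) = sdiff A B.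
Proof.
apply/seteqP; rewrite /sdiff; split => x /=.
- by move=> [[h1 /contrapT h2]|[h1 /contrapT h2]]; [right|left].
- by move=> [[h1 h2]|[h1 h2]]; [right|left]; split => // /(_ h1).
Qed.

Section closure.
Variable D : set (set X).
Hypothesis muT : (mu setT < +oo)%E.
Hypothesis D_measurable : D `<=` measurable.
Hypothesis D0 : D set0.
Hypothesis DC : forall A, D A -> D (~` A).
Hypothesis DU : forall A B, D A -> D B -> D (A `|` B).

Lemma approximable_sub : D `<=` approximable D.
Proof.
move=> A DA; split; first exact: D_measurable.
by move=> e e0; exists A => //; rewrite /sdiff setDv setU0 measure0 lte_fin.
Qed.

Lemma approximableC A : approximable D A -> approximable D (~` A).
Proof.
move=> [mA hA]; split; first exact: measurableC.
by move=> e /hA[B DB AB]; exists (~` B); [exact: DC|rewrite sdiff_setC].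
Qed.

Lemma approximableU A B :
  approximable D A -> approximable D B -> approximable D (A `|` B).
Proof.
move=> [mA hA] [mB hB]; split; first exact: measurableU.
move=> e e0; have e2 : 0 < e / 2 by rewrite divr_gt0.
have [A' DA' ltA] := hA _ e2; have [B' DB' ltB] := hB _ e2.
have mA' := D_measurable DA'; have mB' := D_measurable DB'.
exists (A' `|` B'); first exact: DU.
apply: (@le_lt_trans _ _ (mu (sdiff A A') + mu (sdiff B B'))%E); last first.
  by rewrite [e]splitr EFinD lteD.
have mSA := measurable_sdiff mA mA'; have mSB := measurable_sdiff mB mB'.
apply: (le_trans _ (measureU2 mu mSA mSB)); apply: le_measure; rewrite ?inE.
- by apply: measurable_sdiff; exact: measurableU.
- exact: measurableU.
- by rewrite /sdiff => x /=; tauto.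
Qed.

(** Since mu is finite, the finite unions exhaust the countable one up to e/2 by continuity from
    above; a finite union is then approximated within the other e/2. *)
Lemma approximable_bigcup (F : (set X)^nat) :
  (forall n, approximable D (F n)) -> approximable D (\bigcup_n F n).
Proof.
move=> hF; have mF n : measurable (F n) by case: (hF n).
have mU : measurable (\bigcup_n F n) by exact: bigcup_measurable.
split => // e e0; have e2 : 0 < e / 2 by rewrite divr_gt0.
pose U n := \big[setU/set0]_(i < n) F i.
have hU n : approximable D (U n).
  rewrite /U; elim: n => [|n IH]; first by rewrite big_ord0; exact: approximable_sub.
  by rewrite big_ord_recr/=; exact: approximableU.
have mUn n : measurable (U n) by case: (hU n).
pose G n := (\bigcup_n F n) `\` U n.
have mG n : measurable (G n) by exact: measurableD.
have G0 : \bigcap_n G n = set0.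
  apply/seteqP; split => // x Gx; have [[i _ Fix] _] := Gx 0%N I.
  have [_] := Gx i.+1 I; apply; rewrite /U -bigcup_mkord.
  by exists i => /=.
have : (mu \o G) @ \oo --> mu (\bigcap_n G n).
  apply: nonincreasing_cvg_mu => //.
  - by apply: le_lt_trans muT; apply: le_measure; rewrite ?inE.
  - by rewrite G0.
  - move=> m n mn; apply/subsetPset => x [Fx nU]; split => //; apply: contra_not nU.
    rewrite /U -!bigcup_mkord => -[i /= im Fi].
    by exists i => //=; exact: leq_trans mn.
rewrite G0 measure0 => cv.
have [] := cv [set x | (x < (e / 2)%:E)%E].
  by apply: open_nbhs_nbhs; split; [exact: open_ereal_lt_ereal|rewrite /= lte_fin].
move=> n _ /(_ n (leqnn n)) /= Gn.
have [B DB UB] := (hU n).2 _ e2; have mB := D_measurable DB.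
exists B => //.
apply: (@le_lt_trans _ _ (mu (G n) + mu (sdiff (U n) B))%E); last first.
  by rewrite [e]splitr EFinD lteD.
have mS := measurable_sdiff (mUn n) mB.
apply: (le_trans _ (measureU2 mu (mG n) mS)); apply: le_measure; rewrite ?inE.
- exact: measurable_sdiff.
- exact: measurableU.
- rewrite /sdiff /G => x /= [[Fx nB]|[Bx nF]].
    by have [Ux|Ux] := pselect (U n x); [right; left|left].
  right; right; split => //; apply: contra_not nF.
  by rewrite /U -bigcup_mkord => -[i _ Fi]; exists i.
Qed.

Lemma approximable_sigma_algebra : sigma_algebra setT (approximable D).
Proof.
split; first exact: approximable_sub.
  by move=> A; rewrite setTD; exact: approximableC.
exact: approximable_bigcup.
Qed.

(** Triangle inequality for symmetric differences. It lets the jump times of the paths be ignored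
    below. *)
Lemma approximable_null A B : measurable A -> approximable D B ->
  mu (sdiff A B) = 0%E -> approximable D A.
Proof.
move=> mA [mB hB] AB0; split => // e /hB [C DC' BC]; exists C => //.
have mC := D_measurable DC'.
apply: le_lt_trans BC; rewrite -[leRHS]add0e -[X in (_ <= X + _)%E]AB0.
have mAB := measurable_sdiff mA mB; have mBC := measurable_sdiff mB mC.
apply: (le_trans _ (measureU2 mu mAB mBC)); apply: le_measure; rewrite ?inE.
- exact: measurable_sdiff.
- exact: measurableU.
- rewrite /sdiff => x /= [[Ax nC]|[Cx nA]].
    by have [Bx|Bx] := pselect (B x); [right; left|left; left].
  by have [Bx|Bx] := pselect (B x); [left; right|right; right].
Qed.

End closure.
End approximation.

(** * Dyadic cells and one-sided limits of cadlag functions *)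

Section dyadic_grid.
Context {R : realType} {T : {posnum R}}.
Implicit Types (r t : timeI T) (k m j : nat).

Definition mesh k : R := T%:num / 2 ^+ k.
Definition grid k j : timeI T := clamp (mesh k * j%:R).
(** Cells are open on the left and closed on the right, hence a ceiling minus one. As the
    predecessor of 0 is 0, time 0 joins the cell of index 0. *)
Definition idx k r : nat := `|Num.ceil (tval r / mesh k)|%N.-1.

Lemma mesh_gt0 k : 0 < mesh k.
Proof. by rewrite divr_gt0// exprn_gt0. Qed.

Lemma idxP k r : 0 < tval r ->
  mesh k * (idx k r)%:R < tval r <= mesh k * (idx k r).+1%:R.
Proof.
move=> r0; rewrite /idx; set x := tval r / mesh k.
have x0 : 0 < x by rewrite divr_gt0// mesh_gt0.
have c0 : (0 < Num.ceil x)%R by rewrite ceil_gt0.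
have cE : (`|Num.ceil x|%N%:R : R) = (Num.ceil x)%:~R.
  by rewrite natr_absz gtr0_norm.
have a0 : (0 < `|Num.ceil x|)%N by rewrite absz_gt0 gt_eqF.
have := ceil_itv x; rewrite intrB -cE -{1}(prednK a0) -natr1 addrK.
rewrite /x ltr_pdivlMr ?ler_pdivrMr ?mesh_gt0// => /andP[h1 h2].
by rewrite natr1 prednK// ![mesh k * _]mulrC h1 h2.
Qed.

Lemma idx_uniq k r j : mesh k * j%:R < tval r <= mesh k * j.+1%:R -> idx k r = j.
Proof.
move=> /andP[jr rj]; have r0 : 0 < tval r.
  by apply: le_lt_trans jr; rewrite mulr_ge0// ltW// mesh_gt0.
have /andP[ir ri] := idxP k r0.
have := lt_le_trans jr ri; rewrite ltr_pM2l ?mesh_gt0// ltr_nat ltnS => h1.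
have := lt_le_trans ir rj; rewrite ltr_pM2l ?mesh_gt0// ltr_nat ltnS => h2.
by apply/eqP; rewrite eqn_leq h1 h2.
Qed.

Lemma idx0 k r : tval r = 0 -> idx k r = 0%N.
Proof. by rewrite /idx => ->; rewrite mul0r ceil0. Qed.

Lemma mesh_raise k m : mesh k = mesh (k + m) * (2 ^ m)%:R.
Proof.
rewrite /mesh exprD natrX; field.
by rewrite !expf_neq0.
Qed.

(** This nesting of cells is why the grids are dyadic: sets described on two grids can be rewritten
    on a common finer one. *)
Lemma idx_raise k m r : idx k r = (idx (k + m) r %/ 2 ^ m)%N.
Proof.
have := tval_ge0 r; rewrite le_eqVlt => /predU1P[/esym r0|r0].
  by rewrite !idx0// div0n.
have /andP[] := idxP (k + m) r0; move: (idx _ r) => n.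
move=> ir ri; apply: idx_uniq; rewrite (mesh_raise k m).
have := mesh_gt0 (k + m); move: (mesh (k + m)) ir ri => M ir ri M0.
rewrite -!mulrA -!natrM; apply/andP; split.
  apply: le_lt_trans ir; rewrite ler_pM2l// ler_nat mulnC.
  exact: leq_trunc_div.
apply: (le_trans ri); rewrite ler_pM2l// ler_nat mulnC.
by apply: ltn_ceil; rewrite expn_gt0.
Qed.

(** Hence an event known at the left end of a coarse cell stays admissible on every fine cell inside
    it. *)
Lemma grid_raise k m j : tval (grid k (j %/ 2 ^ m)) <= tval (grid (k + m) j).
Proof.
apply: clamp_nd; rewrite (mesh_raise k m) -mulrA -natrM ler_pM2l ?mesh_gt0//.
by rewrite ler_nat mulnC leq_trunc_div.
Qed.

Lemma cvg_mesh : mesh @ \oo --> (0 : R).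
Proof.
rewrite (_ : mesh = (fun k => T%:num * (2^-1) ^+ k)); last first.
  by apply/funext => k; rewrite /mesh exprVn.
rewrite -[X in _ --> X](mulr0 (T%:num)); apply: cvgM; first exact: cvg_cst.
by apply: cvg_expr; rewrite ger0_norm// invf_lt1// ltr1n.
Qed.

Lemma idx_left r : 0 < tval r ->
  (forall k, mesh k * (idx k r)%:R < tval r) /\
  (fun k => mesh k * (idx k r)%:R) @ \oo --> tval r.
Proof.
move=> r0; split=> [k|]; first by have /andP[] := idxP k r0.
apply: (@squeeze_cvgr _ _ _ _ (fun k => tval r - mesh k) (fun=> tval r)).
- near=> k; have /andP[h1 h2] := idxP k r0; rewrite (ltW h1) andbT.
  by rewrite lerBlDr (le_trans h2)// -natr1 mulrDr mulr1.
- rewrite -[X in _ --> X]subr0; apply: cvgB; [exact: cvg_cst|exact: cvg_mesh].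
- exact: cvg_cst.
Unshelve. all: by end_near. Qed.

(** The shift is 2 and not 1: r may be the right end of its own cell, and a limit from the right
    needs points strictly beyond r. *)
Lemma idx_right r :
  (forall k, tval r < mesh k * (idx k r).+2%:R) /\
  (fun k => mesh k * (idx k r).+2%:R) @ \oo --> tval r.
Proof.
have H k : mesh k * (idx k r)%:R <= tval r <= mesh k * (idx k r).+1%:R.
  have := tval_ge0 r; rewrite le_eqVlt => /predU1P[/esym r0|r0].
    by rewrite idx0// r0 mulr0 lexx mulr1 ltW// mesh_gt0.
  by have /andP[/ltW -> ->] := idxP k r0.
split=> [k|].
  have /andP[h1 h2] := H k; apply: (le_lt_trans h2).
  by rewrite ltr_pM2l ?mesh_gt0// ltr_nat.
apply: (@squeeze_cvgr _ _ _ _ (fun=> tval r) (fun k => tval r + mesh k * 2)).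
- near=> k; have /andP[h1 h2] := H k; apply/andP; split.
    by apply: (le_trans h2); rewrite ler_pM2l ?mesh_gt0// ler_nat.
  by rewrite -addn2 natrD mulrDr lerD2r.
- exact: cvg_cst.
- rewrite -[X in _ --> X]addr0 -(mul0r 2); apply: cvgD; first exact: cvg_cst.
  by apply: cvgM; [exact: cvg_mesh|exact: cvg_cst].
Unshelve. all: by end_near. Qed.

Lemma cadlag_grid_right (h : timeI T -> R) r : cadlag_from tmin h ->
  (fun k => h (grid k (idx k r).+2)) @ \oo --> h r.
Proof.
move=> /(_ r (tval_ge0 r))[+ _] => /cvg_at_rightP.
by move=> /(_ (fun k => mesh k * (idx k r).+2%:R)); apply; exact: idx_right.
Qed.

(** To an upward jump t attach rationals p < t and q with h < q on ]p, t[ and q < h(t). Two jumps t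
    < t' cannot share the pair: t lies in ]p, t'[, so h(t) < q < h(t). *)
Lemma countable_up_jumps (h : timeI T -> R) :
  countable [set t | exists2 l, h (clamp r) @[r --> (tval t)^'-] --> l & l < h t].
Proof.
set J := [set t | _].
have H t : exists pq : rat * rat, J t -> [/\ ratr pq.1 < tval t,
    (forall r : R, ratr pq.1 < r -> r < tval t -> h (clamp r) < ratr pq.2) &
    ratr pq.2 < h t].
  have [[l cv lh]|nJ] := pselect (J t); last by exists (0, 0).
  have [q] := rat_in_itvoo lh; rewrite in_itv/= => /andP[lq qh].
  have : \forall r \near (tval t)^'-, h (clamp r) < ratr q.
    by apply: (cvgr_lt l).
  move=> [e /= e0 eP].
  have [p] := @rat_in_itvoo R (tval t - e) (tval t) ltac:(by rewrite ltrBlDr ltrDl).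
  rewrite in_itv/= => /andP[ep pt].
  exists (p, q) => _; split => //= r pr rt; apply: eP => //=.
  by rewrite gtr0_norm ?subr_gt0// ltrBlDr addrC -ltrBlDr (lt_trans ep).
have [g gP] := choice H.
apply/countable_injP; exists (pickle \o g) => t t' /[!inE] Jt Jt' /= /(pcan_inj pickleK) gtt.
have main a b : J a -> J b -> g a = g b -> tval a < tval b -> False.
  move=> Ja Jb gab ab; have [h1 _ h3] := gP _ Ja; have [_ h2 _] := gP _ Jb.
  have := h2 (tval a); rewrite -gab clampK => /(_ h1 ab).
  by move=> /(lt_trans h3); rewrite ltxx.
apply: tval_inj; apply/eqP; rewrite eq_le !leNgt; apply/andP; split; apply/negP => lt.
  exact: main Jt' Jt _ lt.
exact: main Jt Jt' _ lt.
Qed.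

Definition left_jumps (h : timeI T -> R) : set (timeI T) :=
  [set t | ~ h (clamp r) @[r --> (tval t)^'-] --> h t].

Lemma countable_left_jumps (h : timeI T -> R) : cadlag_from tmin h ->
  countable (left_jumps h).
Proof.
move=> ch; pose J (h : timeI T -> R) :=
  [set t | exists2 l, h (clamp r) @[r --> (tval t)^'-] --> l & l < h t].
pose F (b : bool) := if b then J h else J (fun t => - h t).
have cF : countable (\bigcup_(b in [set: bool]) F b).
  by apply: bigcup_countable => // -[] _; exact: countable_up_jumps.
apply: sub_countable cF; apply: subset_card_le => t jt.
have [t0|t0] := leP (tval t) 0.
  (* At time 0 the extension by [clamp] is constant on the left, so 0 is never a jump. *)
  exfalso; apply: jt.
  have te : t = tmin by rewrite -(clampK t) clamp_le0.
  apply: cvg_near_cst; near=> r.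
  rewrite te clamp_le0//; apply: le_trans t0.
  by near: r; exact: nbhs_left_le.
have [_ /(_ t0)[l cl]] := ch t (tval_ge0 t).
have [lh|hl|lh] := ltgtP l (h t).
- by exists true => //; exists l.
- by exists false => //; exists (- l); [exact: cvgN|rewrite ltrN2].
- by exfalso; apply: jt; rewrite -lh.
Unshelve. all: by end_near. Qed.

Lemma cadlag_grid_left (h : timeI T -> R) r : 0 < tval r -> ~ left_jumps h r ->
  (fun k => h (grid k (idx k r))) @ \oo --> h r.
Proof.
move=> r0 /contrapT /cvg_at_leftP.
by move=> /(_ (fun k => mesh k * (idx k r)%:R)); apply; exact: idx_left.
Qed.

Lemma measurable_idx k j : measurable [set r | idx k r = j].
Proof.
have [h1 _ _ _] := @measurable_time_ray R T (mesh k * j.+1%:R).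
have [_ _ _ h2] := @measurable_time_ray R T (mesh k * j%:R).
have [h3 _ _ _] := @measurable_time_ray R T 0.
have -> : [set r | idx k r = j] =
   ([set r | mesh k * j%:R < tval r] `&` [set r | tval r <= mesh k * j.+1%:R]) `|`
   ([set r | tval r <= 0] `&` [set r | j = 0%N]).
  apply/seteqP; split => r /=.
    move=> ij; have [r0|r0] := leP (tval r) 0.
      by right; split => //; rewrite -ij idx0//; apply/eqP; rewrite eq_le r0 tval_ge0.
    by left; have /andP[] := idxP k r0; rewrite ij.
  move=> [[a b]|[a ->]]; first by apply: idx_uniq; rewrite a b.
  by apply: idx0; apply/eqP; rewrite eq_le a tval_ge0.
apply: measurableU; apply: measurableI => //.
have [->|j0] := eqVneq j 0%N.
  by rewrite (_ : mkset _ = setT)//; apply/seteqP.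
rewrite (_ : mkset _ = set0)//; apply/seteqP; split => // r /= /eqP.
by rewrite (negbTE j0).
Qed.

End dyadic_grid.

Lemma clk_countable {R : realType} {T : {posnum R}} (V : clock T) s (A : set (timeI T)) :
  countable A -> (clk V s).-negligible A.
Proof.
move=> /countable_injP[f finj].
have -> : A = \bigcup_n [set x | A x /\ f x = n].
  by apply/seteqP; split => [x Ax|x [n _ []]//]; exists (f x).
apply: negligible_bigcup => n.
have [[x [Ax fx]]|nx] := pselect (exists x, A x /\ f x = n).
  apply: (@negligibleS _ _ _ _ [set x]).
    by move=> y [Ay fy] /=; apply: finj; rewrite ?inE// fx fy.
  exists [set x]; split => //; last exact: clk_set1.
  exists [set tval x]; first exact: measurable_real1.
  by rewrite setTI; apply/seteqP; split => y /= => [/tval_inj//|->].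
rewrite (_ : mkset _ = set0); first exact: negligible_set0.
by apply/seteqP; split => // x [Ax fx]; apply: nx; exists x.
Qed.

(** * Path space: joint measurability and elementary predictable sets *)

Section path_measurability.
Context {R : realType} {T : {posnum R}} {E : ptopologicalType}.
Implicit Types (t r : timeI T) (w : cpath T E).

Lemma cylinders_le t r : tval t <= tval r ->
  <<s cylinders (E := E) t >> `<=` <<s cylinders r >>.
Proof.
move=> tr; apply: sub_sigma_algebra2 => A [q [B [qt mB ->]]].
by exists q, B; split => //; exact: le_trans tr.
Qed.

Lemma cylinders_measurable t :
  <<s cylinders t >> `<=` (measurable : set (set (cpath T E))).
Proof. by apply: cylinders_le; exact: tval_le. Qed.

Lemma cylinders_eval t (B : set (borel E)) : measurable B ->
  <<s cylinders t >> [set w : cpath T E | B (w t)].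
Proof. by move=> mB; apply: sub_gen_smallest; exists t, B. Qed.

Lemma cylindersC t (A : set (cpath T E)) : <<s cylinders t >> A -> <<s cylinders t >> (~` A).
Proof. by move=> h; rewrite -setTD; exact: sigma_algebraCD. Qed.

Lemma cylinders0 t : <<s cylinders t >> (set0 : set (cpath T E)).
Proof. exact: sigma_algebra0. Qed.

Lemma cylindersU t (A B : set (cpath T E)) : <<s cylinders t >> A ->
  <<s cylinders t >> B -> <<s cylinders t >> (A `|` B).
Proof.
move=> hA hB; rewrite -bigcup2E; apply: sigma_algebra_bigcup => -[|[|i]] //=.
exact: cylinders0.
Qed.

Lemma measurable_eval t :
  measurable_fun setT (fun w : cpath T E => (w t : borel E)).
Proof.
move=> _ B mB; rewrite setTI; apply: (@cylinders_measurable t).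
exact: cylinders_eval.
Qed.

(* The elementary predictable sets: on the cell ]grid k j, grid k j.+1] the
   section is an event known at its left end. *)
Definition elementary_sets : set (set (timeI T * cpath T E)) :=
  [set D | exists k (S : nat -> set (cpath T E)),
    (forall j, <<s cylinders (grid k j) >> (S j)) /\
    D = [set z | S (idx k z.1) z.2]].

Lemma measurable_cells k (S : nat -> set (cpath T E)) :
  (forall j, measurable (S j)) ->
  measurable [set z : timeI T * cpath T E | S (idx k z.1) z.2].
Proof.
move=> mS; have -> : [set z : timeI T * cpath T E | S (idx k z.1) z.2] =
    \bigcup_j ([set r | idx k r = j] `*` S j).
  apply/seteqP; split => [[r w] /= Srw|[r w] [j _ [/= <-]]]//.
  by exists (idx k r).
apply: bigcup_measurable => j _; apply: measurableX => //.
exact: measurable_idx.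
Qed.

Lemma elementary_measurable : elementary_sets `<=` measurable.
Proof.
move=> _ [k [S [hS ->]]]; apply: measurable_cells => j.
exact: cylinders_measurable (hS j).
Qed.

Lemma elementary0 : elementary_sets set0.
Proof.
exists 0%N, (fun=> set0); split => // j; exact: cylinders0.
Qed.

Lemma elementaryC D : elementary_sets D -> elementary_sets (~` D).
Proof.
move=> [k [S [hS ->]]]; exists k, (fun j => ~` S j); split => // j.
exact: cylindersC.
Qed.

Lemma elementary_raise k m (S : nat -> set (cpath T E)) :
  (forall j, <<s cylinders (grid k j) >> (S j)) ->
  (forall j, <<s cylinders (grid (k + m) j) >> (S (j %/ 2 ^ m)%N)) /\
  [set z : timeI T * cpath T E | S (idx k z.1) z.2] =
  [set z | S (idx (k + m) z.1 %/ 2 ^ m)%N z.2].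
Proof.
move=> hS; split => [j|]; first exact: (cylinders_le (grid_raise k m j)).
by apply/seteqP; split => z /=; rewrite (idx_raise k m).
Qed.

Lemma elementaryU A B : elementary_sets A -> elementary_sets B ->
  elementary_sets (A `|` B).
Proof.
move=> [k [S [hS ->]]] [m [U [hU ->]]].
have [hS' ->] := elementary_raise m hS; have [hU' ->] := elementary_raise k hU.
exists (k + m)%N, (fun j => S (j %/ 2 ^ m)%N `|` U (j %/ 2 ^ k)%N); split.
  by move=> j; apply: cylindersU => //; rewrite addnC.
by apply/seteqP; split => z /=; rewrite (addnC m k).
Qed.

Lemma measurable_cells_fun d' (U : measurableType d') k (F : nat -> cpath T E -> U) :
  (forall j, measurable_fun setT (F j)) ->
  measurable_fun setT (fun z : timeI T * cpath T E => F (idx k z.1) z.2).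
Proof.
move=> mF _ B mB; rewrite setTI.
apply: (@measurable_cells k (fun j => F j @^-1` B)) => j.
by rewrite -[X in measurable X]setTI; exact: mF.
Qed.

Section adapted_cadlag.
Variable Z : timeI T -> cpath T E -> R.
Hypothesis Z_adapted : forall t c, <<s cylinders t >> [set w | c < Z t w].
Hypothesis Z_cadlag : forall w, cadlag_from tmin (Z ^~ w).

Let mZ t : measurable_fun setT (Z t).
Proof.
apply: (measurability _ (RGenOInfty.measurableE R)) => //.
move=> _ [_ [c ->] <-]; rewrite setTI.
rewrite (_ : _ @^-1` _ = [set w | c < Z t w]); last first.
  by apply/seteqP; split => w /=; rewrite in_itv/= andbT.
by apply: (@cylinders_measurable t); exact: Z_adapted.
Qed.

(** By right-continuity Z is the pointwise limit of its values at dyadic times to the right of r,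
    and these are step functions of time. *)
Lemma measurable_adapted_cadlag :
  measurable_fun setT (fun z : timeI T * cpath T E => Z z.1 z.2).
Proof.
apply: (@measurable_fun_cvg _ _ _ _
  (fun k (z : timeI T * cpath T E) => Z (grid k (idx k z.1).+2) z.2)).
- move=> k; apply: (@measurable_cells_fun _ _ k (fun j => Z (grid k j.+2))) => j.
  exact: mZ.
- by move=> [r w] _ /=; exact: (@cadlag_grid_right R T (Z ^~ w) r (Z_cadlag w)).
Qed.

(* Off its countably many jumps a cadlag function is the limit of its values at
   the left ends of the dyadic cells, and dV has no atoms. *)
Lemma approximable_adapted_cadlag (V : clock T) s (rho : probability (cpath T E) R) :
  approximable (clk V s \x rho)%E elementary_sets [set z | 0 < Z z.1 z.2].
Proof.
set mu := (clk V s \x rho)%E.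
have muT : (mu setT < +oo)%E.
  rewrite -setXTT /mu product_measure1E//= -ge0_fin_numE ?mule_ge0//.
  by rewrite fin_numM// fin_num_measure.
have sa := approximable_sigma_algebra muT elementary_measurable elementary0 elementaryC elementaryU.
have [_ saC saU] := sa.
pose C k m : set (timeI T * cpath T E) :=
  [set z | m.+1%:R^-1 < Z (grid k (idx k z.1)) z.2].
have hC k m : approximable mu elementary_sets (C k m).
  apply: approximable_sub; first exact: elementary_measurable.
  by exists k, (fun j => [set w | m.+1%:R^-1 < Z (grid k j) w]); split.
(* D says that the values at the left ends eventually exceed some 1/(m+1). The margin keeps the
   limit strictly positive, so D agrees with {Z > 0} wherever the left-end values converge to Z. *)
pose D := \bigcup_m \bigcup_K \bigcap_(k in [set k | K <= k]%N) C k m.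
have hcap K m : approximable mu elementary_sets (\bigcap_(k in [set k | K <= k]%N) C k m).
  rewrite -[X in approximable _ _ X]setCK -setTD; apply: (saC _).
  rewrite setC_bigcap (_ : (\bigcup_(_ in _) _) =
    \bigcup_k (if (K <= k)%N then ~` C k m else set0)).
    apply: (saU _) => k; case: ifP => _; last exact: approximable_sub elementary_measurable _ elementary0.
    by rewrite -setTD; exact: (saC _).
  apply/seteqP; split => [z [k /= Kk Ck]|z [k _]]; first by exists k => //; rewrite Kk.
  by case: ifP => // Kk Ck; exists k.
have hD : approximable mu elementary_sets D by apply: (saU _) => m; exact: (saU _).
have mA : measurable [set z : timeI T * cpath T E | 0 < Z z.1 z.2].
  have := measurable_adapted_cadlag measurableT (measurable_itv `]0, +oo[%R); rewrite setTI.
  by congr measurable; apply/seteqP; split => z /=; rewrite in_itv/= andbT.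
apply: (approximable_null _ mA hD) => //; first exact: elementary_measurable.
have mD : measurable D by case: hD.
have mS := measurable_sdiff mA mD.
transitivity (\int[clk V s \x rho]_z (\1_(sdiff [set z | 0 < Z z.1 z.2] D) z)%:E)%E.
  by rewrite integral_indic// setIT.
rewrite fubini_tonelli2//; last first.
  by apply/measurable_EFinP; exact: measurable_indic.
apply: integral0_eq => w _; rewrite /fubini_G.
have mY := measurable_ysection w mS.
transitivity (\int[clk V s]_r (\1_(ysection (sdiff [set z | 0 < Z z.1 z.2] D) w) r)%:E)%E.
  by apply: eq_integral => r _; rewrite !indicE mem_ysection.
rewrite integral_indic// setIT; apply: measure_negligible => //.
(* Time 0 is added to the jumps because it has no left end strictly before it, as [cadlag_grid_left]
   requires. *)
apply: (@negligibleS _ _ _ _ ([set tmin] `|` left_jumps (Z ^~ w))); last first.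
  apply: negligibleU; apply: clk_countable; last exact: countable_left_jumps.
  exact: finite_set_countable.
move=> r /=; rewrite ysectionE /= => Srw; apply: contrapT => /not_orP[r0 lj].
have {}r0 : 0 < tval r.
  rewrite lt_neqAle tval_ge0 andbT eq_sym; apply/eqP => re.
  by apply: r0; apply: tval_inj.
have cv := cadlag_grid_left r0 lj.
case: Srw => -[/= h1 h2].
- apply: h2; have [m _ mZ'] : exists2 m, True & m.+1%:R^-1 < Z r w.
    by have [m _] := near_infty_natSinv_lt (PosNum h1); move/(_ m (leqnn m)) => /= hm; exists m.
  have [K _ KP] : \forall k \near \oo, m.+1%:R^-1 < Z (grid k (idx k r)) w.
    exact: (cvgr_gt _ cv).
  by exists m => //; exists K => // k; exact: KP.
- apply: h2; case: h1 => m _ [K _ KP].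
  apply: (@lt_le_trans _ _ m.+1%:R^-1); first by rewrite invr_gt0.
  apply: (cvgr_to_ge cv); exists K => // k Kk; apply: ltW; exact: KP.
Qed.

End adapted_cadlag.

Section polish_space.
Hypothesis hE : polish R E.

(** phi is the distance to the complement of U, set to 1 when the complement is empty. It turns {X_t
    in U} into the positivity of a real cadlag process. *)
Lemma polish_open_pos (U : set E) : open U ->
  exists2 phi : E -> R, continuous phi & U = [set x | 0 < phi x].
Proof.
move=> oU; case: hE => _ [d [d0 dC dT dN _]].
have [U0|] := pselect (~` U = set0).
  exists (fun=> 1); first by move=> x; exact: cvg_cst.
  by rewrite -[LHS]setCK U0 setC0; apply/seteqP; split => // x _; exact: ltr01.
move=> /eqP/set0P[y0 Uy0].
have dge0 x y : 0 <= d x y.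
  have := dT x y x; rewrite (d0 x x).2// (dC y x) -mulr2n pmulrn_lge0//.
pose A x := [set d x y | y in ~` U].
have hA x : has_inf (A x).
  by split; [exists (d x y0), y0|exists 0 => _ [y _ <-]].
have Lip x x' : inf (A x) <= inf (A x') + d x x'.
  rewrite -lerBlDr; apply: lb_le_inf; first by exists (d x' y0), y0.
  move=> _ [y Uy <-]; rewrite lerBlDr [leRHS]addrC (le_trans _ (dT x x' y))//.
  by apply: inf_lbound; [case: (hA x)|exists y].
exists (fun x => inf (A x)).
  move=> x; apply/cvgrPdist_lt => e e0.
  apply/dN; exists e => // y /= xy; rewrite ltr_norml; apply/andP; split.
    by have := Lip y x; rewrite dC; lra.
  by have := Lip x y; lra.
apply/seteqP; split => x /=.
  move=> Ux; have /dN[e e0 eU] : nbhs x U by exact: open_nbhs_nbhs.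
  apply: (lt_le_trans e0); apply: lb_le_inf; first by exists (d x y0), y0.
  move=> _ [y Uy <-]; rewrite leNgt; apply/negP => xy; exact/Uy/eU.
move=> A0; apply: contrapT => Ux; move: A0; apply/negP; rewrite -leNgt.
by rewrite -((d0 x x).2 erefl); apply: inf_lbound; [case: (hA x)|exists x].
Qed.

Lemma cpathP w : cadlag_from tmin w.
Proof. by case: w. Qed.

Lemma cadlag_comp (phi : E -> R) w : continuous phi ->
  cadlag_from tmin (fun r => phi (w r)).
Proof.
move=> cphi t t0; have [cr cl] := cpathP w t0; split.
  apply: (@cvg_comp _ _ _ (fun r : R => w (clamp r)) phi _ (nbhs (w t))); [exact: cr|exact: cphi].
move=> st; have [l cvl] := cl st; exists (phi l).
apply: (@cvg_comp _ _ _ (fun r : R => w (clamp r)) phi _ (nbhs l)); [exact: cvl|exact: cphi].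
Qed.

(** Serves the time coordinate of [graph]: the ray {t > c} is the positivity set of this
    deterministic process. *)
Lemma cadlag_tval (c : R) : cadlag_from tmin (fun t : timeI T => tval t - c).
Proof.
move=> t _; split.
  apply: cvgB; last exact: cvg_cst.
  apply: (@squeeze_cvgr _ _ _ _ (fun=> tval t) id).
  - near=> r; have tr : tval t <= r by near: r; exact: nbhs_right_ge.
    have := clamp_nd (T := T) tr; rewrite clampK => ->/=.
    by rewrite ge_max ge_min lexx orTb andbT (le_trans _ tr)// tval_ge0.
  - exact: cvg_cst.
  - by apply: cvg_at_right_filter; exact: cvg_id.
move=> _; exists (tval t - c); apply: cvgB; last exact: cvg_cst.
apply: (@squeeze_cvgr _ _ _ _ id (fun=> tval t)).
- near=> r; have rt : r <= tval t by near: r; exact: nbhs_left_le.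
  have := clamp_nd (T := T) rt; rewrite clampK => ->; rewrite andbT/=.
  by rewrite le_max le_min lexx (le_trans rt (tval_le t)) orbT.
- by apply: cvg_at_left_filter; exact: cvg_id.
- exact: cvg_cst.
Unshelve. all: by end_near. Qed.

Lemma adapted_comp (phi : E -> R) t c : continuous phi ->
  <<s cylinders t >> [set w : cpath T E | c < phi (w t)].
Proof.
move=> cphi; apply: (@cylinders_eval t [set x | c < phi x]).
apply: sub_gen_smallest.
rewrite (_ : mkset _ = phi @^-1` [set y | c < y])//.
by apply: open_comp; [move=> x _; exact: cphi|exact: open_gt].
Qed.

Definition graph (z : timeI T * cpath T E) : timeI T * borel E := (z.1, z.2 z.1).

Lemma measurable_graph : measurable_fun setT graph.
Proof.
apply: measurable_fun_pair; first exact: measurable_fst.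
apply: (@measurability _ _ _ (borel E) _ _ (@open E) erefl).
move=> _ [U oU <-]; rewrite setTI.
have [phi cphi ->] := polish_open_pos oU.
have := @measurable_adapted_cadlag (fun t w => phi (w t))
  (fun t c => @adapted_comp phi t c cphi) (fun w => @cadlag_comp phi w cphi) measurableT _ (measurable_itv `]0, +oo[%R).
by rewrite setTI; congr measurable; apply/seteqP; split => z /=; rewrite in_itv/= andbT.
Qed.

Lemma measurable_graph_preimage C : measurable C ->
  measurable (graph @^-1` C : set (timeI T * cpath T E)).
Proof.
by move=> mC; rewrite -[X in measurable X]setTI; exact: measurable_graph.
Qed.

(** The C with approximable preimage form a sigma-algebra, so generators suffice: time rays and open
    sets of E, both of which come from positivity sets of adapted cadlag processes. The law rho is
    arbitrary, which later permits a Dirac mass. *)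
Lemma approximable_graph (V : clock T) s (rho : probability (cpath T E) R) C :
  measurable C ->
  approximable (clk V s \x rho)%E elementary_sets (graph @^-1` C).
Proof.
set mu := (clk V s \x rho)%E.
have muT : (mu setT < +oo)%E.
  rewrite -setXTT /mu product_measure1E//= -ge0_fin_numE ?mule_ge0//.
  by rewrite fin_numM// fin_num_measure.
have sa := approximable_sigma_algebra muT elementary_measurable elementary0 elementaryC elementaryU.
have cl (U : Type) (f : timeI T * cpath T E -> U) (G : set (set U)) :
  (forall A, G A -> approximable mu elementary_sets (f @^-1` A)) ->
  <<s G >> `<=` [set A | approximable mu elementary_sets (f @^-1` A)].
  move=> h; apply: smallest_sub => //; case: sa => h0 hC hU; split => //=.
  - by move=> A /hC; rewrite !setTD preimage_setC.
  - by move=> A /hU; rewrite preimage_bigcup.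
have apI A B : approximable mu elementary_sets A -> approximable mu elementary_sets B ->
    approximable mu elementary_sets (A `&` B).
  case: sa => _ hC _; move=> hA hB; rewrite -[_ `&` _]setCK setCI -setTD.
  apply: (hC _); apply: approximableU => //; try exact: elementary_measurable;
    try exact: elementaryU; by rewrite -setTD; exact: (hC _).
rewrite measurable_prod_measurableType; apply: (cl _ _ _) => _ [A [A' mA' <-] [B mB <-]].
rewrite setTI (_ : _ @^-1` _ = (fun z : timeI T * cpath T E => tval z.1) @^-1` A' `&`
   (fun z : timeI T * cpath T E => (z.2 z.1 : borel E)) @^-1` B)//.
apply: (apI _ _).
  move: mA'; rewrite [measurable _](_ : _ = (RGenOInfty.G (R:=R)).-sigma.-measurable A'); last first.
    by rewrite -RGenOInfty.measurableE.
  apply: (cl _ _ _) => _ [c ->].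
  rewrite (_ : _ @^-1` _ = [set z | 0 < tval z.1 - c]); last first.
    by apply/seteqP; split => z /=; rewrite in_itv/= andbT subr_gt0.
  apply: (@approximable_adapted_cadlag (fun t _ => tval t - c)); last first.
    by move=> _; exact: cadlag_tval.
  move=> t e; have [h|h] := pselect (e < tval t - c).
    rewrite (_ : mkset _ = ~` set0); first by apply: cylindersC; exact: cylinders0.
    by rewrite setC0; apply/seteqP; split.
  rewrite (_ : mkset _ = set0); first exact: cylinders0.
  by apply/seteqP; split.
apply: (cl _ _ (@open E)) mB => U oU.
have [phi cphi ->] := polish_open_pos oU.
exact: (@approximable_adapted_cadlag (fun t w => phi (w t))
  (fun t c => @adapted_comp phi t c cphi) (fun w => @cadlag_comp phi w cphi)).
Qed.

End polish_space.
End path_measurability.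

Local Notation along h := (fun z : timeI _ * cpath _ _ => h (graph z)).

Lemma probability_lty d (U : measurableType d) (R : realType) (rho : probability U R) :
  (rho setT < +oo)%E.
Proof. by rewrite probability_setT ltry. Qed.

(** * Real-valued integrals *)

Section rintegrable.
Context d (X : measurableType d) {R : realType} (mu : {measure set X -> \bar R}).
Implicit Types (f g h : X -> R) (c : R).

Definition rintegrable f := mu.-integrable setT (EFin \o f).

Definition sq_integrable f :=
  measurable_fun setT f /\ rintegrable (fun x => f x ^+ 2).

Lemma rintegrable_measurable f : rintegrable f -> measurable_fun setT f.
Proof. by move=> /measurable_int/measurable_EFinP. Qed.

Lemma rintegrableP f : measurable_fun setT f ->
  rintegrable f <-> (\int[mu]_x `|f x|%:E < +oo)%E.
Proof.
move=> mf; split; first by move=> /integrableP[].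
by move=> h; apply/integrableP; split => //; exact/measurable_EFinP.
Qed.

Lemma rintegrableD f g : rintegrable f -> rintegrable g -> rintegrable (fun x => f x + g x).
Proof. by move=> hf hg; exact: (integrableD measurableT hf hg). Qed.

Lemma rintegrableB f g : rintegrable f -> rintegrable g -> rintegrable (fun x => f x - g x).
Proof. by move=> hf hg; exact: (integrableB measurableT hf hg). Qed.

Lemma rintegrable0 : rintegrable (fun=> 0).
Proof. exact: integrable0. Qed.

Lemma rintegrableZ c f : rintegrable f -> rintegrable (fun x => c * f x).
Proof. by move=> hf; exact: (integrableZl measurableT c hf). Qed.

Lemma rintegrable_norm f : rintegrable f -> rintegrable (fun x => `|f x|).
Proof. exact: integrable_norm. Qed.

Lemma rintegrable_sum (I : Type) (s : seq I) (F : I -> X -> R) :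
  (forall i, rintegrable (F i)) -> rintegrable (fun x => \sum_(i <- s) F i x).
Proof.
move=> hF; elim: s => [|i s IH].
  by under eq_fun do rewrite big_nil; exact: rintegrable0.
by under eq_fun do rewrite big_cons; exact: rintegrableD.
Qed.

Lemma le_rintegrable f g : measurable_fun setT f ->
  (forall x, `|f x| <= `|g x|) -> rintegrable g -> rintegrable f.
Proof.
move=> mf fg; apply: le_integrable => //; first exact/measurable_EFinP.
by move=> x _; rewrite lee_fin.
Qed.

Lemma rintegrable_bounded_mul c h f : measurable_fun setT h ->
  (forall x, `|h x| <= c) -> rintegrable f -> rintegrable (fun x => h x * f x).
Proof.
move=> mh hc hf; have mf := rintegrable_measurable hf.
apply: (@le_rintegrable _ (fun x => c * f x)); last exact: rintegrableZ.
  exact: measurable_funM.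
move=> x; rewrite !normrM ler_wpM2r//; apply: (le_trans (hc x)); exact: ler_norm.
Qed.

Lemma rintegrable_indic (A : set X) f : measurable A -> rintegrable f ->
  rintegrable (fun x => \1_A x * f x).
Proof.
move=> mA; apply: (@rintegrable_bounded_mul 1); first exact: measurable_indic.
by move=> x; rewrite indicE; case: (_ \in _); rewrite ?normr1 ?normr0.
Qed.

Lemma Rint_indic (A : set X) f :
  \int[mu]_(x in A) f x = \int[mu]_x (\1_A x * f x).
Proof.
rewrite Rintegral_mkcond; apply: eq_Rintegral => x _.
by rewrite patchE indicE; case: ifP; rewrite ?mul1r ?mul0r.
Qed.

Lemma eq_rintegrable f g : f =1 g -> rintegrable f -> rintegrable g.
Proof. by move=> /funext ->. Qed.

Lemma RintD f g : rintegrable f -> rintegrable g ->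
  \int[mu]_x (f x + g x) = \int[mu]_x f x + \int[mu]_x g x.
Proof. exact: RintegralD. Qed.

Lemma RintB f g : rintegrable f -> rintegrable g ->
  \int[mu]_x (f x - g x) = \int[mu]_x f x - \int[mu]_x g x.
Proof. exact: RintegralB. Qed.

Lemma RintZ c f : rintegrable f -> \int[mu]_x (c * f x) = c * \int[mu]_x f x.
Proof. by move=> hf; apply: RintegralZl. Qed.

Lemma RintN f : rintegrable f -> \int[mu]_x (- f x) = - \int[mu]_x f x.
Proof.
move=> hf; rewrite -mulN1r -RintZ//; apply: eq_Rintegral => x _.
by rewrite mulN1r.
Qed.

Lemma Rint0 : \int[mu]_x (0 : R) = 0.
Proof. by rewrite /Rintegral integral0. Qed.

Lemma Rint_sum (I : Type) (s : seq I) (F : I -> X -> R) :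
  (forall i, rintegrable (F i)) ->
  \int[mu]_x (\sum_(i <- s) F i x) = \sum_(i <- s) \int[mu]_x F i x.
Proof.
move=> hF; elim: s => [|i s IH].
  by rewrite big_nil -[RHS]Rint0; apply: eq_Rintegral => x _; rewrite big_nil.
rewrite big_cons -IH -RintD//; last exact: rintegrable_sum.
by apply: eq_Rintegral => x _; rewrite big_cons.
Qed.

Lemma le_Rint f g : rintegrable f -> rintegrable g -> (forall x, f x <= g x) ->
  \int[mu]_x f x <= \int[mu]_x g x.
Proof. by move=> hf hg fg; apply: le_Rintegral. Qed.

Lemma Rint_ge0 f : (forall x, 0 <= f x) -> 0 <= \int[mu]_x f x.
Proof. by move=> f0; apply: Rintegral_ge0. Qed.

Lemma EFin_Rint f : rintegrable f -> (\int[mu]_x f x)%:E = (\int[mu]_x (f x)%:E)%E.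
Proof. by move=> hf; rewrite /Rintegral fineK//; exact: integrable_fin_num. Qed.

Lemma ae_eq_Rint f g : measurable_fun setT f -> measurable_fun setT g ->
  {ae mu, forall x, f x = g x} -> \int[mu]_x f x = \int[mu]_x g x.
Proof.
move=> mf mg fg; congr fine; apply: ae_eq_integral => //; try exact/measurable_EFinP.
by apply: filterS fg => x /= ->.
Qed.

Lemma ae_rintegrable f g : measurable_fun setT g ->
  {ae mu, forall x, f x = g x} -> rintegrable f -> rintegrable g.
Proof.
move=> mg fg hf; have mf := rintegrable_measurable hf.
apply/rintegrableP => //; move/(rintegrableP mf) : hf; apply: le_lt_trans.
apply: ae_ge0_le_integral => //.
- by apply/measurable_EFinP; exact: measurableT_comp.
- by apply/measurable_EFinP; exact: measurableT_comp.
- by apply: filterS fg => x /= ->.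
Qed.

Lemma Rint_ge0_eq0 f : rintegrable f -> (forall x, 0 <= f x) ->
  \int[mu]_x f x = 0 -> {ae mu, forall x, f x = 0}.
Proof.
move=> hf f0 i0; have mf := rintegrable_measurable hf.
have : (\int[mu]_x `|(f x)%:E| = 0)%E.
  under eq_integral do rewrite gee0_abs ?lee_fin//.
  by rewrite -EFin_Rint// i0.
move/ae_eq_integral_abs => /(_ measurableT).
move=> /(_ ltac:(exact/measurable_EFinP)).
by apply: filterS => x /= /(_ I) [].
Qed.

Lemma sq_integrable_rM f g : sq_integrable f -> sq_integrable g ->
  rintegrable (fun x => f x * g x).
Proof.
move=> [mf hf] [mg hg].
apply: (@le_rintegrable _ (fun x => f x ^+ 2 + g x ^+ 2)); last exact: rintegrableD.
  exact: measurable_funM.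
move=> x; rewrite [leRHS]ger0_norm ?addr_ge0 ?sqr_ge0//.
rewrite ler_norml; apply/andP; split; have := sqr_ge0 (f x + g x);
  have := sqr_ge0 (f x - g x); have := sqr_ge0 (f x); have := sqr_ge0 (g x); nra.
Qed.

Lemma sq_integrableD f g : sq_integrable f -> sq_integrable g ->
  sq_integrable (fun x => f x + g x).
Proof.
move=> hf hg; split; first by apply: measurable_funD; [case: hf|case: hg].
apply: (@eq_rintegrable (fun x => (f x ^+ 2 + 2 * (f x * g x)) + g x ^+ 2)).
  by move=> x; ring.
apply: rintegrableD; last by case: hg.
apply: rintegrableD; first by case: hf.
by apply: rintegrableZ; exact: sq_integrable_rM.
Qed.

Lemma sq_integrableZ c f : sq_integrable f -> sq_integrable (fun x => c * f x).
Proof.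
move=> [mf hf]; split; first exact: measurable_funM.
by under eq_fun do rewrite exprMn; exact: rintegrableZ.
Qed.

Lemma sq_integrableN f : sq_integrable f -> sq_integrable (fun x => - f x).
Proof. by move=> /(sq_integrableZ (-1)); under eq_fun do rewrite mulN1r. Qed.

Lemma sq_integrableB f g : sq_integrable f -> sq_integrable g ->
  sq_integrable (fun x => f x - g x).
Proof. by move=> hf hg; apply: sq_integrableD => //; exact: sq_integrableN. Qed.

Lemma le_sq_integrable f g : measurable_fun setT f ->
  (forall x, `|f x| <= `|g x|) -> sq_integrable g -> sq_integrable f.
Proof.
move=> mf fg [mg hg]; split => //; apply: le_rintegrable hg.
  exact: measurable_funX.
by move=> x; rewrite !normrX lerXn2r ?nnegrE.
Qed.

Lemma sq_integrable_norm f : sq_integrable f -> sq_integrable (fun x => `|f x|).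
Proof.
move=> hf; apply: (@le_sq_integrable _ f) => //.
  by apply: measurableT_comp => //; case: hf.
by move=> x; rewrite normr_id.
Qed.

Lemma sq_integrable_bounded_mul c h f : measurable_fun setT h ->
  (forall x, `|h x| <= c) -> sq_integrable f -> sq_integrable (fun x => h x * f x).
Proof.
move=> mh hc hf; apply: (@le_sq_integrable _ (fun x => c * f x)).
- by apply: measurable_funM => //; case: hf.
- by move=> x; rewrite !normrM ler_wpM2r// (le_trans (hc x))// ler_norm.
- exact: sq_integrableZ.
Qed.

Lemma ae_sq_integrable f g : measurable_fun setT g ->
  {ae mu, forall x, f x = g x} -> sq_integrable f -> sq_integrable g.
Proof.
move=> mg fg [mf hf]; split => //; apply: ae_rintegrable hf.
  exact: measurable_funX.
by apply: filterS fg => x ->.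
Qed.

Lemma sq_integrable_sum (I : Type) (s : seq I) (F : I -> X -> R) :
  (forall i, sq_integrable (F i)) -> sq_integrable (fun x => \sum_(i <- s) F i x).
Proof.
move=> hF; elim: s => [|i s IH].
  under eq_fun do rewrite big_nil; split; first exact: measurable_cst.
  by under eq_fun do rewrite expr0n/=; exact: rintegrable0.
by under eq_fun do rewrite big_cons; exact: sq_integrableD.
Qed.

Section finite.
Hypothesis muT : (mu setT < +oo)%E.

Lemma rintegrable_cst c : rintegrable (fun=> c).
Proof.
apply/rintegrableP; first exact: measurable_cst.
rewrite (integral_cst mu measurableT); apply: lte_mul_pinfty => //.
Qed.

Lemma sq_integrable_cst c : sq_integrable (fun=> c).
Proof. by split; [exact: measurable_cst|exact: rintegrable_cst]. Qed.

Lemma sq_integrable_r f : sq_integrable f -> rintegrable f.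
Proof.
move=> hf; have := sq_integrable_rM (sq_integrable_cst 1) hf.
by under eq_fun do rewrite mul1r.
Qed.

Lemma Rint_cst c : \int[mu]_x c = c * fine (mu setT).
Proof. by rewrite Rintegral_cst. Qed.

(** Cauchy-Schwarz against the constant 1: expand \int (f - c)^2 >= 0 at the mean c = I / m. *)
Lemma sqr_Rint_le f : sq_integrable f ->
  (\int[mu]_x f x) ^+ 2 <= fine (mu setT) * \int[mu]_x f x ^+ 2.
Proof.
move=> hf; have hf1 := sq_integrable_r hf; have [mf hf2] := hf.
set m := fine _; set I := \int[mu]_x f x; set J := \int[mu]_x _.
have m0 : 0 <= m by rewrite fine_ge0.
have J0 : 0 <= J by apply: Rint_ge0 => x; exact: sqr_ge0.
have H c : 0 <= J - 2 * c * I + c ^+ 2 * m.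
  have : 0 <= \int[mu]_x (f x - c) ^+ 2 by apply: Rint_ge0 => x; exact: sqr_ge0.
  rewrite (@eq_Rintegral _ _ _ _ _ (fun x => (f x ^+ 2 - 2 * c * f x) + c ^+ 2)); last first.
    by move=> x _; ring.
  rewrite RintD; last 2 first.
  - by apply: rintegrableB => //; exact: rintegrableZ.
  - exact: rintegrable_cst.
  rewrite RintB//; last exact: rintegrableZ.
  by rewrite RintZ// Rint_cst.
have [m00|m00] := eqVneq m 0.
  have : I = 0.
    (* For m = 0 the expansion is affine in c, and this c gives it the value -1. *)
    apply/eqP/negPn/negP => I0; have := H ((J + 1) / (2 * I)).
    rewrite m00 mulr0 addr0 (_ : _ - _ = -1) ?ler0N1//; field; exact: I0.
  by move=> ->; rewrite m00 mul0r expr0n.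
have mp : 0 < m by rewrite lt_neqAle eq_sym m00.
have := H (I / m); rewrite -(pmulr_rge0 _ mp).
have -> : m * (J - 2 * (I / m) * I + (I / m) ^+ 2 * m) = m * J - I ^+ 2 by field.
by rewrite subr_ge0.
Qed.

End finite.
End rintegrable.

Section real_fubini.
Context d1 d2 (X : measurableType d1) (Y : measurableType d2) {R : realType}.
Variables (m1 : {sigma_finite_measure set X -> \bar R})
  (m2 : {sigma_finite_measure set Y -> \bar R}).
Implicit Types f : X * Y -> R.

(** An inner integral is finite only almost everywhere; elsewhere [fine] substitutes a default
    value, which changes G on a null set. *)
Let fine_Rint d (Z : measurableType d) (m : {measure set Z -> \bar R}) (G : Z -> \bar R) :
  m.-integrable setT G ->
  rintegrable m (fine \o G) /\ (\int[m]_z fine (G z))%:E = (\int[m]_z G z)%E.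
Proof.
move=> iG; have mG := measurable_int m iG.
have ae : {ae m, forall z, (fine (G z))%:E = G z}.
  have := integrable_ae measurableT iG; apply: filterS => z /(_ I) h.
  by rewrite fineK.
have mf : measurable_fun setT (fine \o G) by exact: measurableT_comp.
have ig : rintegrable m (fine \o G).
  apply/integrableP; split; first exact/measurable_EFinP.
  move/integrableP : (iG) => [_]; apply: le_lt_trans.
  apply: ae_ge0_le_integral => //.
  - by apply: measurableT_comp => //; exact/measurable_EFinP.
  - by apply: measurableT_comp.
  - apply: filterS ae => z h _.
    by change (`|(fine (G z))%:E| <= `|G z|)%E; rewrite h.
split => //; rewrite (EFin_Rint ig); apply: ae_eq_integral => //.
  exact/measurable_EFinP.
by apply: filterS ae => z h _.
Qed.

Let integrable_fubini_G f : rintegrable (m1 \x m2)%E f ->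
  m2.-integrable setT (fubini_G m1 (EFin \o f)).
Proof.
move=> hf; apply/integrableP; split; first exact: (measurable_fubini_G hf).
have mf := measurable_int _ hf.
have h21 : (\int[m2]_y \int[m1]_x `|(EFin \o f) (x, y)| < +oo)%E by apply/integrable21ltyP.
apply: (le_lt_trans _ h21); apply: ge0_le_integral => //.
- by apply: measurableT_comp => //; exact: (measurable_fubini_G hf).
- apply: (measurable_fun_fubini_tonelli_G (fun z => `|(EFin \o f) z|%E)) => //.
  exact: measurableT_comp.
- move=> y _; apply: le_abse_integral => //.
  exact: measurableT_comp.
Qed.

Lemma rintegrable_fubini2 f : rintegrable (m1 \x m2)%E f ->
  rintegrable m2 (fun y => \int[m1]_x f (x, y)).
Proof. by move=> hf; have [] := fine_Rint (integrable_fubini_G hf). Qed.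

Lemma Rint_fubini2 f : rintegrable (m1 \x m2)%E f ->
  \int[(m1 \x m2)%E]_z f z = \int[m2]_y (\int[m1]_x f (x, y)).
Proof.
move=> hf; have [_] := fine_Rint (integrable_fubini_G hf).
rewrite (integral21_prod_meas1 hf) => h; exact/esym/(congr1 fine h).
Qed.

Lemma rintegrable_fubini1 f : rintegrable (m1 \x m2)%E f ->
  rintegrable m1 (fun x => \int[m2]_y f (x, y)).
Proof. by move=> hf; have [] := fine_Rint (integrable_fubini_F hf). Qed.

Lemma Rint_fubini1 f : rintegrable (m1 \x m2)%E f ->
  \int[(m1 \x m2)%E]_z f z = \int[m1]_x (\int[m2]_y f (x, y)).
Proof.
move=> hf; have [_] := fine_Rint (integrable_fubini_F hf).
rewrite (integral12_prod_meas1 hf) => h; exact/esym/(congr1 fine h).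
Qed.

End real_fubini.

Lemma sum_norm_le_total_variation (R : realType) (F : R -> R) (p : nat -> R) n :
  {homo p : i j / (i <= j)%N >-> i <= j} ->
  (\sum_(j < n) `|F (p j.+1) - F (p j)|%:E <= total_variation (p 0%N) (p n) F)%E.
Proof.
move=> hp; elim: n => [|n IH]; first by rewrite big_ord0 total_variation_ge0.
rewrite big_ord_recr/= (total_variationD F (hp _ _ (leq0n n)) (hp _ _ (leqnSn n))).
by apply: leeD => //; apply: total_variation_ge; exact: hp.
Qed.

(** * Total variation of the indefinite integral along a path *)

Section clock_cells.
Context {R : realType} {T : {posnum R}} (V : clock T) (s : timeI T).
Implicit Types (g : timeI T -> R) (t r : timeI T).

Local Notation mesh := (@mesh R T).

Lemma clk_finite : (clk V s setT < +oo)%E.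
Proof. by rewrite -ge0_fin_numE// fin_num_measure. Qed.

Definition cumul g t : R := \int[clk V s]_(r in upto t) g r.

Lemma cumul_tmax g : cumul g tmax = \int[clk V s]_r g r.
Proof. by rewrite /cumul upto_tmax. Qed.

Lemma idx_lt k r : (idx k r < 2 ^ k)%N.
Proof.
have := tval_ge0 r; rewrite le_eqVlt => /predU1P[/esym r0|r0].
  by rewrite idx0// expn_gt0.
have /andP[h _] := idxP k r0; rewrite ltnNge; apply/negP => kr.
have : mesh k * (2 ^ k)%:R < T%:num.
  apply: (le_lt_trans _ (lt_le_trans h (tval_le r))).
  by rewrite ler_pM2l ?mesh_gt0// ler_nat.
by rewrite /mesh natrX divfK ?ltxx// expf_neq0.
Qed.

Lemma le_grid k j r : (tval r <= tval (grid k j : timeI T)) = (tval r <= mesh k * j%:R).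
Proof.
have mj : 0 <= mesh k * j%:R by rewrite mulr_ge0// ltW// mesh_gt0.
by rewrite /= (max_idPr _) ?le_min ?mj//= tval_le andbT.
Qed.

Lemma ae_neq_tmin (Q : timeI T -> Prop) : (forall r, r <> tmin -> Q r) ->
  {ae clk V s, forall r, Q r}.
Proof.
move=> h; exists [set tmin]; split => //.
- exists [set 0]; first exact: measurable_real1.
  by rewrite setTI; apply/seteqP; split => y /= => [y0|->//]; apply: tval_inj.
- exact: clk_set1.
- by move=> r /= nQ; apply: contrapT => /h.
Qed.

Lemma measurable_oc (p q : R) : measurable [set r : timeI T | (p < tval r)%R && (tval r <= q)%R].
Proof.
have [_ _ _ h1] := @measurable_time_ray R T p; have [h2 _ _ _] := @measurable_time_ray R T q.
rewrite (_ : mkset _ = [set r : timeI T | p < tval r] `&` [set r : timeI T | tval r <= q]); first exact: measurableI.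
by apply/seteqP; split => x /= => [/andP[]|[-> ->]].
Qed.

(** The cell is the half-open interval between two grid points, except that the cell of index 0 also
    contains time 0, which is null. *)
Lemma cell_Rint g k j : rintegrable (clk V s) g ->
  \int[clk V s]_(r in [set r | idx k r = j]) g r = cumul g (grid k j.+1) - cumul g (grid k j).
Proof.
move=> hg; pose C := [set r : timeI T | (mesh k * j%:R < tval r)%R && (tval r <= mesh k * j.+1%:R)%R].
have mC : measurable C by exact: measurable_oc.
have -> : \int[clk V s]_(r in [set r | idx k r = j]) g r = \int[clk V s]_(r in C) g r.
  have mg := rintegrable_measurable hg.
  rewrite [LHS]Rint_indic [RHS]Rint_indic; apply: ae_eq_Rint; try apply: measurable_funM => //.
    by apply: measurable_indic; exact: measurable_idx.
  apply: ae_neq_tmin => r rt; congr (_ * _).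
  have r0 : 0 < tval r.
    by rewrite lt_neqAle tval_ge0 andbT eq_sym; apply/eqP => re; apply/rt/tval_inj.
  rewrite !indicE; congr (nat_of_bool _)%:R; apply/idP/idP; rewrite !inE/=.
    by move=> rj; rewrite /C /= -rj; exact: idxP.
  by move=> h; exact: idx_uniq.
have mj : mesh k * j%:R <= mesh k * j.+1%:R.
  by rewrite ler_pM2l ?mesh_gt0// ler_nat.
have UE : upto (grid k j.+1) = upto (grid k j) `|` C.
  apply/seteqP; split => r; rewrite /upto /C /= !le_grid.
    by move=> h; have [a|a] := leP (tval r) (mesh k * j%:R); [left|right].
  by move=> [h|/andP[]//]; exact: le_trans mj.
have dj : [disjoint upto (grid k j) & C].
  apply/disj_setPS => r; rewrite /upto /C /= le_grid => -[h /andP[]].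
  by rewrite ltNge h.
have mU : measurable (upto (grid (T := T) k j)) by exact: measurable_upto.
rewrite /cumul UE Rintegral_setU//; first by rewrite addrC addKr.
by apply: integrableS hg => //; exact: measurableU.
Qed.

Lemma Rint_cells k (b : nat -> R) g : rintegrable (clk V s) g ->
  \int[clk V s]_r (b (idx k r) * g r) =
  \sum_(j < 2 ^ k) b j * (cumul g (grid k j.+1) - cumul g (grid k j)).
Proof.
move=> hg; have mI j : measurable [set r : timeI T | idx k r = j] by exact: measurable_idx.
have ij j : rintegrable (clk V s) (fun r => \1_[set r | idx k r = j] r * g r).
  exact: rintegrable_indic.
transitivity (\sum_(j < 2 ^ k) \int[clk V s]_r (b j * (\1_[set r | idx k r = j] r * g r))); last first.
  by apply: eq_bigr => j _; rewrite (RintZ (b j) (ij j)) -cell_Rint// -Rint_indic.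
rewrite -Rint_sum; last by move=> j; exact: rintegrableZ.
apply: eq_Rintegral => r _; rewrite (bigD1 (Ordinal (idx_lt k r)))//=.
rewrite big1 ?addr0 ?indicE ?mem_set ?mul1r// => j jr.
rewrite indicE memNset ?mul0r ?mulr0//= => rj.
by move/eqP: jr; apply; apply: val_inj.
Qed.

Lemma rintegrable_cells k (b : nat -> R) g : rintegrable (clk V s) g ->
  rintegrable (clk V s) (fun r => b (idx k r) * g r).
Proof.
move=> hg; have mI j : measurable [set r : timeI T | idx k r = j] by exact: measurable_idx.
apply: (@eq_rintegrable _ _ _ _ (fun r => \sum_(j < 2 ^ k) b j * (\1_[set r | idx k r = j] r * g r))).
  move=> r; rewrite (bigD1 (Ordinal (idx_lt k r)))//=.
  rewrite big1 ?addr0 ?indicE ?mem_set ?mul1r// => j jr.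
  rewrite indicE memNset ?mul0r ?mulr0//= => rj.
  by move/eqP: jr; apply; apply: val_inj.
by apply: rintegrable_sum => j; apply: rintegrableZ; exact: rintegrable_indic.
Qed.

(** The integral of a step function is the sum of b_j times the increments of the indefinite
    integral; with |b_j| <= 1 it is at most a variation sum over the grid. *)
Lemma norm_Rint_cells_le_TV k (b : nat -> R) g : rintegrable (clk V s) g ->
  (forall j, `|b j| <= 1) ->
  ((\int[clk V s]_r (b (idx k r) * g r))%:E <=
   total_variation 0 T%:num (fun r : R => cumul g (clamp r)))%E.
Proof.
move=> hg hb; rewrite Rint_cells//.
have := @sum_norm_le_total_variation R (fun r : R => cumul g (clamp r)) (fun j => mesh k * j%:R) (2 ^ k)%N.
rewrite mulr0 {1}/mesh natrX divfK ?expf_neq0//.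
have hm : {homo (fun j => mesh k * j%:R) : i j / (i <= j)%N >-> i <= j}.
  by move=> i j ij; rewrite ler_pM2l ?mesh_gt0// ler_nat.
move=> /(_ hm); apply: le_trans; rewrite sumEFin lee_fin; apply: ler_sum => j _.
apply: (le_trans (ler_norm _)); rewrite normrM -[leRHS]mul1r ler_wpM2r//.
Qed.

End clock_cells.

Section pathwise_total_variation.
Context {R : realType} {T : {posnum R}} {E : ptopologicalType} (hE : polish R E).
Variables (V : clock T) (s : timeI T).

(** Under a Dirac mass at w only the section at w counts, so approximation by elementary sets
    becomes approximation by unions of time cells along the single path w. *)
Lemma product_diracE (w : cpath T E) (A : set (timeI T * cpath T E)) : measurable A ->
  (clk V s \x \d_w)%E A = clk V s (ysection A w).
Proof.
move=> mA; transitivity (\int[clk V s \x \d_w]_z (\1_A z)%:E)%E.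
  by rewrite integral_indic// setIT.
rewrite fubini_tonelli2//; last by apply/measurable_EFinP; exact: measurable_indic.
rewrite integral_dirac//; last first.
  apply: (measurable_fun_fubini_tonelli_G (fun z => (\1_A z)%:E)) => //.
  by apply/measurable_EFinP; exact: measurable_indic.
rewrite diracT mul1e /fubini_G.
transitivity (\int[clk V s]_r (\1_(ysection A w) r)%:E)%E.
  by apply: eq_integral => r _; rewrite !indicE mem_ysection.
by rewrite integral_indic ?setIT//; exact: measurable_ysection.
Qed.

(* The sign of h along the path is approximated by a step function of time. *)
Lemma norm_le_total_variation (h : timeI T * borel E -> R) (w : cpath T E) :
  measurable_fun setT h -> rintegrable (clk V s) (fun r => h (r, w r)) ->
  (\int[clk V s]_r `|h (r, w r)|%:E <=
   total_variation 0 T%:num (fun r : R => cumul V s (fun r => h (r, w r)) (clamp r)))%E.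
Proof.
move=> mh; set g := fun r => h (r, w r) => hg.
rewrite -EFin_Rint; last exact: rintegrable_norm.
apply/lee_addgt0Pr => e e0; have e2 : 0 < e / 2 by rewrite divr_gt0.
have [d [d0 dP]] := integral_normr_continuous hg e2.
pose C := [set z | 0 <= h z].
have mC : measurable C.
  have := mh measurableT _ (measurable_itv `[0, +oo[%R); rewrite setTI.
  by congr measurable; apply/seteqP; split => z /=; rewrite in_itv/= andbT.
have [mGC /(_ d d0)[D [k [S [hS DE]]] sd]] := approximable_graph hE V s \d_w mC.
have mD : measurable D.
  by apply: elementary_measurable; rewrite DE; exists k, S.
have mS := measurable_sdiff mGC mD.
set A := ysection (sdiff (graph @^-1` C) D) w.
have {}sd : (clk V s A < d%:E)%E by rewrite -product_diracE//; exact: sd.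
have mA : measurable A by exact: measurable_ysection.
have {}dP := dP A mA sd.
pose b j : R := if `[< S j w >] then 1 else -1.
have hb j : `|b j| <= 1 by rewrite /b; case: ifP; rewrite ?normrN ?normr1.
have := norm_Rint_cells_le_TV k hg hb; set TVF := total_variation _ _ _ => hTV.
apply: (@le_trans _ _ ((\int[clk V s]_r (b (idx k r) * g r))%:E + e%:E)%E); last exact: leeD.
rewrite -EFinD lee_fin.
(* Off A the step function b is the sign of g. On A it may be wrong, which costs at most 2 |g|; A is
   small enough for the integral of |g| over it to be below e/2. *)
apply: (@le_trans _ _ (\int[clk V s]_r (b (idx k r) * g r + 2 * (\1_A r * `|g r|)))).
  have ig : rintegrable (clk V s) (fun r => `|g r|) by exact: rintegrable_norm.
  apply: le_Rint => //.
    apply: rintegrableD; first exact: rintegrable_cells.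
    by apply: rintegrableZ; exact: rintegrable_indic.
  move=> r; rewrite indicE.
  have [rA|rA] := boolP (r \in A).
    rewrite mul1r; have : `|b (idx k r) * g r| <= `|g r|.
      by rewrite normrM -[leRHS]mul1r ler_wpM2r.
    by rewrite ler_norml => /andP[h1 _]; lra.
  rewrite mul0r mulr0 addr0 /b.
  have nA : ~ sdiff (graph @^-1` C) D (r, w).
    by move=> h1; move/negP: rA; apply; rewrite inE /A ysectionE.
  have [Srw|Srw] := asboolP (S (idx k r) w).
    have : C (graph (r, w)) by apply: contrapT => nC; apply: nA; right; split => //; rewrite DE.
    by rewrite /C /graph/= => gr; rewrite mul1r ger0_norm.
  have : ~ C (graph (r, w)) by move=> Cg; apply: nA; left; split => //; rewrite DE.
  by rewrite /C /graph/= => /negP; rewrite -ltNge => gr; rewrite mulN1r ltr0_norm.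
have ig : rintegrable (clk V s) (fun r => `|g r|) by exact: rintegrable_norm.
rewrite RintD; last 2 first.
- exact: rintegrable_cells.
- by apply: rintegrableZ; exact: rintegrable_indic.
rewrite lerD2l RintZ; last exact: rintegrable_indic.
by rewrite -Rint_indic; move: dP; lra.
Qed.

End pathwise_total_variation.

(** * Martingale increments *)

Section simple_approximation.
Context d (X : measurableType d) {R : realType}.
Implicit Types f : X -> R.

(** The explicit form keeps the sets visible, so that each can be replaced by an elementary one with
    the same coefficient. *)
Definition is_simple f := exists n (c : nat -> R) (A : nat -> set X),
  (forall i, measurable (A i)) /\ f = (fun x => \sum_(i < n) c i * \1_(A i) x).

Import HBNNSimple.

Lemma is_simple_nnsfun (f : {nnsfun X >-> R}) : is_simple f.
Proof.
pose s := finmap.enum_fset (fset_set (range f)).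
exists (size s), (fun i => s`_i), (fun i => f @^-1` [set s`_i]); split.
  by move=> i; rewrite -[X in measurable X]setTI; exact: measurable_funP.
apply/funext => x; rewrite fimfunE fsbig_finite//= (big_nth 0) big_mkord.
by [].
Qed.

Lemma simple_approx f : measurable_fun setT f -> (forall x, 0 <= f x) ->
  exists fn : nat -> X -> R,
    [/\ forall n, is_simple (fn n), forall n x, 0 <= fn n x <= f x,
        forall x, nondecreasing_seq (fn ^~ x) &
        forall x, fn ^~ x @ \oo --> f x].
Proof.
move=> mf f0; have mEf : measurable_fun setT (EFin \o f) by exact/measurable_EFinP.
have cv x : nnsfun_approx measurableT mEf ^~ x @ \oo --> f x.
  have : EFin \o nnsfun_approx measurableT mEf ^~ x @ \oo --> (f x)%:E.
    by apply: cvg_nnsfun_approx => // y _; rewrite /= lee_fin.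
  by move=> /fine_cvgP[_].
have nd x : nondecreasing_seq (nnsfun_approx measurableT mEf ^~ x).
  by move=> m n mn; exact: (lefP _ _ (nd_nnsfun_approx measurableT mEf mn) x).
exists (nnsfun_approx measurableT mEf); split => //.
- by move=> n; exact: is_simple_nnsfun.
- move=> n x; apply/andP; split; first exact: fun_ge0.
  have := nondecreasing_cvgn_le (nd x) (cvgP _ (cv x)) n.
  by rewrite (cvg_lim _ (cv x)).
Qed.

Lemma is_simple_measurable f : is_simple f -> measurable_fun setT f.
Proof.
move=> [n [c [A [mA ->]]]]; apply: measurable_sum => i.
by apply: measurable_funM => //; exact: measurable_indic.
Qed.

End simple_approximation.

Section dominated.
Context d (X : measurableType d) {R : realType} (mu : {measure set X -> \bar R}).

Lemma Rint_dominated_cvg (fn : nat -> X -> R) (f g : X -> R) :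
  (forall n, measurable_fun setT (fn n)) -> (forall x, fn ^~ x @ \oo --> f x) ->
  rintegrable mu g -> (forall n x, `|fn n x| <= g x) ->
  \int[mu]_x fn n x @[n --> \oo] --> \int[mu]_x f x.
Proof.
move=> mfn cv ig fg.
have := @dominated_cvg _ X R mu setT measurableT (fun n => EFin \o fn n) (EFin \o f) (EFin \o g).
have i0 : forall n, measurable_fun setT (EFin \o fn n) by move=> n; exact/measurable_EFinP.
have if_ : rintegrable mu f.
  have mf : measurable_fun setT f by exact: (measurable_fun_cvg mfn).
  apply: le_rintegrable ig => // x; rewrite (le_trans _ (ler_norm _))//.
  have : `|fn n x| @[n --> \oo] --> `|f x| by exact: cvg_norm.
  by move=> /cvgr_to_le; apply; apply: nearW => n.
move=> /(_ i0) H.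
have {}H : ((\int[mu]_x (fn n x)%:E)%E @[n --> \oo] --> (\int[mu]_x (f x)%:E)%E).
  apply: H => //.
  - by move=> x _; apply: cvg_EFin; [exact: nearW|exact: cv].
  - by move=> n x _; rewrite lee_fin.
move: H; rewrite -(EFin_Rint if_) => /fine_cvgP[_].
by apply.
Qed.

End dominated.

Section condexp.
Context d {U : measurableType d} {R : realType} (mu : {measure set U -> \bar R}).
Implicit Types (G : set (set U)) (W Y Z : U -> R).

Lemma measurable_wrtW G W : <<s G >> `<=` measurable -> measurable_wrt G W ->
  measurable_fun setT W.
Proof. by move=> sG mW _ B mB; apply: sG; exact: mW. Qed.

(** The weight W may be unbounded. D = Y - Z integrates to 0 against indicators of G, hence against
    simple functions; dominated convergence with the bound |W D| extends this to every G-measurable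
    weight between 0 and |W|, in particular to the positive and negative parts of W. *)
Lemma condexp_mul G W Y Z : <<s G >> `<=` measurable ->
  is_condexp mu G Y Z -> measurable_wrt G W ->
  rintegrable mu (fun x => W x * Y x) -> rintegrable mu (fun x => W x * Z x) ->
  \int[mu]_x (W x * Y x) = \int[mu]_x (W x * Z x).
Proof.
move=> sG [iY iZ mZ YZ] mW iWY iWZ.
have mW' := measurable_wrtW sG mW.
pose D x := Y x - Z x.
have iD : rintegrable mu D by exact: rintegrableB.
have iWD : rintegrable mu (fun x => W x * D x).
  apply: eq_rintegrable (rintegrableB iWY iWZ) => x.
  by rewrite /D mulrBr.
have D0 A : <<s G >> A -> \int[mu]_x (\1_A x * D x) = 0.
  move=> GA; have mA := sG _ GA.
  have iYA : rintegrable mu (fun x => \1_A x * Y x) by exact: rintegrable_indic.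
  have iZA : rintegrable mu (fun x => \1_A x * Z x) by exact: rintegrable_indic.
  under eq_Rintegral do rewrite /D mulrBr.
  rewrite RintB// -!Rint_indic /Rintegral.
  by have /= -> := YZ _ GA; rewrite subrr.
suff W0 (W' : U -> R) : measurable_wrt G W' -> (forall x, 0 <= W' x <= `|W x|) ->
    \int[mu]_x (W' x * D x) = 0.
  have mWp : measurable_wrt G (fun x => Num.max (W x) 0).
    by apply: measurable_maxr => //; exact: measurable_cst.
  have mWn : measurable_wrt G (fun x => Num.max (- W x) 0).
    by apply: measurable_maxr; [exact: measurable_funN|exact: measurable_cst].
  have bp x : 0 <= Num.max (W x) 0 <= `|W x|.
    by rewrite le_max lexx orbT/= ge_max ler_norm normr_ge0.
  have bn x : 0 <= Num.max (- W x) 0 <= `|W x|.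
    by rewrite le_max lexx orbT/= ge_max -normrN ler_norm normr_ge0.
  have ip (W' : U -> R) : measurable_wrt G W' -> (forall x, 0 <= W' x <= `|W x|) ->
      rintegrable mu (fun x => W' x * D x).
    move=> /(measurable_wrtW sG) mW1 b1; apply: le_rintegrable iWD.
      by apply: measurable_funM => //; exact: rintegrable_measurable iD.
    move=> x; have /andP[h1 h2] := b1 x.
    by rewrite !normrM ler_wpM2r// ger0_norm.
  apply/eqP; rewrite -subr_eq0 -RintB//; apply/eqP.
  rewrite (@eq_Rintegral _ _ _ _ _ (fun x => Num.max (W x) 0 * D x - Num.max (- W x) 0 * D x)); last first.
    move=> x _; rewrite -mulrBl -mulrBr; congr (_ * _).
    by case: (leP (W x) 0) => h; case: (leP (- W x) 0) => h'; lra.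
  by rewrite RintB ?W0 ?subr0//; exact: ip.
move=> mW1 b1.
have [fn [sfn bfn _ cfn]] := @simple_approx _ (g_sigma_algebraType G) R W' mW1 (fun x => proj1 (andP (b1 x))).
have mfn n : measurable_fun [set: U] (fn n : U -> R).
  exact: (@measurable_wrtW G (fn n) sG (is_simple_measurable (sfn n))).
have fn0 n : \int[mu]_x (fn n x * D x) = 0.
  have [m [c [A [mA ->]]]] := sfn n.
  under eq_Rintegral do rewrite mulr_suml.
  rewrite Rint_sum; last first.
    move=> i; apply: eq_rintegrable (rintegrableZ (c i) (rintegrable_indic (sG _ (mA i)) iD)) => x.
    by rewrite mulrA.
  apply: big1 => i _; under eq_Rintegral do rewrite -mulrA.
  by rewrite (RintZ (c i) (rintegrable_indic (@sG _ (mA i)) iD)) (D0 _ (mA i)) mulr0.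
have := @Rint_dominated_cvg _ U R mu (fun n x => fn n x * D x) (fun x => W' x * D x) (fun x => `|W x * D x|).
have H1 n : measurable_fun [set: U] (fun x : U => fn n x * D x).
  exact: measurable_funM (mfn n) (rintegrable_measurable iD).
have H2 (x : U) : fn n x * D x @[n --> \oo] --> W' x * D x.
  by apply: cvgM; [exact: cfn|exact: cvg_cst].
have H3 n (x : U) : `|fn n x * D x| <= `|W x * D x|.
  rewrite !normrM ler_wpM2r//; have /andP[h1 h2] := bfn n x.
  have /andP[_ h3] := b1 x.
  by rewrite ger0_norm// (le_trans h2).
move=> /(_ H1 H2 (rintegrable_norm iWD) H3).
rewrite (_ : (fun n => \int[mu]_x (fn n x * D x)) = fun=> 0); last exact/funext.
by move=> /(cvg_lim (@norm_hausdorff _ _)) <-; rewrite lim_cst.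
Qed.

Lemma condexp_indic G A Y Z : <<s G >> `<=` measurable -> is_condexp mu G Y Z ->
  <<s G >> A -> \int[mu]_x (\1_A x * Y x) = \int[mu]_x (\1_A x * Z x).
Proof.
move=> sG [iY iZ mZ YZ] GA; rewrite -!Rint_indic /Rintegral.
by have /= -> := YZ _ GA.
Qed.

End condexp.

Section covariation.
Context {R : realType} {T : {posnum R}} d {U : measurableType d}.
Variables (mu : {measure set U -> \bar R}) (F : timeI T -> set (set U)).
Implicit Types (M N B : timeI T -> U -> R) (s p q t : timeI T).
Hypothesis sF : forall t, <<s F t >> `<=` measurable.

Lemma measurable_wrtM G (W Y : U -> R) : measurable_wrt G W -> measurable_wrt G Y ->
  measurable_wrt G (fun x => W x * Y x).
Proof. exact: measurable_funM. Qed.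

Lemma cadlag_sq_martingale_sq s M t : cadlag_sq_martingale_from mu F s M ->
  tval s <= tval t -> sq_integrable mu (M t).
Proof.
move=> [_ [iM _] sqM] st; have [_ /rintegrable_measurable mM] := iM _ st.
split => //; apply/rintegrableP; first exact: measurable_funX.
under eq_integral do rewrite ger0_norm ?sqr_ge0//.
exact: sqM.
Qed.

(** Conditioning at p gives the cross terms M_p N_q and M_q N_p the weighted mean of M_p N_p. The
    weights W M_p and W N_p are unbounded, hence the generality of [condexp_mul]. *)
Lemma martingale_mul s M N p q W : cadlag_sq_martingale_from mu F s M ->
  cadlag_sq_martingale_from mu F s N ->
  tval s <= tval p -> tval p <= tval q ->
  measurable_wrt (F p) W -> (exists c : R, forall x, `|W x| <= c) ->
  \int[mu]_x (W x * ((M q x - M p x) * (N q x - N p x))) =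
  \int[mu]_x (W x * (M q x * N q x)) - \int[mu]_x (W x * (M p x * N p x)).
Proof.
move=> hM hN sp pq mW [c Wc]; have sq := le_trans sp pq.
have mW' := measurable_wrtW (@sF p) mW.
have [Mp Mq Np Nq] : [/\ sq_integrable mu (M p), sq_integrable mu (M q),
    sq_integrable mu (N p) & sq_integrable mu (N q)].
  by split; [exact: (cadlag_sq_martingale_sq hM sp)|exact: (cadlag_sq_martingale_sq hM sq)
    |exact: (cadlag_sq_martingale_sq hN sp)|exact: (cadlag_sq_martingale_sq hN sq)].
have iW (f g : U -> R) : sq_integrable mu f -> sq_integrable mu g ->
    rintegrable mu (fun x => W x * (f x * g x)).
  by move=> hf hg; apply: rintegrable_bounded_mul Wc _ => //; exact: sq_integrable_rM.
have [_ [aM cM] _] := hM; have [_ [aN cN] _] := hN.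
have e1 : \int[mu]_x (W x * (M p x * N q x)) = \int[mu]_x (W x * (M p x * N p x)).
  have := condexp_mul (@sF p) (cN _ _ sp pq) (measurable_wrtM mW (aM _ sp).1).
  under [X in rintegrable _ X -> _]eq_fun do rewrite -mulrA.
  under [X in _ -> rintegrable _ X -> _]eq_fun do rewrite -mulrA.
  move=> /(_ (iW _ _ Mp Nq) (iW _ _ Mp Np)).
  by under eq_Rintegral do rewrite -mulrA; under [RHS]eq_Rintegral do rewrite -mulrA.
have e2 : \int[mu]_x (W x * (M q x * N p x)) = \int[mu]_x (W x * (M p x * N p x)).
  have := condexp_mul (@sF p) (cM _ _ sp pq) (measurable_wrtM mW (aN _ sp).1).
  under [X in rintegrable _ X -> _]eq_fun do rewrite -mulrA [X in _ * X]mulrC.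
  under [X in _ -> rintegrable _ X -> _]eq_fun do rewrite -mulrA [X in _ * X]mulrC.
  move=> /(_ (iW _ _ Mq Np) (iW _ _ Mp Np)).
  by under eq_Rintegral do rewrite -mulrA [X in _ * X]mulrC; under [RHS]eq_Rintegral do rewrite -mulrA [X in _ * X]mulrC.
rewrite (@eq_Rintegral _ _ _ _ _ (fun x => (W x * (M q x * N q x) - W x * (M p x * N q x)) -
   (W x * (M q x * N p x) - W x * (M p x * N p x)))); last by move=> x _; ring.
rewrite RintB; last 2 first.
- by apply: rintegrableB; exact: iW.
- by apply: rintegrableB; exact: iW.
by rewrite !RintB ?e1 ?e2 ?subrr ?subr0//; exact: iW.
Qed.

(** MN - B being a martingale, the weighted increments of MN and B have equal means;
    [martingale_mul] rewrites the former as products of increments. *)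
Lemma martingale_bracket s M N B p q W : cadlag_sq_martingale_from mu F s M ->
  cadlag_sq_martingale_from mu F s N ->
  martingale_from mu F s (fun t x => M t x * N t x - B t x) ->
  tval s <= tval p -> tval p <= tval q ->
  measurable_wrt (F p) W -> (exists c : R, forall x, `|W x| <= c) ->
  [/\ rintegrable mu (B p), rintegrable mu (B q) &
  \int[mu]_x (W x * ((M q x - M p x) * (N q x - N p x))) =
  \int[mu]_x (W x * (B q x - B p x))].
Proof.
move=> hM hN [aMB cMB] sp pq mW hW; have [c Wc] := hW; have sq := le_trans sp pq.
have mW' := measurable_wrtW (@sF p) mW.
have iMN t : tval s <= tval t -> rintegrable mu (fun x => M t x * N t x).
  by move=> st; apply: sq_integrable_rM; [exact: (cadlag_sq_martingale_sq hM st)|exact: (cadlag_sq_martingale_sq hN st)].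
have iB t : tval s <= tval t -> rintegrable mu (B t).
  move=> st; have := rintegrableB (iMN _ st) (aMB _ st).2.
  by apply: eq_rintegrable => x; ring.
have iW (f : U -> R) : rintegrable mu f -> rintegrable mu (fun x => W x * f x).
  by move=> hf; apply: rintegrable_bounded_mul Wc _.
split; [exact: iB|exact: iB|].
rewrite (martingale_mul hM hN sp pq mW hW).
have := condexp_mul (@sF p) (cMB _ _ sp pq) mW (iW _ (aMB _ sq).2) (iW _ (aMB _ sp).2).
have ex t : tval s <= tval t -> \int[mu]_x (W x * (M t x * N t x - B t x)) =
    \int[mu]_x (W x * (M t x * N t x)) - \int[mu]_x (W x * B t x).
  move=> st; under eq_Rintegral do rewrite mulrBr.
  by rewrite RintB//; apply: iW; [exact: iMN|exact: iB].
rewrite !ex// => h.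
have -> : \int[mu]_x (W x * (B q x - B p x)) =
    \int[mu]_x (W x * B q x) - \int[mu]_x (W x * B p x).
  under eq_Rintegral do rewrite mulrBr.
  by rewrite RintB//; apply: iW; exact: iB.
by move: h; lra.
Qed.

End covariation.

(** The integral of a nonnegative function is a supremum over simple functions below it, so
    monotonicity asks for no measurability. *)
Lemma ge0_le_integral_nm d (X : measurableType d) (R : realType)
    (mu : {measure set X -> \bar R}) (f g : X -> \bar R) :
  (forall x, 0 <= f x)%E -> (forall x, f x <= g x)%E ->
  (\int[mu]_x f x <= \int[mu]_x g x)%E.
Proof.
move=> f0 fg; have g0 x : (0 <= g x)%E by exact: le_trans (fg x).
rewrite !ge0_integralTE//; apply: ereal_sup_le => _ [h hf <-].
by exists h => // x; exact: le_trans (fg x).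
Qed.

(** * The completed path space *)

Section completion.
Context {R : realType} {T : {posnum R}} {E : ptopologicalType}.
Variables (Pr : timeI T -> E -> probability (cpath T E) R) (s : timeI T) (x : E).
Implicit Types (A : set (cpath T E)) (f g : cpath T E -> R).

Local Notation Pc := (Prc Pr s x).
Local Notation Omega := (caratheodory_type (mu_ext (Pr s x))).

Lemma Prc_measurable A : measurable A -> measurable (A : set Omega).
Proof. exact: caratheodory_measurable_mu_ext. Qed.

Lemma PrcE A : measurable A -> Pc A = Pr s x A.
Proof. by move=> mA; rewrite /Prc /completed_measure_extension measurable_mu_extE. Qed.

Lemma negligible_Prc A : (Pr s x).-negligible A -> Pc.-negligible A.
Proof.
move=> [B [mB B0 AB]]; exists B; split => //; first exact: Prc_measurable.
by rewrite PrcE.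
Qed.

Lemma ae_Prc (Q : cpath T E -> Prop) : {ae Pr s x, forall w, Q w} ->
  {ae Pc, forall w, Q w}.
Proof.
move=> [B [mB B0 QB]]; exists B; split => //; first exact: Prc_measurable.
by rewrite PrcE.
Qed.

Lemma completed_filtration_sub t :
  <<s completed_filtration Pr s x t >> `<=` (measurable : set (set Omega)).
Proof.
apply: smallest_sub; first exact: sigma_algebra_measurable.
apply: smallest_sub; first exact: sigma_algebra_measurable.
move=> A [|/negligible_Prc]; last exact: measure_is_complete_caratheodory.
rewrite /canonical_filtration; case: ifPn => [tT FA|_]; last exact: Prc_measurable.
apply: Prc_measurable; apply: (@cylinders_measurable R T E tmax).
by apply: FA.
Qed.

Lemma completed_filtration_le p q : tval p <= tval q ->
  <<s completed_filtration Pr s x p >> `<=` <<s completed_filtration Pr s x q >>.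
Proof.
move=> pq; apply: sub_sigma_algebra2; apply: sub_sigma_algebra2 => A [FA|nA]; last by right.
left; move: FA; rewrite /canonical_filtration.
case: ifPn => pT; case: ifPn => qT //.
- by move=> FA r /= qr; apply: FA; exact: le_lt_trans qr.
- by move=> FA; apply: (@cylinders_measurable R T E tmax); exact: FA.
- by exfalso; move: pT; rewrite (le_lt_trans pq).
Qed.

Lemma cylinders_completed t : <<s cylinders t >> `<=` <<s completed_filtration Pr s x t >>.
Proof.
move=> A cA; do 2 apply: sub_gen_smallest; left; rewrite /canonical_filtration.
case: ifPn => tT; last exact: cylinders_measurable cA.
by move=> r /= tr; exact: (cylinders_le (ltW tr)).
Qed.

Lemma cylinders_measurable_wrt t f : measurable_wrt (cylinders t) f ->
  measurable_wrt (completed_filtration Pr s x t) f.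
Proof. by move=> mf _ B mB; apply: cylinders_completed; exact: mf. Qed.

Lemma measurable_fun_Prc d (Y : measurableType d) (f : cpath T E -> Y) :
  measurable_fun setT f -> measurable_fun [set: Omega] (f : Omega -> Y).
Proof. by move=> mf _ B mB; apply: Prc_measurable; exact: mf. Qed.

(** The identity is measurable from the completed to the raw space and pushes [Pc] forward to
    [Pr s x]. *)
Lemma ge0_integral_Prc (f : cpath T E -> \bar R) : measurable_fun setT f ->
  (forall w, 0 <= f w)%E -> (\int[Pc]_w f w = \int[Pr s x]_w f w)%E.
Proof.
move=> mf f0.
have mid : measurable_fun [set: Omega] (id : Omega -> cpath T E).
  exact: (@measurable_fun_Prc _ (cpath T E) id).
transitivity (\int[pushforward Pc (id : Omega -> cpath T E)]_w f w)%E.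
  by rewrite ge0_integral_pushforward.
by apply: eq_measure_integral => A mA _; change (Pc A = Pr s x A); exact: PrcE.
Qed.

Lemma rintegrable_Prc f : measurable_fun setT f ->
  rintegrable Pc f <-> rintegrable (Pr s x) f.
Proof.
move=> mf; have mf' := measurable_fun_Prc mf.
rewrite rintegrableP// (rintegrableP _ mf) ge0_integral_Prc//.
by apply/measurable_EFinP; exact: measurableT_comp.
Qed.

Lemma Rint_Prc f : measurable_fun setT f ->
  \int[Pc]_w f w = \int[Pr s x]_w f w.
Proof.
move=> mf; have mEf : measurable_fun setT (EFin \o f) by exact/measurable_EFinP.
rewrite /Rintegral; congr fine; rewrite integralE [RHS]integralE.
rewrite !ge0_integral_Prc//; [exact: measurable_funeneg|exact: measurable_funepos].
Qed.

Lemma sq_integrable_Prc f : measurable_fun setT f ->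
  sq_integrable Pc f <-> sq_integrable (Pr s x) f.
Proof.
move=> mf; have mf2 := measurable_funX 2 mf.
split => -[_ h]; split; [exact: mf|exact: (rintegrable_Prc mf2).1|
  exact: measurable_fun_Prc|exact: (rintegrable_Prc mf2).2].
Qed.

End completion.

(** * Drift integrals, compensated processes and their brackets *)

Section drift.
Context {R : realType} {T : {posnum R}} {E : ptopologicalType} (hE : polish R E).
Variables (V : clock T).
Implicit Types (h : timeI T * borel E -> R) (w : cpath T E) (s t : timeI T).

Lemma measurable_along_path h w : measurable_fun setT h ->
  measurable_fun setT (fun r => h (r, w r)).
Proof.
move=> mh; apply: (@measurableT_comp _ _ _ _ _ _ (fun z => h (graph z)) _ (fun r => (r, w))).
  by apply: measurableT_comp => //; exact: measurable_graph.
by apply: measurable_fun_pair => //; exact: measurable_cst.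
Qed.

Lemma drift_intE h s t w : measurable_fun setT h ->
  drift_int V h s t w = cumul V s (fun r => h (r, w r)) t.
Proof.
move=> mh; rewrite /drift_int clock_intE//.
by apply/measurable_EFinP; exact: measurable_along_path.
Qed.

Lemma measurable_Rint_clk d (U : measurableType d) s (F : timeI T * U -> R) : measurable_fun setT F ->
  measurable_fun setT (fun w : U => \int[clk V s]_r F (r, w)).
Proof.
move=> mF; have mEF : measurable_fun setT (EFin \o F) by exact/measurable_EFinP.
have step g : measurable_fun setT g -> (forall z, 0 <= g z)%E ->
    measurable_fun setT (fun w : U => \int[clk V s]_r g (r, w))%E.
  exact: (@measurable_fun_fubini_tonelli_G _ _ _ U R (clk V s)).
apply: (@measurableT_comp _ _ _ _ _ _ fine _ (fun w : U => (\int[clk V s]_r (F (r, w))%:E)%E)) => //.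
under eq_fun do rewrite integralE.
apply: emeasurable_funB.
- rewrite (_ : (fun _ => _) = fun w : U => (\int[clk V s]_r (EFin \o F)^\+ (r, w))%E).
    by apply: step; [exact: measurable_funepos|move=> z; exact: funepos_ge0].
  by apply/funext => w; apply: eq_integral => r _; rewrite !funeposE.
- rewrite (_ : (fun _ => _) = fun w : U => (\int[clk V s]_r (EFin \o F)^\- (r, w))%E).
    by apply: step; [exact: measurable_funeneg|move=> z; exact: funeneg_ge0].
  by apply/funext => w; apply: eq_integral => r _; rewrite !funenegE.
Qed.

Lemma measurable_path_fun h : measurable_fun setT h ->
  measurable_fun setT (along h).
Proof. by move=> mh; apply: measurableT_comp => //; exact: measurable_graph. Qed.

Lemma measurable_cumul h s t : measurable_fun setT h ->
  measurable_fun setT (fun w : cpath T E => cumul V s (fun r => h (r, w r)) t).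
Proof.
move=> mh; rewrite /cumul; under eq_fun do rewrite Rint_indic.
apply: (@measurable_Rint_clk _ (cpath T E) s (fun z => \1_(upto t) z.1 * h (graph z))).
apply: measurable_funM; last exact: measurable_path_fun.
apply: (measurableT_comp _ measurable_fst).
by apply: measurable_indic; exact: measurable_upto.
Qed.

Lemma measurable_drift h s t : measurable_fun setT h ->
  measurable_fun setT (fun w : cpath T E => drift_int V h s t w).
Proof.
move=> mh; under eq_fun do rewrite drift_intE//.
exact: measurable_cumul.
Qed.

Lemma measurable_state h t : measurable_fun setT h ->
  measurable_fun setT (fun w : cpath T E => h (t, w t)).
Proof.
move=> mh; apply: (@measurableT_comp _ _ _ _ _ _ h _ (fun w => (t, w t : borel E))) => //.
by apply: measurable_fun_pair; [exact: measurable_cst|exact: measurable_eval].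
Qed.

Lemma measurable_compensated (phi chi : timeI T * borel E -> R) s (x : E) t : measurable_fun setT phi ->
  measurable_fun setT chi -> measurable_fun setT (compensated V phi chi s x t).
Proof.
move=> mp mc; rewrite /compensated; case: (tval s <= tval t); last exact: measurable_cst.
apply: measurable_funB; last exact: measurable_drift.
by apply: measurable_funB; [exact: measurable_state|exact: measurable_cst].
Qed.

End drift.

Lemma sub_ae d (X : measurableType d) (R : realType) (mu : {measure set X -> \bar R})
    (P Q : X -> Prop) : (forall x, P x -> Q x) -> {ae mu, forall x, P x} -> {ae mu, forall x, Q x}.
Proof. by move=> PQ; exact: filterS. Qed.

Lemma ae_and d (X : measurableType d) (R : realType) (mu : {measure set X -> \bar R})
    (P Q : X -> Prop) : {ae mu, forall x, P x} -> {ae mu, forall x, Q x} ->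
  {ae mu, forall x, P x /\ Q x}.
Proof. exact: filterI. Qed.

(** Cutting f off on a measurable null set makes the inequality hold everywhere, while g, possibly
    not measurable, is left untouched. *)
Lemma ae_ge0_le_integral_nm d (X : measurableType d) (R : realType)
    (mu : {measure set X -> \bar R}) (f g : X -> \bar R) : measurable_fun setT f ->
  (forall x, 0 <= f x)%E -> (forall x, 0 <= g x)%E ->
  {ae mu, forall x, (f x <= g x)%E} ->
  (\int[mu]_x f x <= \int[mu]_x g x)%E.
Proof.
move=> mf f0 g0 [A [mA A0 hA]].
have -> : (\int[mu]_x f x = \int[mu]_x (f \_ (~` A)) x)%E.
  apply: ae_eq_integral => //.
    by apply/(measurable_restrictT _ (measurableC mA)); exact: measurable_funTS.
  exists A; split => // x /= nx; apply: contrapT => nA; apply: nx => _.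
  by rewrite patchE mem_set.
apply: ge0_le_integral_nm => x; rewrite patchE; case: ifP => // /[!inE] nA.
by apply: contrapT => /hA.
Qed.

Section martingale_part.
Context {R : realType} {T : {posnum R}} {E : ptopologicalType} (hE : polish R E).
Variables (Pr : timeI T -> E -> probability (cpath T E) R) (V : clock T).
Variables (s : timeI T) (x : E).
Implicit Types (phi chi psi beta G : timeI T * borel E -> R) (t p q : timeI T).
Implicit Types (M N : timeI T -> cpath T E -> R) (W : cpath T E -> R).

Local Notation rho := (Pr s x).
Local Notation Pc := (Prc Pr s x).
Local Notation Y phi chi := (compensated V phi chi s x).

Local Notation Omega := (caratheodory_type (mu_ext rho)).
Local Notation Fc := (fun t => completed_filtration Pr s x t : set (set Omega)).

Let sFc t : <<s Fc t >> `<=` (measurable : set (set Omega)).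
Proof. exact: completed_filtration_sub. Qed.

(** The bridge from M to the explicit process: at a fixed time they agree almost surely, and the
    explicit process is measurable on the raw space, so its square integrability descends from the
    completion. *)
Lemma cadlag_modification_ae phi chi M : measurable_fun setT phi -> measurable_fun setT chi ->
  cadlag_modification Pr V phi chi s x M -> forall t,
  [/\ sq_integrable Pc (M t), {ae Pc, forall w, M t w = Y phi chi t w} & sq_integrable rho (Y phi chi t)].
Proof.
move=> mp mc [[hM M0] MY] t.
have sM := cadlag_sq_martingale_sq hM (tval_ge0 t : tval tmin <= tval t).
have ae := ae_Prc (MY t).
have mY := measurable_compensated hE V s x t mp mc.
split; [exact: sM|exact: ae|apply/(sq_integrable_Prc Pr s x mY)].
exact: (@ae_sq_integrable _ _ _ Pc _ _ (measurable_fun_Prc mY) ae sM).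
Qed.

Lemma compensated_condexp phi chi M p q W : measurable_fun setT phi -> measurable_fun setT chi ->
  cadlag_modification Pr V phi chi s x M -> tval p <= tval q ->
  measurable_wrt (cylinders p) W -> sq_integrable rho W ->
  \int[rho]_w (W w * Y phi chi q w) = \int[rho]_w (W w * Y phi chi p w).
Proof.
move=> mp mc hM pq mW sW.
have mW' := measurable_wrtW (@cylinders_measurable _ _ _ p) mW.
have sW' : sq_integrable Pc W by exact/sq_integrable_Prc.
have hA t : \int[rho]_w (W w * Y phi chi t w) = \int[Pc]_w (W w * M t w).
  have [sMt aet sYt] := cadlag_modification_ae mp mc hM t.
  rewrite -Rint_Prc; last by apply: measurable_funM => //; case: sYt.
  apply: ae_eq_Rint.
  - by apply: measurable_funM; apply: measurable_fun_Prc => //; case: sYt.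
  - by apply: measurable_funM; [exact: measurable_fun_Prc|case: sMt].
  - by apply: sub_ae aet => w ->.
have [[[_ [_ cM] _] _] _] := hM.
rewrite !hA; apply: (@condexp_mul _ Omega _ Pc (Fc p) W (M q) (M p) (@sFc p) (cM _ _ (tval_ge0 p : tval tmin <= tval p) pq)).
- exact: cylinders_measurable_wrt.
- by have [sMq _ _] := cadlag_modification_ae mp mc hM q; exact: (sq_integrable_rM sW' sMq).
- by have [sMp _ _] := cadlag_modification_ae mp mc hM p; exact: (sq_integrable_rM sW' sMp).
Qed.

Lemma compensated_mean phi chi M t : measurable_fun setT phi -> measurable_fun setT chi ->
  cadlag_modification Pr V phi chi s x M -> \int[rho]_w Y phi chi t w = 0.
Proof.
move=> mp mc hM.
have [sM0 ae0 sY0] := cadlag_modification_ae mp mc hM tmin.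
have fr := probability_lty rho.
have := @compensated_condexp phi chi M tmin t (fun=> 1) mp mc hM (tval_ge0 t)
  (measurable_cst _) (sq_integrable_cst fr 1).
under eq_Rintegral do rewrite mul1r; move=> ->.
under eq_Rintegral do rewrite mul1r.
have [[_ M0] MY] := hM.
rewrite -Rint_Prc; last by case: sY0.
rewrite -(@Rint0 _ _ _ Pc); apply: ae_eq_Rint.
- exact: (measurable_fun_Prc sY0.1).
- exact: measurable_cst.
by apply: sub_ae (ae_and M0 ae0) => w [-> <-].
Qed.

Lemma mean_sqr_increment phi chi M p q : measurable_fun setT phi -> measurable_fun setT chi ->
  cadlag_modification Pr V phi chi s x M -> tval p <= tval q ->
  \int[rho]_w (Y phi chi q w - Y phi chi p w) ^+ 2 =
  \int[rho]_w (Y phi chi q w) ^+ 2 - \int[rho]_w (Y phi chi p w) ^+ 2.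
Proof.
move=> mp mc hM pq.
have [sMp aep sYp] := cadlag_modification_ae mp mc hM p.
have [sMq aeq sYq] := cadlag_modification_ae mp mc hM q.
have e t : sq_integrable rho (Y phi chi t) -> sq_integrable Pc (M t) ->
    {ae Pc, forall w, M t w = Y phi chi t w} ->
    \int[rho]_w (Y phi chi t w) ^+ 2 = \int[Pc]_w (M t w * M t w).
  move=> sY sM ae; rewrite -Rint_Prc; last by case: sY => m _; exact: measurable_funX.
  apply: ae_eq_Rint.
  - by apply: measurable_fun_Prc; case: sY => m _; exact: measurable_funX.
  - by case: sM => m _; exact: measurable_funM.
  - by apply: sub_ae ae => w ->; rewrite expr2.
rewrite !e//; have [[hM' _] _] := hM.
have c1 : exists c : R, forall w : Omega, `|1 : R| <= c by exists `|1|.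
have := @martingale_mul _ _ _ Omega Pc Fc sFc tmin M M p q (fun=> 1) hM' hM' (tval_ge0 p : tval tmin <= tval p) pq
  (measurable_cst (1 : R)) c1.
under eq_Rintegral do rewrite mul1r.
under [X in _ = X - _ -> _]eq_Rintegral do rewrite mul1r.
under [X in _ = _ - X -> _]eq_Rintegral do rewrite mul1r.
move=> <-; have [mMp _] := sMp; have [mMq _] := sMq.
have [mYp _] := sYp; have [mYq _] := sYq.
rewrite -Rint_Prc; last by apply: measurable_funX; exact: measurable_funB.
apply: ae_eq_Rint.
- by apply: measurable_fun_Prc; apply: measurable_funX; exact: measurable_funB.
- by apply: measurable_funM; exact: measurable_funB.
- by apply: sub_ae (ae_and aep aeq) => w [-> ->]; rewrite expr2.
Qed.

Lemma le_mean_sqr_compensated phi chi M p q : measurable_fun setT phi -> measurable_fun setT chi ->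
  cadlag_modification Pr V phi chi s x M -> tval p <= tval q ->
  \int[rho]_w (Y phi chi p w) ^+ 2 <= \int[rho]_w (Y phi chi q w) ^+ 2.
Proof.
move=> mp mc hM pq; rewrite -subr_ge0 -(mean_sqr_increment mp mc hM pq).
by apply: Rint_ge0 => w; exact: sqr_ge0.
Qed.

Lemma ae_path_rintegrable G : measurable_fun setT G -> drift_finite Pr V G s x ->
  {ae rho, forall w : cpath T E, rintegrable (clk V s) (fun r => G (r, w r))}.
Proof.
move=> mG; apply: sub_ae => w; have mGw := measurable_along_path hE w mG.
rewrite clock_intE ?upto_tmax.
  by move=> h; apply/rintegrableP.
by apply/measurable_EFinP; exact: measurableT_comp.
Qed.

Section bracket.
Variables (phi psi chi beta G : timeI T * borel E -> R) (M N : timeI T -> cpath T E -> R).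
Hypotheses (aphi : is_frak_a Pr V phi chi) (apsi : is_frak_a Pr V psi beta).
Hypotheses (hM : cadlag_modification Pr V phi chi s x M)
  (hN : cadlag_modification Pr V psi beta s x N) (hG : is_frak_G Pr V psi phi G).

Let mp : measurable_fun setT phi. Proof. by case: aphi. Qed.
Let mc : measurable_fun setT chi. Proof. by case: aphi => _ []. Qed.
Let mp' : measurable_fun setT psi. Proof. by case: apsi. Qed.
Let mc' : measurable_fun setT beta. Proof. by case: apsi => _ []. Qed.
Let mG : measurable_fun setT G. Proof. by case: hG. Qed.

Let frak_bracket : drift_finite Pr V G s x /\
  exists2 B, bracket_sx Pr s x M N B & {ae rho, forall w t, B t w = drift_int V G s t w}.
Proof.
have [_ _ _ h] := hG.
by have /(_ (ex_intro2 _ _ _ aphi hM) (ex_intro2 _ _ _ apsi hN)) := h s x M N.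
Qed.

Lemma compensated_bracket p q W : tval p <= tval q ->
  measurable_wrt (cylinders p) W -> (exists c : R, forall w, `|W w| <= c) ->
  \int[rho]_w (W w * ((Y phi chi q w - Y phi chi p w) * (Y psi beta q w - Y psi beta p w))) =
  \int[rho]_w (W w * (drift_int V G s q w - drift_int V G s p w)).
Proof.
move=> pq mW bW.
have [_ [B [_ _ _ mB] /ae_Prc aeB]] := frak_bracket.
have [[hM' _] _] := hM; have [[hN' _] _] := hN.
have mW' := measurable_wrtW (@cylinders_measurable _ _ _ p) mW.
have [iBp iBq] := @martingale_bracket _ _ _ Omega Pc Fc sFc tmin M N B p q W hM' hN' mB
  (tval_ge0 p : tval tmin <= tval p) pq (cylinders_measurable_wrt mW) bW.
have [[mMp _] aMp [mYp _]] := cadlag_modification_ae mp mc hM p.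
have [[mMq _] aMq [mYq _]] := cadlag_modification_ae mp mc hM q.
have [[mNp _] aNp [mZp _]] := cadlag_modification_ae mp' mc' hN p.
have [[mNq _] aNq [mZq _]] := cadlag_modification_ae mp' mc' hN q.
have mD t := measurable_drift hE V s t mG.
have mYZ := measurable_funM mW' (measurable_funM (measurable_funB mYq mYp) (measurable_funB mZq mZp)).
have mWD := measurable_funM mW' (measurable_funB (mD q) (mD p)).
move=> h; rewrite -Rint_Prc; last exact: mYZ.
rewrite -[RHS]Rint_Prc; last exact: mWD.
transitivity (\int[Pc]_w (W w * ((M q w - M p w) * (N q w - N p w)))); last first.
  rewrite h; apply: ae_eq_Rint.
  - apply: measurable_funM; first exact: measurable_fun_Prc.
    exact: (measurable_funB (rintegrable_measurable iBq) (rintegrable_measurable iBp)).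
  - exact: (measurable_fun_Prc mWD).
  - by apply: sub_ae aeB => w e; rewrite !e.
apply: ae_eq_Rint.
- exact: (measurable_fun_Prc mYZ).
- exact: (measurable_funM (measurable_fun_Prc mW')
    (measurable_funM (measurable_funB mMq mMp) (measurable_funB mNq mNp))).
- by apply: sub_ae (ae_and (ae_and aMp aMq) (ae_and aNp aNq)) => w [[-> ->] [-> ->]].
Qed.

(** Along almost every path \int |G| dV is at most the total variation of the bracket. Measurability
    of that variation in w is not established, hence the comparison by [ae_ge0_le_integral_nm]. *)
Lemma frak_G_rintegrable :
  rintegrable (clk V s \x rho)%E (along G).
Proof.
have [/(ae_path_rintegrable mG) /ae_Prc aeG [B [_ _ tvB _] /ae_Prc aeB]] := frak_bracket.
have mGg := measurable_path_fun hE mG.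
apply/integrable21ltyP; first exact/measurable_EFinP.
pose K (w : cpath T E) := (\int[clk V s]_r `|(G (r, w r))%:E|)%E.
have mK : measurable_fun setT K.
  apply: (@measurable_fun_fubini_tonelli_G _ _ _ (cpath T E) R (clk V s) (fun z => `|(G (graph z))%:E|%E)) => //.
  by apply/measurable_EFinP; exact: measurableT_comp.
have K0 w : (0 <= K w)%E by exact: integral_ge0.
rewrite -(@ge0_integral_Prc _ _ _ Pr s x K mK K0); apply: le_lt_trans tvB.
have mK' := @measurable_fun_Prc _ _ _ Pr s x _ _ K mK.
apply: (@ae_ge0_le_integral_nm _ Omega _ Pc _ _ mK' K0).
  by move=> w; exact: total_variation_ge0 (ltW _).
apply: sub_ae (ae_and aeG aeB) => w [iG eB].
apply: (le_trans (norm_le_total_variation hE mG iG)).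
suff -> : (fun r : R => cumul V s (fun r0 => G (r0, w r0)) (clamp r)) = (fun r => B (clamp r) w) by [].
by apply/funext => r; rewrite eB drift_intE.
Qed.

End bracket.

End martingale_part.

(** * Functions in the domain of the martingale problem *)

Section condexp_criterion.
Context d {U : measurableType d} {R : realType} (mu : {measure set U -> \bar R}).
Implicit Types (G : set (set U)) (Y Z : U -> R).

Lemma EFin_Rint_indic (A : set U) Y : measurable A -> rintegrable mu Y ->
  (\int[mu]_(w in A) (Y w)%:E)%E = (\int[mu]_w (\1_A w * Y w))%:E.
Proof.
move=> mA iY; rewrite EFin_Rint; last exact: rintegrable_indic.
rewrite integral_mkcond; apply: eq_integral => w _.
by rewrite patchE indicE; case: ifP; rewrite ?mul1r ?mul0r.
Qed.

Lemma condexp_of_indic G Y Z : <<s G >> `<=` measurable ->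
  rintegrable mu Y -> rintegrable mu Z -> measurable_wrt G Z ->
  (forall A, <<s G >> A -> \int[mu]_w (\1_A w * Y w) = \int[mu]_w (\1_A w * Z w)) ->
  is_condexp mu G Y Z.
Proof.
move=> sG iY iZ mZ YZ; split => // A GA.
by rewrite !EFin_Rint_indic ?YZ//; exact: sG.
Qed.

End condexp_criterion.

Section null_before.
Context {R : realType} {T : {posnum R}} d {U : measurableType d}.
Variables (mu : {measure set U -> \bar R}) (F : timeI T -> set (set U)).
Hypothesis mufin : (mu setT < +oo)%E.
Hypothesis sF : forall t, <<s F t >> `<=` measurable.
Hypothesis F_nd : forall q t : timeI T, tval q <= tval t -> <<s F q >> `<=` <<s F t >>.
Variables (s : timeI T) (N : timeI T -> U -> R) (c : R).
Hypotheses (hN : cadlag_sq_martingale_from mu F s N) (Ns : {ae mu, forall w, N s w = c}).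
Implicit Types (q t r : timeI T).

Let Y t w := if tval s <= tval t then N t w - c else 0.

Let Y_from t w : tval s <= tval t -> Y t w = N t w - c.
Proof. by move=> st; rewrite /Y st. Qed.

Let Y_before t w : tval t < tval s -> Y t w = 0.
Proof. by move=> st; rewrite /Y leNgt st. Qed.

Let Y_cadlag w : cadlag_from s (N ^~ w) -> cadlag_from tmin (Y ^~ w).
Proof.
move=> cN t _; have [ts|st] := ltP (tval t) (tval s).
- split => [|t0].
  + rewrite Y_before//; apply: cvg_near_cst; near=> r.
    apply: Y_before; rewrite /= gt_max (le_lt_trans (tval_ge0 t) ts)/= gt_min.
    by apply/orP; left; near: r; exact: nbhs_right_lt.
  + exists 0; apply: cvg_near_cst; near=> r.
    apply: Y_before; rewrite /= gt_max (le_lt_trans (tval_ge0 t) ts)/= gt_min.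
    by apply/orP; left; apply: lt_trans ts; near: r; exact: nbhs_left_lt.
- have [cr cl] := cN t st; split => [|t0].
  + rewrite Y_from//; apply: cvg_trans (cvgB cr (cvg_cst (c))).
    apply: near_eq_cvg; near=> r; rewrite Y_from//=.
    rewrite le_max le_min (tval_le s) andbT; apply/orP; right.
    by apply: (le_trans st); near: r; exact: nbhs_right_ge.
  + have [st'|ts] := ltP (tval s) (tval t).
      have [l hl] := cl st'; exists (l - c).
      apply: cvg_trans (cvgB hl (cvg_cst (c))).
      apply: near_eq_cvg; near=> r; rewrite Y_from//=.
      rewrite le_max le_min (tval_le s) andbT; apply/orP; right.
      by near: r; exact: nbhs_left_ge.
    (* Here t = s: the left limit is taken where the process is 0. *)
    exists 0; apply: cvg_near_cst; near=> r.
    apply: Y_before; rewrite /= gt_max gt_min.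
    have s0 : 0 < tval s by exact: lt_le_trans t0 ts.
    rewrite s0/=; apply/orP; left.
    apply: (@lt_le_trans _ _ (tval t) _ _ _ ts); near: r; exact: nbhs_left_lt.
Unshelve. all: by end_near. Qed.

Let sqN t : tval s <= tval t -> sq_integrable mu (N t).
Proof. exact: cadlag_sq_martingale_sq hN. Qed.

Let sqY t : sq_integrable mu (Y t).
Proof.
have [ts|st] := ltP (tval t) (tval s).
  have -> : Y t = (fun=> 0) by apply/funext => w; exact: Y_before.
  exact: sq_integrable_cst.
have -> : Y t = (fun w => N t w - c) by apply/funext => w; exact: Y_from.
apply: sq_integrableB; first exact: sqN.
exact: sq_integrable_cst.
Qed.

Let Ys : {ae mu, forall w, Y s w = 0}.
Proof. by apply: sub_ae Ns => w e; rewrite Y_from// e subrr. Qed.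

Let mY t : measurable_wrt (F t) (Y t).
Proof.
have [ts|st] := ltP (tval t) (tval s).
  have -> : Y t = (fun=> 0) by apply/funext => w; exact: Y_before.
  exact: measurable_cst.
have -> : Y t = (fun w => N t w - c) by apply/funext => w; exact: Y_from.
have [_ [/(_ t st)[mN _] _] _] := hN.
exact: (measurable_funB mN (measurable_cst _)).
Qed.

Let condY_from q t A : tval s <= tval q -> tval q <= tval t -> <<s F q >> A ->
  \int[mu]_w (\1_A w * Y t w) = \int[mu]_w (\1_A w * Y q w).
Proof.
move=> sq qt FA; have st := le_trans sq qt.
have [_ [_ /(_ q t sq qt) cN] _] := hN.
have mA := @sF q _ FA.
have e r : tval s <= tval r -> \int[mu]_w (\1_A w * Y r w) =
    \int[mu]_w (\1_A w * N r w) - \int[mu]_w (\1_A w * c).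
  move=> sr; rewrite -RintB; last 2 first.
  - by apply: rintegrable_indic => //; apply: sq_integrable_r => //; exact: sqN.
  - by apply: rintegrable_indic => //; exact: rintegrable_cst.
  by apply: eq_Rintegral => w _; rewrite Y_from// -mulrBr.
rewrite !e//; congr (_ - _).
exact: (condexp_indic (@sF q) cN).
Qed.

Let condY q t A : tval q <= tval t -> <<s F q >> A ->
  \int[mu]_w (\1_A w * Y t w) = \int[mu]_w (\1_A w * Y q w).
Proof.
move=> qt FA; have [qs|] := ltP (tval q) (tval s); last by move=> sq; exact: condY_from.
have Y0 r : tval r < tval s -> \int[mu]_w (\1_A w * Y r w) = 0.
  move=> rs; rewrite -(@Rint0 _ _ _ mu); apply: eq_Rintegral => w _.
  by rewrite Y_before// mulr0.
rewrite (Y0 q qs); have [ts|st] := ltP (tval t) (tval s); first exact: Y0.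
have FAs : <<s F s >> A by apply: F_nd FA; exact: ltW.
rewrite (condY_from _ st FAs)// -(@Rint0 _ _ _ mu).
apply: ae_eq_Rint => //.
  apply: measurable_funM; last by case: (sqY s).
  by apply: measurable_indic; exact: sF FAs.
by apply: sub_ae Ys => w ->; rewrite mulr0.
Qed.

(* For q < s the increments after s vanish in conditional mean given F_q because
   F_q is contained in F_s and N - c is null at s. *)
Lemma H20_null_before : H20 mu F (fun t w => if tval s <= tval t then N t w - c else 0).
Proof.
have iY t : rintegrable mu (Y t) by apply: sq_integrable_r => //; exact: sqY.
rewrite -/Y; split; last first.
  have [s0|s0] := leP (tval s) 0; last by apply: aeW => w; exact: Y_before.
  by have -> : tmin = s by apply: tval_inj; apply/eqP; rewrite eq_le s0 tval_ge0.
split.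
- by have [cN _ _] := hN; apply: sub_ae cN => w; exact: Y_cadlag.
- split => [t _|q t _ qt]; first by split; [exact: mY|exact: iY].
  by apply: condexp_of_indic => // A FA; exact: condY.
- move=> t _; have [mYt] := sqY t.
  move=> /(rintegrableP mu (measurable_funX _ mYt)).
  by under eq_integral do rewrite (ger0_norm (sqr_ge0 _)).
Qed.

End null_before.

Section martingale_problem.
Context {R : realType} {T : {posnum R}} {E : ptopologicalType} (hE : polish R E).
Variables (Pr : timeI T -> E -> probability (cpath T E) R) (V : clock T).
Variables (Da : set (timeI T * borel E -> R))
  (a : (timeI T * borel E -> R) -> (timeI T * borel E -> R)).
Hypotheses (ha : is_operator Da a) (hMP : solves_martingale_problem Pr V Da a).
Implicit Types (phi chi : timeI T * borel E -> R) (s t q r : timeI T) (x : E).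

Lemma drift_int_id (h : timeI T * borel E -> R) s (w : cpath T E) : measurable_fun setT h ->
  drift_int V h s s w = 0.
Proof.
move=> mh; rewrite drift_intE// /cumul /Rintegral null_set_integral//; first exact: measurable_upto.
  by apply: measurable_funTS; apply/measurable_EFinP; exact: measurable_along_path.
by have /= -> := clk_le V (lexx (tval s)); rewrite subrr.
Qed.

Lemma polish_openC1 (x : E) : open (~` [set x]).
Proof.
have [_ [d [d0 dC dT dN _]]] := hE.
rewrite openE => y /= yx; apply/dN; exists (d x y).
  have dge0 : 0 <= d x y.
    have := dT x y x; rewrite (d0 x x).2// (dC y x) -mulr2n pmulrn_lge0//.
  by rewrite lt_neqAle dge0 andbT eq_sym; apply/eqP => /d0 xy; exact: yx.
by move=> z /= yz zx; move: yz; rewrite zx dC ltxx.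
Qed.

Lemma measurable_set1_polish (x : borel E) : measurable [set x].
Proof.
rewrite -[X in measurable X]setCK; apply: measurableC; apply: sub_sigma_algebra.
exact: polish_openC1.
Qed.

(** The intersection is uncountable. By right-continuity the condition at dyadic times before s
    gives it at all times before s; s itself is listed apart, since it need not be dyadic and times
    beyond s are not constrained. *)
Lemma measurable_constant_upto s x :
  measurable [set w : cpath T E | forall t : timeI T, tval t <= tval s -> w t = x].
Proof.
have m1 t : measurable [set w : cpath T E | w t = x].
  by have := measurable_eval t measurableT (measurable_set1_polish x); rewrite setTI.
pose D k j := [set w : cpath T E | tval (grid k j : timeI T) <= tval s -> w (grid k j) = x].
have mD k j : measurable (D k j).
  rewrite /D; case: (tval (grid k j) <= tval s).
    suff -> : [set w : cpath T E | true -> w (grid k j) = x] = [set w | w (grid k j) = x] by exact: m1.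
    by apply/seteqP; split => w //= h; exact: h.
  suff -> : [set w : cpath T E | false -> w (grid k j) = x] = setT by exact: measurableT.
  by apply/seteqP; split.
have -> : [set w : cpath T E | forall t : timeI T, tval t <= tval s -> w t = x] =
    [set w : cpath T E | w s = x] `&` \bigcap_k \bigcap_j D k j.
  apply/seteqP; split => [w h|w [ws h] t ts].
    by split; [exact: h|move=> k _ j _ /h].
  have [st|] := leP (tval s) (tval t).
    by have -> : t = s by apply: tval_inj; apply/eqP; rewrite eq_le ts st.
  move=> {}ts; apply: contrapT => wtx.
  (* phi is positive exactly off x, so the limit in E can be tested by a limit of reals. *)
  have [phi cphi Uphi] := polish_open_pos hE (polish_openC1 x).
  have phix : phi x <= 0 by rewrite leNgt; apply/negP => px; have /(_ erefl) : (~` [set x]) x by rewrite Uphi.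
  have : (~` [set x]) (w t) by []; rewrite Uphi /=; apply/negP; rewrite -leNgt.
  have [ir ic] := idx_right t.
  have cv := cadlag_grid_right (r := t) (cadlag_comp w cphi); apply: (@cvgr_to_le _ _ _ R _ _ _ cv).
  have FF : Filter (\oo : set_system nat) by exact: _.
  have := cvgr_lt (tval t) ic (tval s) ts => /(_ FF).
  apply: filterS => k ks; rewrite (h k I _ I)//.
  by rewrite -[s]clampK; apply: clamp_nd; exact: ltW.
have mI : measurable (\bigcap_k \bigcap_j D k j).
  by apply: bigcapT_measurable => k; apply: bigcapT_measurable => j; exact: mD.
exact: measurableI.
Qed.

Lemma ae_initial s x : {ae Pr s x, forall w : cpath T E, w s = x}.
Proof.
have [P1 _] := hMP s x; have mS := measurable_constant_upto s x.
apply/(negligibleS (A := ~` [set w : cpath T E | forall t : timeI T, tval t <= tval s -> w t = x])).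
  by move=> w /= nw hw; apply: nw; exact: hw.
apply/negligibleP; first exact: measurableC.
by have := probability_setC (Pr s x) mS; rewrite P1 subee.
Qed.

Section fixed.
Variables (phi : timeI T * borel E -> R) (s : timeI T) (x : E).
Hypothesis Dphi : Da phi.

Local Notation rho := (Pr s x).
Local Notation Pc := (Prc Pr s x).
Local Notation Omega := (caratheodory_type (mu_ext rho)).
Local Notation Fc := (fun t => completed_filtration Pr s x t : set (set Omega)).

(** The martingale problem speaks only of times from s on, and its process starts at phi(s, x);
    [H20_null_before] subtracts this value and extends by 0 before s. *)
Lemma compensated_modification :
  cadlag_modification Pr V phi (a phi) s x (compensated V phi (a phi) s x).
Proof.
split; last by move=> t; apply: aeW.
have iM := ((hMP s x).2 phi Dphi).2.
have -> : compensated V phi (a phi) s x =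
    (fun t w => if tval s <= tval t then phi (t, w t) - drift_int V (a phi) s t w - phi (s, x) else 0).
  apply/funext => t; apply/funext => w; rewrite /compensated.
  by case: ifP => // _; rewrite addrAC.
apply: (@H20_null_before _ _ _ Omega Pc Fc _ _ _ s
  (fun t (w : cpath T E) => phi (t, w t) - drift_int V (a phi) s t w) (phi (s, x)) iM).
- by change (Pc setT < +oo)%E; rewrite PrcE// probability_setT ltry.
- by move=> t; exact: completed_filtration_sub.
- by move=> q t; exact: completed_filtration_le.
- apply: ae_Prc; apply: sub_ae (ae_initial s x) => w ws.
  by rewrite ws drift_int_id ?subr0//; have [_ _ _ h _] := ha; exact: h.
Qed.

End fixed.

Lemma domain_is_frak_a phi : Da phi -> is_frak_a Pr V phi (a phi).
Proof.
move=> Dphi; split.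
- by have [h _ _ _ _] := ha; exact: h.
- split; first by have [_ _ _ h _] := ha; exact: h.
  by move=> s x; have [_ /(_ _ Dphi)[]] := hMP s x.
- by move=> s x; exists (compensated V phi (a phi) s x); exact: compensated_modification.
Qed.

End martingale_problem.

(** * Square integrability and uniqueness of bracket densities *)

Section grid_ends.
Context {R : realType} {T : {posnum R}}.

Lemma grid_max k : grid k (2 ^ k) = tmax :> timeI T.
Proof.
by rewrite /grid clamp_geT// /mesh natrX -mulrA mulVf ?mulr1.
Qed.

Lemma grid_nd k i j : (i <= j)%N -> tval (grid k i : timeI T) <= tval (grid k j : timeI T).
Proof.
move=> ij; apply: clamp_nd; rewrite ler_pM2l ?ler_nat//.
by rewrite /mesh divr_gt0// exprn_gt0.
Qed.

End grid_ends.

Section elementary.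
Context {R : realType} {T : {posnum R}} {E : ptopologicalType} (hE : polish R E).
Variables (V : clock T) (s : timeI T) (rho : probability (cpath T E) R).
Implicit Types (g G : timeI T * borel E -> R) (b : nat -> cpath T E -> R).

Local Notation lam := (clk V s \x rho)%E.
Local Notation D g t := (fun w : cpath T E => cumul V s (fun r => g (r, w r)) t).

Lemma prod_clk_finite : (lam setT < +oo)%E.
Proof.
rewrite -[setT]setXTT product_measure1E// lte_mul_pinfty//.
  by rewrite ge0_fin_numE//; exact: clk_finite.
exact: probability_lty.
Qed.

Lemma rintegrable_cumul g t : rintegrable lam (along g) ->
  rintegrable rho (D g t).
Proof.
move=> ig; have := rintegrable_indic _ ig.
move=> /(_ [set z | upto t z.1]).
have mU : measurable [set z : timeI T * cpath T E | upto t z.1].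
  rewrite -[X in measurable X]setTI.
  exact: (@measurable_fst _ _ (timeI T) (cpath T E) measurableT _ (measurable_upto t)).
move=> /(_ mU) /rintegrable_fubini2; apply: eq_rintegrable => w.
rewrite /cumul [RHS]Rint_indic; apply: eq_Rintegral => r _.
by rewrite !indicE.
Qed.

Lemma Rint_elementary k b g c : (forall j, measurable_wrt (cylinders (grid k j)) (b j)) ->
  (forall j w, `|b j w| <= c) ->
  rintegrable lam (along g) ->
  measurable_fun setT g ->
  \int[lam]_z (b (idx k z.1) z.2 * g (graph z)) =
  \sum_(j < 2 ^ k) \int[rho]_w (b j w * (D g (grid k j.+1) w - D g (grid k j) w)).
Proof.
move=> mb bc ig mg.
have mb' j : measurable_fun setT (b j) by exact: measurable_wrtW (@cylinders_measurable _ _ _ _) (mb j).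
have iD j t : rintegrable rho (fun w => b j w * (D g t w)).
  by apply: rintegrable_bounded_mul (bc j) _; [exact: mb'|exact: rintegrable_cumul].
have iB : rintegrable lam (fun z => b (idx k z.1) z.2 * g (graph z)).
  apply: (@rintegrable_bounded_mul _ _ _ _ c) => //; first exact: measurable_cells_fun.
rewrite Rint_fubini2//.
transitivity (\int[rho]_w (\sum_(j < 2 ^ k) b j w * (D g (grid k j.+1) w - D g (grid k j) w))).
  apply: ae_eq_Rint.
  - exact: rintegrable_measurable (rintegrable_fubini2 iB).
  - apply: measurable_sum => j; apply: measurable_funM; first exact: mb'.
    by apply: measurable_funB; exact: measurable_cumul.
  - apply: sub_ae (ae_integrable2 ig) => w iw.
    by rewrite (Rint_cells k (fun j => b j w)).
rewrite Rint_sum// => j.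
under eq_fun do rewrite mulrBr.
exact: rintegrableB.
Qed.

End elementary.

Section density.
Context {R : realType} {T : {posnum R}} {E : ptopologicalType} (hE : polish R E).
Variables (V : clock T) (s : timeI T) (rho : probability (cpath T E) R).
Implicit Types (Y Z : timeI T -> cpath T E -> R) (g G H : timeI T * borel E -> R).
Implicit Types (b : nat -> cpath T E -> R) (W : cpath T E -> R).

Local Notation lam := (clk V s \x rho)%E.
Local Notation D g t := (fun w : cpath T E => cumul V s (fun r => g (r, w r)) t).

(** All that is retained of d<Y, Z> = G dV: its means against bounded weights known at the left end
    of the increment, on the raw space. *)
Definition bracket_density Y Z G := forall p q W, tval p <= tval q ->
  measurable_wrt (cylinders p) W -> (exists c : R, forall w, `|W w| <= c) ->
  \int[rho]_w (W w * ((Y q w - Y p w) * (Z q w - Z p w))) =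
  \int[rho]_w (W w * (D G q w - D G p w)).

Lemma Rint_elementary_density Y Z G k b c : bracket_density Y Z G ->
  (forall j, measurable_wrt (cylinders (grid k j)) (b j)) ->
  (forall j w, `|b j w| <= c) ->
  rintegrable lam (along G) ->
  measurable_fun setT G ->
  \int[lam]_z (b (idx k z.1) z.2 * G (graph z)) =
  \sum_(j < 2 ^ k) \int[rho]_w (b j w * ((Y (grid k j.+1) w - Y (grid k j) w) *
    (Z (grid k j.+1) w - Z (grid k j) w))).
Proof.
move=> hG mb bc iG mG; rewrite (Rint_elementary hE mb bc iG mG).
apply: eq_bigr => j _; rewrite hG//; first exact: grid_nd.
by exists c.
Qed.

Section inequality.
Variables (Y Z : timeI T -> cpath T E -> R) (G G0 : timeI T * borel E -> R) (K : R).
Hypotheses (mG : measurable_fun setT G) (mG0 : measurable_fun setT G0).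
Hypotheses (iG : rintegrable lam (along G)).
Hypotheses (K0 : 0 < K) (G0K : forall z, `|G0 z| <= K).
Hypotheses (sY : forall t, sq_integrable rho (Y t)) (sZ : forall t, sq_integrable rho (Z t)).
Hypotheses (incY : forall p q, tval p <= tval q -> \int[rho]_w (Y q w - Y p w) ^+ 2 =
  \int[rho]_w (Y q w) ^+ 2 - \int[rho]_w (Y p w) ^+ 2).
Hypotheses (bG : bracket_density Y Z G) (bG0 : bracket_density Z Z G0).

Let iG0 : rintegrable lam (along G0).
Proof.
apply: (@le_rintegrable _ _ _ lam _ (fun=> K)).
- exact: measurable_path_fun.
- by move=> z; rewrite (ger0_norm (ltW K0)).
- exact: (rintegrable_cst (prod_clk_finite _ _ _)).
Qed.

(** On each cell 2 b dY dZ <= K dY^2 + K^-1 b^2 dZ^2. The means of dY^2 telescope to at most that of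
    Y_T^2 because increments are orthogonal, and G0 <= K cancels K^-1, which leaves the coefficient
    1 before the integral of b^2. *)
Lemma elementary_inequality k b c : (forall j, measurable_wrt (cylinders (grid k j)) (b j)) ->
  (forall j w, `|b j w| <= c) ->
  2 * \int[lam]_z (b (idx k z.1) z.2 * G (graph z)) <=
  K * \int[rho]_w (Y tmax w) ^+ 2 + \int[lam]_z (b (idx k z.1) z.2) ^+ 2.
Proof.
move=> mb bc.
have mb' j : measurable_fun setT (b j) by exact: measurable_wrtW (@cylinders_measurable _ _ _ _) (mb j).
pose dY j w := Y (grid k j.+1) w - Y (grid k j) w.
pose dZ j w := Z (grid k j.+1) w - Z (grid k j) w.
have sdY j : sq_integrable rho (dY j) by exact: sq_integrableB.
have sdZ j : sq_integrable rho (dZ j) by exact: sq_integrableB.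
have sbZ j : sq_integrable rho (fun w => b j w * dZ j w) by exact: sq_integrable_bounded_mul (bc j) (sdZ j).
have mb2 j : measurable_wrt (cylinders (grid k j)) (fun w => b j w ^+ 2).
  exact: (measurable_funX 2 (mb j)).
have bc2 j w : `|b j w ^+ 2| <= c ^+ 2.
  by rewrite normrX lerXn2r// ?nnegrE// (le_trans _ (bc j w)).
have bnd : \int[lam]_z (b (idx k z.1) z.2 ^+ 2 * G0 (graph z)) <= K * \int[lam]_z (b (idx k z.1) z.2) ^+ 2.
  have ib2 : rintegrable lam (fun z => b (idx k z.1) z.2 ^+ 2).
    apply: (@le_rintegrable _ _ _ lam _ (fun=> c ^+ 2)).
    - exact: (measurable_cells_fun k (fun j => measurable_funX 2 (mb' j))).
    - by move=> z; rewrite (le_trans (bc2 _ _))// ler_norm.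
    - exact: (rintegrable_cst (prod_clk_finite _ _ _)).
  rewrite -RintZ//; apply: le_Rint.
  - apply: (rintegrable_bounded_mul _ (fun z => bc2 _ _) iG0).
    exact: (measurable_cells_fun k (fun j => measurable_funX 2 (mb' j))).
  - exact: rintegrableZ.
  - move=> z; rewrite mulrC ler_wpM2r ?sqr_ge0//.
    by rewrite (le_trans (ler_norm _)).
have e1 := Rint_elementary_density bG mb bc iG mG.
have e2 := Rint_elementary_density bG0 mb2 bc2 iG0 mG0.
have tele : \sum_(j < 2 ^ k) \int[rho]_w (dY j w ^+ 2) <= \int[rho]_w (Y tmax w) ^+ 2.
  under eq_bigr do rewrite incY ?grid_nd//.
  rewrite -(big_mkord xpredT (fun j => \int[rho]_w (Y (grid k j.+1) w ^+ 2) - \int[rho]_w (Y (grid k j) w ^+ 2))).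
  rewrite (telescope_sumr (fun j => \int[rho]_w (Y (grid k j) w ^+ 2)))// grid_max.
  by rewrite lerBlDr lerDl; apply: Rint_ge0 => w; exact: sqr_ge0.
have main : 2 * \int[lam]_z (b (idx k z.1) z.2 * G (graph z)) <=
    K * (\sum_(j < 2 ^ k) \int[rho]_w (dY j w ^+ 2)) +
    K^-1 * \int[lam]_z (b (idx k z.1) z.2 ^+ 2 * G0 (graph z)).
  rewrite e1 e2 !mulr_sumr -big_split; apply: ler_sum => j _ /=.
  have i1 : rintegrable rho (fun w => b j w * (dY j w * dZ j w)).
    by apply: rintegrable_bounded_mul (bc j) _ => //; exact: sq_integrable_rM.
  have i2 : rintegrable rho (fun w => dY j w ^+ 2) by case: (sdY j).
  have i3 : rintegrable rho (fun w => b j w ^+ 2 * (dZ j w * dZ j w)).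
    apply: rintegrable_bounded_mul (bc2 j) _; first exact: measurable_funX.
    exact: sq_integrable_rM.
  rewrite -!RintZ// -RintD; [|exact: rintegrableZ|exact: rintegrableZ].
  apply: le_Rint; [exact: rintegrableZ|by apply: rintegrableD; exact: rintegrableZ|].
  move=> w; rewrite -/(dY j w) -/(dZ j w) -subr_ge0.
  have -> : K * dY j w ^+ 2 + K^-1 * (b j w ^+ 2 * (dZ j w * dZ j w)) -
      2 * (b j w * (dY j w * dZ j w)) = K^-1 * (K * dY j w - b j w * dZ j w) ^+ 2.
    by field; exact: lt0r_neq0.
  by rewrite mulr_ge0 ?invr_ge0 ?sqr_ge0// ltW.
apply: (le_trans main); apply: lerD.
  by rewrite ler_pM2l.
by rewrite ler_pdivrMl.
Qed.

End inequality.

End density.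

Section elementary_approximation.
Context {R : realType} {T : {posnum R}} {E : ptopologicalType} (hE : polish R E).
Variables (V : clock T) (s : timeI T) (rho : probability (cpath T E) R).
Implicit Types (B : nat -> set (timeI T * cpath T E)) (C : nat -> set (timeI T * borel E)).

Local Notation lam := (clk V s \x rho)%E.

(** Each set has its own grid and only finitely many grids have a common refinement, so nothing is
    claimed for l >= n. *)
Lemma elementary_common n B : (forall l, elementary_sets (B l)) ->
  exists k (S : nat -> nat -> set (cpath T E)),
    (forall l j, <<s cylinders (grid k j) >> (S l j)) /\
    forall l, (l < n)%N -> B l = [set z | S l (idx k z.1) z.2].
Proof.
move=> eB; elim: n => [|n [k [S [cS BS]]]].
  by exists 0%N, (fun _ _ => set0); split => // l j; exact: cylinders0.
have [k' [S' [cS' BS']]] := eB n.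
exists (k + k')%N, (fun l => if l == n then (fun j => S' (j %/ 2 ^ k)%N) else (fun j => S l (j %/ 2 ^ k')%N)).
split => [l j|l]; first case: ifP => _.
- by have [h _] := elementary_raise k cS'; rewrite addnC; exact: h.
- by have [h _] := elementary_raise k' (cS l); exact: h.
- rewrite ltnS leq_eqVlt; case: eqP => [-> _|_ /= ln].
    by have [_] := elementary_raise k cS'; rewrite BS' addnC.
  by have [_ <-] := elementary_raise k' (cS l); exact: BS.
Qed.

(** Absolute continuity of the integral of |g| turns closeness in [lam] into closeness in |g|
    [lam]. *)
Lemma elementary_approximation n C (g : timeI T * cpath T E -> R) e : 0 < e ->
  (forall l, measurable (C l)) -> rintegrable lam g ->
  exists k (S : nat -> nat -> set (cpath T E)),
    (forall l j, <<s cylinders (grid k j) >> (S l j)) /\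
    forall l, (l < n)%N ->
      \int[lam]_z (\1_(sdiff (graph @^-1` C l) [set z | S l (idx k z.1) z.2]) z * `|g z|) <= e.
Proof.
move=> e0 mC ig; have [d [d0 hd]] := integral_normr_continuous ig e0.
have : forall l, exists D, elementary_sets D /\ (lam (sdiff (graph @^-1` C l) D) < d%:E)%E.
  move=> l; have [_ /(_ _ d0)[D eD hD]] := approximable_graph hE V s rho (mC l).
  by exists D.
move=> /choice[B hB]; have [k [S [cS BS]]] := elementary_common n (fun l => (hB l).1).
exists k, S; split => // l ln; rewrite -BS// -Rint_indic; apply: ltW; apply: hd (hB l).2.
apply: measurable_sdiff; last exact: elementary_measurable (hB l).1.
exact: measurable_graph_preimage.
Qed.

End elementary_approximation.

Section density_bound.
Context {R : realType} {T : {posnum R}} {E : ptopologicalType} (hE : polish R E).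
Variables (V : clock T) (s : timeI T) (rho : probability (cpath T E) R).
Local Notation lam := (clk V s \x rho)%E.

Lemma measurable_wrt_indic_sum k n (S : nat -> nat -> set (cpath T E)) (c : nat -> R) j :
  (forall l j, <<s cylinders (grid k j) >> (S l j)) ->
  measurable_wrt (cylinders (grid k j)) (fun w => \sum_(l < n) c l * \1_(S l j) w).
Proof.
move=> cS; apply: measurable_sum => l; apply: measurable_funM => //.
by apply: measurable_indic; exact: cS.
Qed.

Lemma norm_indic_sum (X : Type) n (A : nat -> set X) (c : nat -> R) x :
  `|\sum_(l < n) c l * \1_(A l) x| <= \sum_(l < n) `|c l|.
Proof.
apply: (le_trans (ler_norm_sum _ _ _)); apply: ler_sum => l _.
rewrite normrM indicE; case: (_ \in _); rewrite ?normr1 ?normr0 ?mulr1// mulr0//.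
Qed.

Section uniqueness.
Variables (Y Z : timeI T -> cpath T E -> R) (G G' : timeI T * borel E -> R).
Hypotheses (mG : measurable_fun setT G) (mG' : measurable_fun setT G').
Hypotheses (iG : rintegrable lam (along G))
  (iG' : rintegrable lam (along G')).
Hypotheses (bG : bracket_density V s rho Y Z G) (bG' : bracket_density V s rho Y Z G').

Let g (z : timeI T * cpath T E) := G (graph z) - G' (graph z).
Let ig : rintegrable lam g. Proof. exact: rintegrableB. Qed.

(** Over an elementary set G and G' have the same integral, the same sum of mean products of
    increments; passing to the preimage of C costs at most the integral of |g| over the symmetric
    difference. *)
Let Rint_graph0 C : measurable C -> \int[lam]_z (\1_(graph @^-1` C) z * g z) = 0.
Proof.
move=> mC; apply/eqP; rewrite -normr_le0; apply/ler_addgt0Pr => e e0; rewrite add0r.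
have [k [S [cS /(_ 0%N isT) hS]]] := elementary_approximation hE 1 e0 (fun _ : nat => mC) ig.
set B := [set z | S 0%N (idx k z.1) z.2] in hS.
set A := graph @^-1` C in hS *.
have eB : elementary_sets B by exists k, (S 0%N).
have mA : measurable A by exact: measurable_graph_preimage.
have mB : measurable B by exact: elementary_measurable.
have int0 : \int[lam]_z (\1_B z * g z) = 0.
  have b1 j w : `|(\1_(S 0%N j) w : R)| <= 1 by rewrite indicE; case: (_ \in _); rewrite ?normr1 ?normr0.
  have mb j : measurable_wrt (cylinders (grid k j)) (\1_(S 0%N j) : _ -> R) by apply: measurable_indic; exact: cS.
  transitivity (\int[lam]_z (\1_B z * G (graph z) - \1_B z * G' (graph z))).
    by apply: eq_Rintegral => z _; rewrite /g mulrBr.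
  rewrite RintB; [|exact: rintegrable_indic|exact: rintegrable_indic].
  have e1 := Rint_elementary_density hE bG mb b1 iG mG.
  have e2 := Rint_elementary_density hE bG' mb b1 iG' mG'.
  have eZ G1 : \int[lam]_z (\1_B z * G1 z) = \int[lam]_z (\1_(S 0%N (idx k z.1)) z.2 * G1 z).
    by apply: eq_Rintegral => z _; rewrite !indicE.
  by rewrite (eZ (fun z => G (graph z))) (eZ (fun z => G' (graph z))) e1 e2 subrr.
have -> : \int[lam]_z (\1_A z * g z) = \int[lam]_z (\1_A z * g z) - \int[lam]_z (\1_B z * g z).
  by rewrite int0 subr0.
rewrite -RintB; [|exact: rintegrable_indic|exact: rintegrable_indic].
apply: le_trans hS; apply: (le_trans (le_normr_Rintegral _ _)) => //.
  by apply: rintegrableB; exact: rintegrable_indic.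
apply: le_Rint.
- by apply: rintegrable_norm; apply: rintegrableB; exact: rintegrable_indic.
- by apply: rintegrable_indic; [exact: measurable_sdiff|exact: rintegrable_norm].
- move=> z; rewrite -mulrBl normrM ler_wpM2r// !indicE /sdiff !in_setU !in_setD.
  by case: (z \in A); case: (z \in B); rewrite /= ?subrr ?subr0 ?sub0r ?normrN ?normr1 ?normr0.
Qed.

(** Testing on preimages under [graph] suffices because the difference is itself a function of the
    graph: take C = {G' < G} and C = {G < G'}. *)
Lemma bracket_density_unique :
  {ae lam, forall z : timeI T * cpath T E, G (graph z) = G' (graph z)}.
Proof.
have mA (f h : timeI T * borel E -> R) : measurable_fun setT f -> measurable_fun setT h -> measurable [set z | f z < h z].
  move=> mf mh; rewrite -[X in measurable X]setTI.
  exact: (@measurable_fun_ltr _ _ _ _ f h mf mh measurableT [set true]).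
have posD (f h : timeI T * borel E -> R) : measurable_fun setT f -> measurable_fun setT h ->
    (\int[lam]_z (\1_(graph @^-1` [set z | f z < h z]) z * (h (graph z) - f (graph z))) = 0) ->
    rintegrable lam (fun z : timeI T * cpath T E => h (graph z) - f (graph z)) ->
    {ae lam, forall z : timeI T * cpath T E, h (graph z) <= f (graph z)}.
  move=> mf mh i0 ih.
  have mgA : measurable (graph @^-1` [set z | f z < h z] : set (timeI T * cpath T E)).
    by apply: measurable_graph_preimage => //; exact: mA.
  have := Rint_ge0_eq0 (rintegrable_indic mgA ih) _ i0.
  move=> /(_ _)[].
    by move=> z; rewrite indicE; case: (boolP (z \in _)); rewrite ?mul0r ?mul1r// inE/= subr_ge0 => /ltW.
  move=> N [mN N0 hN]; exists N; split => // z /= nz; apply: hN => /= h0.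
  apply: nz; rewrite leNgt; apply/negP => fh; move: h0; rewrite indicE mem_set//= mul1r => /eqP.
  by rewrite subr_eq0 => /eqP hf; move: fh; rewrite hf ltxx.
have h1 := posD G' G mG' mG (Rint_graph0 (mA _ _ mG' mG)) ig.
have ig' : rintegrable lam (fun z : timeI T * cpath T E => G' (graph z) - G (graph z)) by exact: rintegrableB.
have h2 : {ae lam, forall z : timeI T * cpath T E, G' (graph z) <= G (graph z)}.
  apply: posD => //; have := Rint_graph0 (mA _ _ mG mG') => /(congr1 -%R).
  rewrite oppr0 -RintN; last first.
    by apply: rintegrable_indic => //; apply: measurable_graph_preimage => //; exact: mA.
  by move=> <-; apply: eq_Rintegral => z _; rewrite -mulrN /g opprB.
apply: sub_ae (ae_and h1 h2) => z [a1 a2]; apply/eqP; by rewrite eq_le a1 a2.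
Qed.

End uniqueness.

End density_bound.

Lemma rintegrable_sq_monotone d (X : measurableType d) (R : realType)
    (mu : {measure set X -> \bar R}) (h : nat -> X -> R) (f : X -> R) (B : R) :
  (forall n, measurable_fun setT (h n)) -> (forall n x, 0 <= h n x) ->
  (forall x, nondecreasing_seq (h ^~ x)) -> (forall x, h ^~ x @ \oo --> f x) ->
  (forall n, rintegrable mu (fun x => h n x ^+ 2) /\ \int[mu]_x (h n x ^+ 2) <= B) ->
  rintegrable mu (fun x => f x ^+ 2).
Proof.
move=> mh h0 ndh cvh hB.
have mf : measurable_fun setT f by apply: (measurable_fun_cvg mh) => x _; exact: cvh.
have cv2 x : (fun n => h n x ^+ 2) @ \oo --> f x ^+ 2.
  by rewrite expr2; under eq_fun do rewrite expr2; exact: cvgM.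
have cvE x : (fun n => (h n x ^+ 2)%:E) @ \oo --> (f x ^+ 2)%:E.
  by apply: cvg_EFin; [exact: nearW|exact: cv2].
apply/rintegrableP; first exact: measurable_funX.
have mE n : measurable_fun setT (fun x => (h n x ^+ 2)%:E).
  by apply/measurable_EFinP; exact: measurable_funX.
have h0E n x : setT x -> (0 <= (h n x ^+ 2)%:E)%E by rewrite lee_fin sqr_ge0.
have ndE x : setT x -> {homo (fun n => (h n x ^+ 2)%:E) : n m / (n <= m)%N >-> (n <= m)%E}.
  by move=> _ n m nm; rewrite lee_fin lerXn2r ?nnegrE//; exact: ndh.
have := @cvg_monotone_convergence _ _ _ mu setT measurableT _ mE h0E ndE.
have -> : (\int[mu]_x limn (fun n => (h n x ^+ 2)%:E) = \int[mu]_x `|f x ^+ 2|%:E)%E.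
  apply: eq_integral => x _; rewrite ger0_norm ?sqr_ge0//.
  by apply/cvg_lim => //; exact: cvE.
move=> cv; apply: (@le_lt_trans _ _ B%:E); last exact: ltry.
rewrite -(cvg_lim _ cv)//; apply: lime_le; first by apply/cvg_ex; eexists; exact: cv.
by apply: nearW => n; have [i1 i2] := hB n; rewrite -EFin_Rint// lee_fin.
Qed.

Section density_sq_integrable.
Context {R : realType} {T : {posnum R}} {E : ptopologicalType} (hE : polish R E).
Variables (V : clock T) (s : timeI T) (rho : probability (cpath T E) R).
Local Notation lam := (clk V s \x rho)%E.

Variables (Y Z : timeI T -> cpath T E -> R) (G G0 : timeI T * borel E -> R) (K : R).
Hypotheses (mG : measurable_fun setT G) (mG0 : measurable_fun setT G0).
Hypotheses (iG : rintegrable lam (along G)).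
Hypotheses (K0 : 0 < K) (G0K : forall z, `|G0 z| <= K).
Hypotheses (sY : forall t, sq_integrable rho (Y t)) (sZ : forall t, sq_integrable rho (Z t)).
Hypotheses (incY : forall p q, tval p <= tval q -> \int[rho]_w (Y q w - Y p w) ^+ 2 =
  \int[rho]_w (Y q w) ^+ 2 - \int[rho]_w (Y p w) ^+ 2).
Hypotheses (bG : bracket_density V s rho Y Z G) (bG0 : bracket_density V s rho Z Z G0).

(** Each set of H is replaced by an elementary one on a common grid, which yields the integrand h of
    [elementary_inequality]. The comparison is made on 2HG - H^2 as a whole. *)
Lemma simple_inequality H : is_simple H ->
  [/\ rintegrable lam (fun z => H (graph z) * G (graph z)),
      rintegrable lam (fun z => H (graph z) ^+ 2) &
      2 * \int[lam]_z (H (graph z) * G (graph z)) <=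
      K * \int[rho]_w (Y tmax w) ^+ 2 + \int[lam]_z (H (graph z)) ^+ 2].
Proof.
move=> [n [c [C [mC HE]]]]; pose c0 := \sum_(l < n) `|c l|.
have c00 : 0 <= c0 by exact: sumr_ge0.
have mH : measurable_fun setT (along H).
  by apply: measurable_path_fun => //; apply: is_simple_measurable; exists n, c, C.
have Hc (z : timeI T * cpath T E) : `|H (graph z)| <= c0 by rewrite HE; exact: norm_indic_sum.
have Hc2 (z : timeI T * cpath T E) : `|H (graph z) ^+ 2| <= c0 ^+ 2 by rewrite normrX lerXn2r.
have lamfin := prod_clk_finite V s rho.
have iH2 : rintegrable lam (fun z => H (graph z) ^+ 2).
  apply: (@le_rintegrable _ _ _ lam _ (fun=> c0 ^+ 2)).
  - exact: measurable_funX.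
  - by move=> z; rewrite (le_trans (Hc2 z))// ler_norm.
  - exact: (rintegrable_cst lamfin).
have iHG : rintegrable lam (fun z => H (graph z) * G (graph z)).
  exact: (rintegrable_bounded_mul mH Hc iG).
split => //; rewrite -lerBlDr; apply/ler_addgt0Pr => e e0.
(* The change from h to H in 2HG - H^2 is (H - h) (2G - (H + h)), and g bounds the second factor
   since |H| and |h| are at most c0. *)
pose g (z : timeI T * cpath T E) := 2 * `|G (graph z)| + 2 * c0.
have ig : rintegrable lam g.
  apply: rintegrableD; last exact: (rintegrable_cst lamfin).
  by apply: rintegrableZ; exact: rintegrable_norm.
have g0 z : 0 <= g z by rewrite addr_ge0// mulr_ge0.
(* The n errors enter with weights |c_l| of sum c0, so together they stay below e; the 1 avoids a
   division by 0. *)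
have e'0 : 0 < e / (c0 + 1) by rewrite divr_gt0// ltr_wpDl.
have [k [S [cS hS]]] := elementary_approximation hE n e'0 mC ig.
pose A l := sdiff (graph @^-1` C l) [set z : timeI T * cpath T E | S l (idx k z.1) z.2].
have mA l : measurable (A l).
  apply: measurable_sdiff; first exact: measurable_graph_preimage.
  by apply: elementary_measurable; exists k, (S l).
pose b j w := \sum_(l < n) c l * \1_(S l j) w.
have mb j : measurable_wrt (cylinders (grid k j)) (b j) by exact: measurable_wrt_indic_sum.
have bc j w : `|b j w| <= c0 by exact: (norm_indic_sum n (fun l => S l j)).
have ineq := elementary_inequality hE mG mG0 iG K0 G0K sY sZ incY bG bG0 mb bc.
have mb' j : measurable_fun setT (b j) by exact: measurable_wrtW (@cylinders_measurable _ _ _ _) (mb j).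
pose h (z : timeI T * cpath T E) := b (idx k z.1) z.2.
have mh : measurable_fun setT h by exact: measurable_cells_fun.
have ih2 : rintegrable lam (fun z => h z ^+ 2).
  apply: (@le_rintegrable _ _ _ lam _ (fun=> c0 ^+ 2)).
  - exact: measurable_funX.
  - by move=> z; rewrite (le_trans _ (ler_norm _))// normrX lerXn2r// ?nnegrE// bc.
  - exact: (rintegrable_cst lamfin).
have ihG : rintegrable lam (fun z => h z * G (graph z)).
  by apply: (rintegrable_bounded_mul mh _ iG) => z; exact: bc.
have iS : rintegrable lam (fun z => \sum_(l < n) `|c l| * (\1_(A l) z * `|g z|)).
  apply: rintegrable_sum => l; apply: rintegrableZ; apply: rintegrable_indic => //.
  exact: rintegrable_norm.
have pw z : 2 * (H (graph z) * G (graph z)) - H (graph z) ^+ 2 <=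
    (2 * (h z * G (graph z)) - h z ^+ 2) + \sum_(l < n) `|c l| * (\1_(A l) z * `|g z|).
  have d1 : `|H (graph z) - h z| <= \sum_(l < n) `|c l| * \1_(A l) z.
    rewrite HE /h /b -sumrB; apply: (le_trans (ler_norm_sum _ _ _)); apply: ler_sum => l _.
    rewrite -mulrBr normrM; apply: ler_wpM2l => //.
    rewrite !indicE /A /sdiff in_setU !in_setD.
    have -> : (z \in graph @^-1` C l) = (graph z \in C l) by apply/idP/idP; rewrite !inE.
    have -> : (z \in [set z | S l (idx k z.1) z.2]) = (z.2 \in S l (idx k z.1)) by apply/idP/idP; rewrite !inE.
    by case: (graph z \in _); case: (z.2 \in _); rewrite /= ?subrr ?subr0 ?sub0r ?normrN ?normr1 ?normr0.
  have d2 : \sum_(l < n) `|c l| * (\1_(A l) z * `|g z|) = (\sum_(l < n) `|c l| * \1_(A l) z) * g z.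
    by rewrite mulr_suml; apply: eq_bigr => l _; rewrite (ger0_norm (g0 z)) mulrA.
  rewrite d2 -lerBlDl; apply: (@le_trans _ _ (`|H (graph z) - h z| * g z)); last by rewrite ler_wpM2r.
  have -> : 2 * (H (graph z) * G (graph z)) - H (graph z) ^+ 2 - (2 * (h z * G (graph z)) - h z ^+ 2) =
      (H (graph z) - h z) * (2 * G (graph z) - (H (graph z) + h z)) by ring.
  apply: (le_trans (ler_norm _)); rewrite normrM ler_wpM2l//.
  apply: (le_trans (ler_normB _ _)); rewrite /g normrM (ger0_norm (ler0n _ 2)) lerD2l.
  apply: (le_trans (ler_normD _ _)); rewrite mulr_natl mulr2n lerD//; exact: bc.
have : \int[lam]_z (2 * (H (graph z) * G (graph z)) - H (graph z) ^+ 2) <=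
    \int[lam]_z ((2 * (h z * G (graph z)) - h z ^+ 2) + \sum_(l < n) `|c l| * (\1_(A l) z * `|g z|)).
  apply: le_Rint => //; first by apply: rintegrableB => //; exact: rintegrableZ.
  by apply: rintegrableD => //; apply: rintegrableB => //; exact: rintegrableZ.
rewrite RintB//; last exact: rintegrableZ.
rewrite RintZ// RintD//; last by apply: rintegrableB => //; exact: rintegrableZ.
rewrite RintB//; last exact: rintegrableZ.
rewrite RintZ// => h1; apply: (le_trans h1); apply: lerD.
  by rewrite lerBlDr; exact: ineq.
rewrite Rint_sum; last first.
  move=> l; apply: rintegrableZ; apply: rintegrable_indic => //; exact: rintegrable_norm.
apply: (@le_trans _ _ (\sum_(l < n) `|c l| * (e / (c0 + 1)))).
  apply: ler_sum => l _; rewrite RintZ; last by apply: rintegrable_indic => //; exact: rintegrable_norm.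
  by apply: ler_wpM2l => //; exact: hS.
rewrite -mulr_suml -/c0 mulrCA ger_pMr// ler_pdivrMr ?mul1r ?lerDl//.
by rewrite ltr_wpDl.
Qed.

(** e = 1 and e = -1 give the positive and the negative part of G. For simple 0 <= h <= (e G)^+ one
    has h^2 <= e h G, so the inequality for e h bounds \int h^2 by K E[Y_T^2]; the absorption is
    licit because \int h^2 is finite for a simple h. Monotone convergence concludes. *)
Let sq_integrable_half e : `|e| = 1 ->
  rintegrable lam (fun z : timeI T * cpath T E => Num.max (e * G (graph z)) 0 ^+ 2).
Proof.
move=> e1; pose f z := Num.max (e * G z) 0.
have arith (x y z : R) : x <= y -> 2 * y <= z + x -> x <= z by lra.
have mf : measurable_fun setT f by apply: measurable_maxr => //; exact: measurable_funM.
have f0 z : 0 <= f z by rewrite le_max lexx orbT.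
have [h [sh hf ndh cvh]] := simple_approx mf f0.
apply: (@rintegrable_sq_monotone _ _ _ lam (fun n z => h n (graph z))
  (fun z => f (graph z)) (K * \int[rho]_w (Y tmax w) ^+ 2)).
- by move=> n; apply: measurable_path_fun => //; exact: is_simple_measurable.
- by move=> n z; have /andP[] := hf n (graph z).
- by move=> z; exact: ndh.
- by move=> z; exact: cvh.
move=> n; have [i1 i2 _] := simple_inequality (sh n).
have seh : is_simple (fun z => e * h n z).
  have [m [c [C [mC ->]]]] := sh n; exists m, (fun l => e * c l), C; split => //.
  by apply/funext => z; rewrite mulr_sumr; apply: eq_bigr => l _; rewrite mulrA.
have [j1 j2] := simple_inequality seh.
have e2 : e ^+ 2 = 1 by rewrite -real_normK ?num_real// e1 expr1n.
under [X in _ <= _ + X -> _]eq_Rintegral do rewrite exprMn e2 mul1r.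
have : \int[lam]_z (h n (graph z) ^+ 2) <= \int[lam]_z (e * h n (graph z) * G (graph z)).
  apply: le_Rint => // z; have /andP[h0 hle] := hf n (graph z).
  have [fe|fe] := leP (e * G (graph z)) 0.
    have : h n (graph z) = 0 by apply/eqP; rewrite eq_le h0 andbT (le_trans hle)// /f (max_idPr _).
    by move=> ->; rewrite mulr0 mul0r expr0n.
  have : f (graph z) = e * G (graph z) by rewrite /f (max_idPl _)// ltW.
  by move=> fE; rewrite -mulrA mulrCA -fE expr2 ler_wpM2l.
by move=> h1 h2; split => //; exact: arith h1 h2.
Qed.

Lemma density_sq_integrable : sq_integrable lam (along G).
Proof.
split; first exact: measurable_path_fun.
have h1 := rintegrableD (sq_integrable_half (normr1 R)) (sq_integrable_half (normrN1 R)).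
apply: (eq_rintegrable _ h1) => z; rewrite mul1r mulN1r.
have [g0|g0] := leP (G (graph z)) 0.
  by rewrite (max_idPl _) ?oppr_ge0// expr0n add0r sqrrN.
by rewrite (max_idPr _) ?expr0n ?addr0// oppr_le0 ltW.
Qed.

End density_sq_integrable.

(** Arithmetic of [gronwall_step]: moving [fq / 2] to the left produces the factor 2. *)
Lemma absorb_half (R : realFieldType) (fq fp f' j i d b : R) :
  fq = fp + f' -> f' <= j + i -> j <= d * b + fq / 2 ->
  0 <= d * b -> 0 <= d * i -> 0 <= b -> 0 <= i -> fq <= 2 * (fp + (1 + d) * (b + i)).
Proof. by rewrite mulrDl mul1r mulrDr; lra. Qed.

(** * Square integrability of solutions *)

Section gronwall.
Context {R : realType} {T : {posnum R}} (V : clock T) (s : timeI T).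
Implicit Types (y m g : timeI T -> R) (p q t r : timeI T).

Local Notation F g t := (cumul V s g t).

Lemma cumulE g t : F g t = \int[clk V s]_r (\1_(upto t) r * g r).
Proof. by rewrite /cumul Rint_indic. Qed.

Lemma cumul_le g p q : rintegrable (clk V s) g -> (forall r, 0 <= g r) ->
  tval p <= tval q -> F g p <= F g q.
Proof.
move=> ig g0 pq; rewrite !cumulE; apply: le_Rint.
- by apply: rintegrable_indic => //; exact: measurable_upto.
- by apply: rintegrable_indic => //; exact: measurable_upto.
- move=> r; apply: ler_wpM2r => //; rewrite !indicE.
  case: (boolP (r \in upto p)); rewrite ?ler0n// inE /upto/= => rp.
  by rewrite mem_set//= (le_trans rp).
Qed.

Lemma cumul_ge0 g t : (forall r, 0 <= g r) -> 0 <= F g t.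
Proof. by move=> g0; rewrite cumulE; apply: Rint_ge0 => r; rewrite mulr_ge0// indicE. Qed.

(** On ]p, q] the running integral is at most its value at q, so its contribution is at most C (V q
    - V p) F(q) <= F(q) / 2, which is absorbed. The remaining terms are mass times a and the
    integral of |m|. *)
Lemma gronwall_step C a y m p q : 0 < C -> 0 <= a ->
  rintegrable (clk V s) y -> rintegrable (clk V s) m ->
  (forall t, tval s <= tval t -> `|y t| <= a + `|m t| + C * F (fun r => `|y r|) t) ->
  tval s <= tval p -> tval p <= tval q -> V q - V p <= (2 * C)^-1 ->
  F (fun r => `|y r|) q <= 2 * (F (fun r => `|y r|) p + (1 + (2 * C)^-1) * (a + \int[clk V s]_r `|m r|)).
Proof.
move=> C0 a0 iy im hy sp pq hV.
have iy' := rintegrable_norm iy; have im' := rintegrable_norm im.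
pose A := [set r : timeI T | tval p < tval r <= tval q].
have mA : measurable A by exact: measurable_oc.
have Fq0 : 0 <= F (fun r => `|y r|) q by exact: cumul_ge0.
have split : F (fun r => `|y r|) q = F (fun r => `|y r|) p + \int[clk V s]_r (\1_A r * `|y r|).
  rewrite !cumulE -RintD; [|by apply: rintegrable_indic => //; exact: measurable_upto|exact: rintegrable_indic].
  apply: eq_Rintegral => r _; rewrite -mulrDl; congr (_ * _); rewrite !indicE.
  have uE t : (r \in upto t) = (tval r <= tval t) by apply/idP/idP; rewrite inE.
  have -> : (r \in A) = (tval p < tval r <= tval q) by apply/idP/idP; rewrite inE.
  rewrite !uE; have [rp|pr] := leP (tval r) (tval p); last by rewrite add0r.
  by rewrite (le_trans rp pq) addr0.
have cfin := clk_finite V s.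
have icst c : rintegrable (clk V s) (fun=> c) by exact: rintegrable_cst.
have bA : \int[clk V s]_r (\1_A r * `|y r|) <=
    \int[clk V s]_r (\1_A r * (a + C * F (fun r => `|y r|) q)) + \int[clk V s]_r `|m r|.
  rewrite -RintD//; last exact: rintegrable_indic.
  apply: le_Rint; [exact: rintegrable_indic|by apply: rintegrableD => //; exact: rintegrable_indic|].
  move=> r; rewrite indicE; case: (boolP (r \in A)); last by rewrite !mul0r add0r.
  rewrite inE => /andP[pr rq]; rewrite !mul1r.
  apply: (le_trans (hy r (le_trans sp (ltW pr)))); rewrite addrAC lerD2r lerD2l ler_pM2l//.
  exact: cumul_le.
have clkA : \int[clk V s]_r (\1_A r * (a + C * F (fun r => `|y r|) q)) <=
    (2 * C)^-1 * (a + C * F (fun r => `|y r|) q).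
  rewrite -Rint_indic Rintegral_cst// mulrC ler_wpM2r//.
    by rewrite addr_ge0// mulr_ge0// ltW.
  apply: le_trans hV; rewrite -lee_fin fineK; first exact: clk_oc.
  by rewrite ge0_fin_numE// (le_lt_trans _ cfin)// le_measure// inE.
have half : (2 * C)^-1 * (C * F (fun r => `|y r|) q) = F (fun r => `|y r|) q / 2.
  by field; exact: lt0r_neq0.
have im0 : 0 <= \int[clk V s]_r `|m r| by apply: Rint_ge0.
have d0 : 0 <= (2 * C)^-1 by rewrite invr_ge0 mulr_ge0// ltW.
apply: (absorb_half split bA); rewrite ?mulr_ge0//.
by rewrite -half -mulrDr.
Qed.

(* V is continuous, so [s, T] is cut into finitely many intervals on each of
   which C dV has mass at most 1/2 and gronwall_step absorbs the integral. *)
Lemma gronwall C : 0 < C -> exists2 c : R, 0 <= c & forall a y m, 0 <= a ->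
  rintegrable (clk V s) y -> rintegrable (clk V s) m ->
  (forall t, tval s <= tval t -> `|y t| <= a + `|m t| + C * F (fun r => `|y r|) t) ->
  \int[clk V s]_r `|y r| <= c * (a + \int[clk V s]_r `|m r|).
Proof.
move=> C0; pose dl := (2 * C)^-1; have dl0 : 0 < dl by rewrite invr_gt0 mulr_gt0.
(* Induction on the number n of pieces of mass [dl] needed to cover [s, t]. The constant is chosen
   before a, y and m, so one c serves all paths. *)
suff main n : exists2 c : R, 0 <= c & forall a y m, 0 <= a ->
    rintegrable (clk V s) y -> rintegrable (clk V s) m ->
    (forall t, tval s <= tval t -> `|y t| <= a + `|m t| + C * F (fun r => `|y r|) t) ->
    forall t, tval s <= tval t -> V t - V s <= n%:R * dl ->
    F (fun r => `|y r|) t <= c * (a + \int[clk V s]_r `|m r|).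
  have [n hn] : exists n : nat, (V tmax - V s) / dl <= n%:R.
    by exists (Num.truncn `|(V tmax - V s) / dl|).+1; rewrite (le_trans (ler_norm _))// ltW// truncnS_gt.
  have [c c0 hc] := main n; exists c => // a y m a0 iy im hy.
  rewrite -cumul_tmax; apply: hc => //; first exact: tval_le.
  by rewrite -ler_pdivrMr.
elim: n => [|n [c c0 IH]].
  exists 0 => // a y m a0 iy im hy t st; rewrite mul0r subr_le0 => Vts.
  have Vst := clock_nd V st.
  have t0 : clk V s (upto t) = 0%E by rewrite clk_le//; congr EFin; apply/eqP; rewrite subr_eq0 eq_le Vts Vst.
  rewrite mul0r /cumul /Rintegral null_set_integral//; first exact: measurable_upto.
  exact: measurable_funTS (measurable_int _ (rintegrable_norm iy)).
(* The bound of [gronwall_step] with c (a + I) inserted for the integral up to p. *)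
exists (2 * (c + (1 + dl))) => [|a y m a0 iy im hy t st hV].
  by rewrite mulr_ge0// addr_ge0// addr_ge0// ltW.
set I := \int[_]_r `|m r|.
have I0 : 0 <= I by exact: Rint_ge0.
have aI : 0 <= a + I by exact: addr_ge0.
have [small|big] := leP (V t - V s) (n%:R * dl).
  apply: (le_trans (IH _ _ _ a0 iy im hy t st small)); rewrite ler_wpM2r//.
  by rewrite mulr_natl mulr2n -addrA lerDl addr_ge0// ?addr_ge0// ltW// ltr_wpDl.
(* The intermediate value theorem supplies p where exactly n pieces are used up, so that at most
   [dl] remains on [p, t]. *)
have [p [sp pt Vp]] : exists p, [/\ tval s <= tval p, tval p <= tval t & V p = V s + n%:R * dl].
  have cV : {within `[tval s, tval t], continuous (fun r : R => V (clamp r))}.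
    by apply: continuous_subspaceT; exact: clock_continuous.
  have [] := IVT st cV (v := V s + n%:R * dl).
    rewrite !clampK (min_idPl _) ?(max_idPr _) ?clock_nd// lerDl.
    by rewrite mulr_ge0 ?(ltW dl0)//= addrC -lerBrDr ltW.
  move=> c'; rewrite in_itv/= => /andP[sc ct] Vc; exists (clamp c').
  have cc : tval (clamp c' : timeI T) = c'.
    by apply: clamp_val; rewrite (le_trans (tval_ge0 s) sc) (le_trans ct (tval_le t)).
  by rewrite cc.
have Vtp : V t - V p <= (2 * C)^-1.
  by rewrite Vp; move: hV; rewrite -natr1 mulrDl mul1r /dl; lra.
apply: (le_trans (gronwall_step C0 a0 iy im hy sp pt Vtp)).
have hp : V p - V s <= n%:R * dl by rewrite Vp addrAC subrr add0r.
have := IH _ _ _ a0 iy im hy p sp hp; rewrite -/I -/dl => h.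
by rewrite -mulrA ler_pM2l// [leRHS]mulrDl lerD2r.
Qed.

End gronwall.

Lemma ae_le_rintegrable d (X : measurableType d) (R : realType)
    (mu : {measure set X -> \bar R}) (f g : X -> R) : measurable_fun setT f ->
  {ae mu, forall x, `|f x| <= `|g x|} -> rintegrable mu g -> rintegrable mu f.
Proof.
move=> mf fg ig; have mg := rintegrable_measurable ig.
apply/rintegrableP => //; move/(rintegrableP mu mg) : ig; apply: le_lt_trans.
apply: ae_ge0_le_integral_nm => //.
by apply/measurable_EFinP; exact: measurableT_comp.
Qed.

Lemma ae_le_sq_integrable d (X : measurableType d) (R : realType)
    (mu : {measure set X -> \bar R}) (f g : X -> R) : measurable_fun setT f ->
  {ae mu, forall x, `|f x| <= `|g x|} -> sq_integrable mu g -> sq_integrable mu f.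
Proof.
move=> mf fg [mg ig]; split => //; apply: ae_le_rintegrable ig.
  exact: measurable_funX.
by apply: sub_ae fg => x h; rewrite !normrX lerXn2r ?nnegrE.
Qed.

Section finite_product.
Context {R : realType} {T : {posnum R}} {E : ptopologicalType}.
Variables (V : clock T) (s : timeI T) (rho : probability (cpath T E) R).
Local Notation lam := (clk V s \x rho)%E.
Implicit Types (F : timeI T * cpath T E -> R) (f : cpath T E -> R).

Lemma ae_snd (Q : cpath T E -> Prop) : {ae rho, forall w, Q w} ->
  {ae lam, forall z : timeI T * cpath T E, Q z.2}.
Proof.
move=> [N [mN N0 hN]]; exists (setT `*` N); split.
- exact: measurableX.
- by rewrite product_measure1E//; have /= -> := N0; rewrite mule0.
- by move=> z /= nQ; split => //; apply: hN.
Qed.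

Lemma ae_fst (Q : timeI T -> Prop) : {ae clk V s, forall r, Q r} ->
  {ae lam, forall z : timeI T * cpath T E, Q z.1}.
Proof.
move=> [N [mN N0 hN]]; exists (N `*` setT); split.
- exact: measurableX.
- by rewrite product_measure1E//; have /= -> := N0; rewrite mul0e.
- by move=> z /= nQ; split => //; apply: hN.
Qed.

Lemma ae_from : {ae clk V s, forall r : timeI T, tval s <= tval r}.
Proof.
exists [set r | tval r < tval s]; split.
- by have [_ h _ _] := @measurable_time_ray R T (tval s).
- exact: clk_lt.
- by move=> r /= /negP; rewrite -ltNge.
Qed.

Lemma rintegrable_tonelli1 F B : measurable_fun setT F ->
  (forall r, rintegrable rho (fun w => F (r, w))) ->
  (forall r, \int[rho]_w `|F (r, w)| <= B) -> rintegrable lam F.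
Proof.
move=> mF iF bF; apply/integrable12ltyP; first exact/measurable_EFinP.
apply: (@le_lt_trans _ _ (\int[clk V s]_r B%:E)%E).
  apply: ge0_le_integral_nm => r; first exact: integral_ge0.
  rewrite [leLHS](_ : _ = (\int[rho]_w `|F (r, w)|)%:E) ?lee_fin//.
  by rewrite EFin_Rint//; exact: rintegrable_norm.
rewrite integral_cst// lte_mul_pinfty// ?lee_fin.
- by apply: le_trans (bF tmin); exact: Rint_ge0.
- exact: clk_finite.
Qed.

Lemma rintegrable_snd f : rintegrable rho f -> rintegrable lam (fun z => f z.2).
Proof.
move=> hf; apply: (@rintegrable_tonelli1 _ (\int[rho]_w `|f w|)) => //.
by apply: measurableT_comp => //; exact: rintegrable_measurable hf.
Qed.

Lemma sq_integrable_snd f : sq_integrable rho f -> sq_integrable lam (fun z => f z.2).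
Proof.
move=> [mf hf]; split; last exact: (@rintegrable_snd (fun w => f w ^+ 2)).
exact: measurableT_comp.
Qed.

(** Cauchy-Schwarz in time, path by path, with the finite mass of dV as the constant. *)
Lemma sq_integrable_Rint F : sq_integrable lam F ->
  sq_integrable rho (fun w => \int[clk V s]_r F (r, w)).
Proof.
move=> hF; have iF := sq_integrable_r (prod_clk_finite V s rho) hF; have [mF iF2] := hF.
have mI := rintegrable_measurable (rintegrable_fubini2 iF); split => //.
apply: (@ae_le_rintegrable _ _ _ _ _ (fun w => fine (clk V s setT) * \int[clk V s]_r (F (r, w) ^+ 2))).
- exact: measurable_funX.
- apply: sub_ae (ae_integrable2 iF2) => w iw.
  rewrite (ger0_norm (sqr_ge0 _)) ger0_norm; last first.
    by apply: mulr_ge0; [exact: fine_ge0|apply: Rint_ge0 => r; exact: sqr_ge0].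
  apply: (sqr_Rint_le (clk_finite V s)).
  by split => //; apply: measurableT_comp => //; exact: measurable_fun_pair.
- by apply: rintegrableZ; exact: (rintegrable_fubini2 iF2).
Qed.

End finite_product.

Section path_integrals.
Context {R : realType} {T : {posnum R}} {E : ptopologicalType} (hE : polish R E).
Variables (V : clock T) (s : timeI T) (rho : probability (cpath T E) R).
Local Notation lam := (clk V s \x rho)%E.
Implicit Types (h phi chi : timeI T * borel E -> R).

Lemma path_tonelli h : measurable_fun setT h -> (forall z, 0 <= h z) ->
  (\int[lam]_z (h (graph z))%:E = \int[rho]_w clock_int V s tmax (fun r => (h (r, w r))%:E))%E.
Proof.
move=> mh h0; have mhg := measurable_path_fun hE mh.
rewrite fubini_tonelli2; first last.
- by move=> z; rewrite lee_fin.
- exact/measurable_EFinP.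
apply: eq_integral => w _; rewrite clock_intE ?upto_tmax//.
by apply/measurable_EFinP; exact: measurable_along_path.
Qed.

Lemma ae_section (Q : timeI T * cpath T E -> Prop) : {ae lam, forall z, Q z} ->
  {ae rho, forall w, {ae clk V s, forall r, Q (r, w)}}.
Proof.
move=> [N [mN N0 hN]]; have mi : measurable_fun setT (\1_N : timeI T * cpath T E -> R) by exact: measurable_indic.
have iN : rintegrable lam (\1_N : timeI T * cpath T E -> R).
  apply: (@le_rintegrable _ _ _ lam _ (fun=> 1)) => //.
  - by move=> z; rewrite indicE normr1; case: (z \in N); rewrite ?normr1 ?normr0.
  - exact: (rintegrable_cst (prod_clk_finite V s rho)).
have I0 : \int[lam]_z \1_N z = 0 :> R.
  by rewrite /Rintegral integral_indic// setIT; have /= -> := N0.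
move: I0; rewrite Rint_fubini2// => /(Rint_ge0_eq0 (rintegrable_fubini2 iN)) h.
have pos w : 0 <= \int[clk V s]_r (\1_N (r, w) : R) by apply: Rint_ge0 => r; rewrite indicE.
apply: sub_ae (ae_and (h pos) (ae_integrable2 iN)) => w [w0 iw].
apply: sub_ae (Rint_ge0_eq0 iw _ w0); last by move=> r; rewrite indicE.
by move=> r /eqP; rewrite indicE pnatr_eq0 eqb0 => /negP nN; apply: contrapT => /hN /mem_set.
Qed.

(** The moving end point is put into the integrand as an indicator, which leaves an integral over a
    fixed domain with parameter (t, w). *)
Lemma measurable_cumul_joint h : measurable_fun setT h ->
  measurable_fun setT (fun z : timeI T * cpath T E => cumul V s (fun r => h (r, z.2 r)) z.1).
Proof.
move=> mh.
rewrite (_ : (fun _ => _) = (fun z : timeI T * cpath T E => \int[clk V s]_q ((tval q <= tval z.1)%R%:R * h (graph (q, z.2))))); last first.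
  apply/funext => z; rewrite cumulE; apply: eq_Rintegral => q _; congr (_ * _).
  by rewrite indicE; congr (_%:R); congr nat_of_bool; apply/idP/idP; rewrite inE.
apply: (@measurable_Rint_clk _ _ V _ (timeI T * cpath T E)%type s
  (fun p => (tval p.1 <= tval p.2.1)%R%:R * h (graph (p.1, p.2.2)))).
apply: measurable_funM; last first.
  apply: (measurableT_comp (measurable_path_fun hE mh)).
  apply: measurable_fun_pair => //; exact: (measurableT_comp measurable_snd measurable_snd).
apply: (@measurableT_comp _ _ _ _ _ _ (fun b : bool => b%:R : R)) => //.
apply: measurable_fun_ler.
- exact: (measurableT_comp measurable_tval measurable_fst).
- by apply: (measurableT_comp measurable_tval); exact: (measurableT_comp measurable_fst measurable_snd).
Qed.

End path_integrals.

Section compensated_product.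
Context {R : realType} {T : {posnum R}} {E : ptopologicalType} (hE : polish R E).
Variables (Pr : timeI T -> E -> probability (cpath T E) R) (V : clock T).
Variables (s : timeI T) (x : E).
Implicit Types (phi chi : timeI T * borel E -> R).
Local Notation rho := (Pr s x).
Local Notation lam := (clk V s \x rho)%E.

Lemma zero_potential_ae A : zero_potential Pr V A ->
  {ae lam, forall z : timeI T * cpath T E, ~ A (graph z)}.
Proof.
move=> [mA A0].
have mgA : measurable (graph @^-1` A : set (timeI T * cpath T E)).
  exact: measurable_graph_preimage.
have l0 : (\int[lam]_z (\1_(graph @^-1` A) z)%:E = 0)%E.
  rewrite -(A0 s x) -(path_tonelli hE V s rho (h := \1_A)).
  - apply: eq_integral => z _; rewrite !indicE; congr (_%:R%:E).
  - exact: measurable_indic.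
  - by move=> z; rewrite indicE.
exists (graph @^-1` A); split => //; last by move=> z /= /contrapT.
by rewrite -[X in _ X = _]setIT -integral_indic.
Qed.

Lemma calL2P phi : measurable_fun setT phi ->
  (\int[rho]_w clock_int V s tmax (fun r => (`|phi (r, w r)| `^ 2)%:E) < +oo)%E <->
  sq_integrable lam (along phi).
Proof.
move=> mphi; have mpg := measurable_path_fun hE mphi.
have -> : (fun w : cpath T E => clock_int V s tmax (fun r => (`|phi (r, w r)| `^ 2)%:E)) =
    (fun w : cpath T E => clock_int V s tmax (fun r => (phi (r, w r) ^+ 2)%:E)).
  apply/funext => w; congr (clock_int _ _ _ _); apply/funext => r; congr EFin.
  by rewrite (powR_mulrn 2)// real_normK// num_real.
rewrite -(path_tonelli hE V s rho (h := fun z => phi z ^+ 2)); last 2 first.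
- exact: measurable_funX.
- by move=> z; exact: sqr_ge0.
have e : (\int[lam]_z (phi (graph z) ^+ 2)%:E = \int[lam]_z `|phi (graph z) ^+ 2|%:E)%E.
  by apply: eq_integral => z _; rewrite ger0_norm ?sqr_ge0.
rewrite e; split => [h|[_ h]].
- by split => //; apply/rintegrableP => //; exact: measurable_funX.
- by apply/(rintegrableP _ (measurable_funX _ mpg)).
Qed.

Lemma measurable_compensated_joint phi chi : measurable_fun setT phi -> measurable_fun setT chi ->
  measurable_fun setT (fun z : timeI T * cpath T E => compensated V phi chi s x z.1 z.2).
Proof.
move=> mp mc.
rewrite (_ : (fun _ => _) = (fun z : timeI T * cpath T E => (tval s <= tval z.1)%R%:R *
   (phi (graph z) - phi (s, x) - cumul V s (fun r => chi (r, z.2 r)) z.1))); last first.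
  apply/funext => z; rewrite /compensated; case: ifP => _; rewrite ?mul0r// mul1r.
  by rewrite drift_intE.
apply: measurable_funM.
  apply: (@measurableT_comp _ _ _ _ _ _ (fun b : bool => b%:R : R)) => //.
  by apply: measurable_fun_ler => //; exact: (measurableT_comp measurable_tval measurable_fst).
apply: measurable_funB; last exact: measurable_cumul_joint.
by apply: measurable_funB => //; exact: measurable_path_fun.
Qed.

(** The second moment at any time is at most the terminal one, and dV is finite. *)
Lemma compensated_sq_integrable phi chi M : measurable_fun setT phi -> measurable_fun setT chi ->
  cadlag_modification Pr V phi chi s x M ->
  sq_integrable lam (fun z : timeI T * cpath T E => compensated V phi chi s x z.1 z.2).
Proof.
move=> mp mc hM; have mY := measurable_compensated_joint mp mc; split => //.
apply: (@rintegrable_tonelli1 _ _ _ _ _ _ _ (\int[rho]_w (compensated V phi chi s x tmax w) ^+ 2)).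
- exact: measurable_funX.
- by move=> r; have [_ _ []] := cadlag_modification_ae hE mp mc hM r.
- move=> r; under eq_Rintegral do rewrite (ger0_norm (sqr_ge0 _)).
  by apply: (le_mean_sqr_compensated hE mp mc hM); exact: tval_le.
Qed.

End compensated_product.

Lemma ae_le_Rint d (X : measurableType d) (R : realType)
    (mu : {measure set X -> \bar R}) (f g : X -> R) :
  rintegrable mu f -> rintegrable mu g -> {ae mu, forall x, f x <= g x} ->
  \int[mu]_x f x <= \int[mu]_x g x.
Proof.
move=> hf hg fg; have mf := rintegrable_measurable hf; have mg := rintegrable_measurable hg.
pose h x := Num.min (f x) (g x).
have mh : measurable_fun setT h by exact: measurable_minr.
have fh : {ae mu, forall x, f x = h x} by apply: sub_ae fg => x fgx; rewrite /h (min_idPl fgx).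
rewrite (ae_eq_Rint mf mh fh); apply: le_Rint => //; first exact: ae_rintegrable fh hf.
by move=> x; rewrite /h ge_min lexx orbT.
Qed.

Section growth.
Context {R : realType} {T : {posnum R}} {E : ptopologicalType} (hE : polish R E).
Variables (Pr : timeI T -> E -> probability (cpath T E) R) (V : clock T).
Variables (s : timeI T) (x : E).
Variables (phi chi b : timeI T * borel E -> R) (C : R).
Local Notation rho := (Pr s x).
Local Notation lam := (clk V s \x rho)%E.
Local Notation m := (compensated V phi chi s x).
Hypotheses (mphi : measurable_fun setT phi) (mchi : measurable_fun setT chi)
  (mb : measurable_fun setT b) (b0 : forall z, 0 <= b z) (C0 : 0 < C).

(** With a = |phi(s, x)| + C \int b, the decomposition of phi(t, X_t) gives |phi_t| <= a + |m_t| + C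
    F(t). Gronwall bounds F by c (a + \int |m|), and collecting terms yields the coefficients 1 + C
    c and C c. *)
Lemma path_growth c (w : cpath T E) : 0 <= c ->
  (forall a y m, 0 <= a ->
    rintegrable (clk V s) y -> rintegrable (clk V s) m ->
    (forall t : timeI T, tval s <= tval t ->
       `|y t| <= a + `|m t| + C * cumul V s (fun r => `|y r|) t) ->
    \int[clk V s]_r `|y r| <= c * (a + \int[clk V s]_r `|m r|)) ->
  rintegrable (clk V s) (fun r => chi (r, w r)) ->
  rintegrable (clk V s) (fun r => b (r, w r)) ->
  rintegrable (clk V s) (fun r => m r w) ->
  {ae clk V s, forall r, `|chi (r, w r)| <= C * (b (r, w r) + `|phi (r, w r)|)} ->
  forall t : timeI T, tval s <= tval t ->
  `|phi (t, w t)| <= (1 + C * c) * (`|phi (s, x)| + C * \int[clk V s]_r b (r, w r)) +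
    C * c * \int[clk V s]_r `|m r w| + `|m t w|.
Proof.
move=> c0 gr ichi ib im hchi.
have idt t : tval s <= tval t ->
    phi (t, w t) = phi (s, x) + m t w + cumul V s (fun r => chi (r, w r)) t.
  by move=> st; rewrite /compensated st drift_intE//; ring.
have ncum t : `|cumul V s (fun r => chi (r, w r)) t| <= cumul V s (fun r => `|chi (r, w r)|) t.
  rewrite !cumulE; apply: (le_trans (le_normr_Rintegral _ _)) => //.
    by apply: rintegrable_indic => //; exact: measurable_upto.
  rewrite (@eq_Rintegral _ _ _ _ _ (fun r => \1_(upto t) r * `|chi (r, w r)|))// => r _.
  by rewrite normrM indicE ger0_norm.
have nid t : tval s <= tval t ->
    `|phi (t, w t)| <= `|phi (s, x)| + `|m t w| + cumul V s (fun r => `|chi (r, w r)|) t.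
  move=> st; rewrite idt//; apply: (le_trans (ler_normD _ _)); apply: lerD => //.
  exact: ler_normD.
have cfin := clk_finite V s.
(* Gronwall presupposes that phi is integrable along the path; the crude bound with the whole
   integral of |chi| in place of the running one gives this. *)
have iy : rintegrable (clk V s) (fun r => phi (r, w r)).
  apply: (@ae_le_rintegrable _ _ _ _ _ (fun r => `|phi (s, x)| + `|m r w| + \int[clk V s]_r `|chi (r, w r)|)).
  - exact: measurable_along_path.
  - apply: sub_ae (ae_from V s) => r sr; rewrite [leRHS]ger0_norm; last first.
      by rewrite !addr_ge0//; exact: Rint_ge0.
    apply: (le_trans (nid r sr)); rewrite lerD2l -cumul_tmax.
    by apply: cumul_le => //; [exact: rintegrable_norm|exact: tval_le].
  - apply: rintegrableD; last exact: rintegrable_cst.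
    by apply: rintegrableD; [exact: rintegrable_cst|exact: rintegrable_norm].
have iyn := rintegrable_norm iy; have ichin := rintegrable_norm ichi.
have mU t := @measurable_upto R T t.
have cb t : cumul V s (fun r => `|chi (r, w r)|) t <=
    C * \int[clk V s]_r b (r, w r) + C * cumul V s (fun r => `|phi (r, w r)|) t.
  apply: (@le_trans _ _ (\int[clk V s]_r (\1_(upto t) r * (C * (b (r, w r) + `|phi (r, w r)|))))).
    rewrite cumulE; apply: ae_le_Rint.
    - exact: rintegrable_indic.
    - by apply: rintegrable_indic => //; apply: rintegrableZ; exact: rintegrableD.
    - by apply: sub_ae hchi => r hr; apply: ler_wpM2l => //; rewrite indicE.
  rewrite -mulrDr -[X in _ <= X * _]/C cumulE.
  have -> : \int[clk V s]_r (\1_(upto t) r * (C * (b (r, w r) + `|phi (r, w r)|))) =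
      C * \int[clk V s]_r (\1_(upto t) r * (b (r, w r) + `|phi (r, w r)|)).
    rewrite -RintZ; last by apply: rintegrable_indic => //; exact: rintegrableD.
    by apply: eq_Rintegral => r _; rewrite mulrCA.
  rewrite ler_pM2l// -RintD//; last exact: rintegrable_indic.
  apply: le_Rint.
  - by apply: rintegrable_indic => //; exact: rintegrableD.
  - by apply: rintegrableD => //; exact: rintegrable_indic.
  - move=> r; rewrite mulrDr lerD2r indicE ler_piMl//; by case: (_ \in _).
set a := `|phi (s, x)| + C * \int[clk V s]_r b (r, w r).
have a0 : 0 <= a by rewrite addr_ge0// mulr_ge0 ?(ltW C0)// Rint_ge0.
have hyp t : tval s <= tval t ->
    `|phi (t, w t)| <= a + `|m t w| + C * cumul V s (fun r => `|phi (r, w r)|) t.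
  move=> st; apply: (le_trans (nid t st)); have := cb t; rewrite /a.
  by move=> h; rewrite -!addrA lerD2l [leRHS]addrCA lerD2l.
have G := gr a _ _ a0 iy im hyp.
move=> t st; apply: (le_trans (hyp t st)).
set I := \int[_]_r `|m r w|.
have -> : (1 + C * c) * a + C * c * I + `|m t w| = a + `|m t w| + C * (c * (a + I)) by ring.
rewrite lerD2l ler_pM2l//; apply: le_trans G; rewrite -cumul_tmax.
by apply: cumul_le => //; exact: tval_le.
Qed.

(** Stated for a general pair so as to serve both u, where b collects 1, eta and |v|, and each
    psi_i, where b = |a(psi_i)|. The pathwise bound splits into D, a function of w alone, and |m|,
    both in L^2. *)
Lemma growth_sq_integrable M A : cadlag_modification Pr V phi chi s x M ->
  drift_finite Pr V chi s x ->
  sq_integrable lam (along b) ->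
  zero_potential Pr V A -> (forall z, ~ A z -> `|chi z| <= C * (b z + `|phi z|)) ->
  sq_integrable lam (along phi).
Proof.
move=> hM fchi sb zA hchi; have [c c0 gr] := gronwall V s C0.
have sm := compensated_sq_integrable hE mphi mchi hM.
have lfin := prod_clk_finite V s rho.
pose D w := (1 + C * c) * (`|phi (s, x)| + C * \int[clk V s]_r b (graph (r, w))) +
    C * c * \int[clk V s]_r `|m r w|.
have rfin := probability_lty rho.
have sD : sq_integrable rho D.
  apply: sq_integrableD; apply: sq_integrableZ.
  - apply: sq_integrableD; first exact: sq_integrable_cst.
    by apply: sq_integrableZ; exact: (sq_integrable_Rint sb).
  - exact: (sq_integrable_Rint (sq_integrable_norm sm)).
have bound : {ae lam, forall z : timeI T * cpath T E, `|phi (graph z)| <= `|D z.2 + `|m z.1 z.2| |}.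
  have g1 := ae_path_rintegrable hE mchi fchi.
  have g2 := ae_integrable2 (sq_integrable_r lfin sb).
  have g3 := ae_integrable2 (sq_integrable_r lfin sm).
  have g4 := ae_section (zero_potential_ae hE s x zA).
  have good := ae_snd V s (ae_and (ae_and g1 g2) (ae_and g3 g4)).
  apply: sub_ae (ae_and good (ae_fst rho (ae_from V s))) => -[t w] /= [[[h1 h2] [h3 h4]] st].
  apply: le_trans (ler_norm _); apply: path_growth => //.
  by apply: sub_ae h4 => r; exact: hchi.
apply: ae_le_sq_integrable bound _; first exact: measurable_path_fun.
by apply: sq_integrableD; [exact: sq_integrable_snd|exact: sq_integrable_norm].
Qed.

End growth.

Lemma rintegrable_prod d1 d2 (X1 : measurableType d1) (X2 : measurableType d2) (R : realType)
    (m1 : {finite_measure set X1 -> \bar R}) (m2 : {finite_measure set X2 -> \bar R})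
    (f : X1 -> R) (g : X2 -> R) : rintegrable m1 f -> rintegrable m2 g ->
  rintegrable (m1 \x m2)%E (fun z => f z.1 * g z.2).
Proof.
move=> hf hg; have mf := rintegrable_measurable hf; have mg := rintegrable_measurable hg.
have mfg : measurable_fun setT (fun z : X1 * X2 => f z.1 * g z.2).
  by apply: measurable_funM; [exact: (measurableT_comp mf measurable_fst)|exact: (measurableT_comp mg measurable_snd)].
apply/integrable21ltyP; first exact/measurable_EFinP.
rewrite (eq_integral (fun y => `|((\int[m1]_x `|f x|) * g y)%:E|%E)); last first.
  move=> y _; rewrite (eq_integral (fun x => (`|g y| * `|f x|)%:E)); last first.
    by move=> x _; rewrite /= normrM mulrC.
  rewrite -EFin_Rint; last by apply: rintegrableZ; exact: rintegrable_norm.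
  rewrite RintZ; last exact: rintegrable_norm.
  by rewrite /= normrM (ger0_norm (Rint_ge0 _ _))// mulrC.
by have /(rintegrableP m2 (rintegrable_measurable (rintegrableZ _ hg))) := rintegrableZ (\int[m1]_x `|f x|) hg.
Qed.

(** * Integration by parts *)

Section cumul_product.
Context {R : realType} {T : {posnum R}} (V : clock T) (s : timeI T).
Local Notation mu := (clk V s).

Lemma cumul_lt (f : timeI T -> R) t : rintegrable mu f ->
  \int[mu]_(r in [set r | tval r < tval t]) f r = cumul V s f t.
Proof.
move=> hf; rewrite cumulE [LHS]Rint_indic.
have [_ mlt _ _] := @measurable_time_ray R T (tval t).
apply: ae_eq_Rint.
- exact: rintegrable_measurable (rintegrable_indic mlt hf).
- exact: rintegrable_measurable (rintegrable_indic (measurable_upto t) hf).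
exists [set t]; split.
- rewrite (_ : [set t] = @tval R T @^-1` [set tval t]).
    by rewrite -[X in measurable X]setTI; apply: measurable_tval => //; exact: measurable_real1.
  by apply/seteqP; split => r /=; [move=> ->|exact: tval_inj].
- exact: clk_set1.
- move=> r /= ne; apply: contrapT => rt; apply: ne; congr (_ * _); rewrite !indicE.
  congr (_%:R); congr nat_of_bool; apply/idP/idP; rewrite !inE /upto /=; first exact: ltW.
  by rewrite le_eqVlt => /predU1P[/tval_inj //|].
Qed.

(* There is no bracket term because dV has no atoms. *)
Lemma cumul_product (f g : timeI T -> R) : rintegrable mu f -> rintegrable mu g ->
  (\int[mu]_r f r) * (\int[mu]_r g r) =
  \int[mu]_r (cumul V s f r * g r + cumul V s g r * f r).
Proof.
move=> hf hg; have hfg := rintegrable_prod hf hg.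
pose A := [set z : timeI T * timeI T | tval z.1 <= tval z.2].
have mA : measurable A.
  rewrite -[X in measurable X]setTI.
  apply: (@measurable_fun_ler _ _ _ _ (fun z : timeI T * timeI T => tval z.1) (fun z => tval z.2) _ _ measurableT [set true]) => //.
  - exact: (measurableT_comp measurable_tval measurable_fst).
  - exact: (measurableT_comp measurable_tval measurable_snd).
have iA := rintegrable_indic mA hfg; have iC := rintegrable_indic (measurableC mA) hfg.
have tot : \int[(mu \x mu)%E]_z (f z.1 * g z.2) = (\int[mu]_r f r) * (\int[mu]_r g r).
  rewrite Rint_fubini2//= (@eq_Rintegral _ _ _ _ _ (fun y => (\int[mu]_r f r) * g y)).
    by rewrite RintZ.
  by move=> y _ /=; rewrite mulrC -RintZ//; apply: eq_Rintegral => r _; rewrite mulrC.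
have eA r : \int[mu]_q (\1_A (q, r) * (f q * g r)) = cumul V s f r * g r.
  rewrite mulrC cumulE -RintZ; last by apply: rintegrable_indic => //; exact: measurable_upto.
  apply: eq_Rintegral => q _; rewrite [RHS]mulrCA [g r * _]mulrC; congr (_ * _).
have eC r : \int[mu]_q (\1_(~` A) (r, q) * (f r * g q)) = cumul V s g r * f r.
  have [_ mlt _ _] := @measurable_time_ray R T (tval r).
  rewrite -(cumul_lt r hg) [X in _ = X * _]Rint_indic mulrC -RintZ; last exact: rintegrable_indic.
  apply: eq_Rintegral => q _; rewrite [RHS]mulrCA; congr (_ * _).
  rewrite !indicE in_setC; congr (_%:R); congr nat_of_bool.
  have -> : ((r, q) \in A) = (tval r <= tval q) by apply/idP/idP; rewrite inE.
  by rewrite -ltNge; apply/idP/idP; rewrite inE.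
have i1 : rintegrable mu (fun r => cumul V s f r * g r).
  by apply: eq_rintegrable (rintegrable_fubini2 iA) => r; exact: eA.
have i2 : rintegrable mu (fun r => cumul V s g r * f r).
  by apply: eq_rintegrable (rintegrable_fubini1 iC) => r; exact: eC.
have e1 : \int[mu]_r (cumul V s f r * g r) = \int[(mu \x mu)%E]_z (\1_A z * (f z.1 * g z.2)).
  by rewrite Rint_fubini2//; apply: eq_Rintegral => r _; rewrite -eA.
have e2 : \int[mu]_r (cumul V s g r * f r) = \int[(mu \x mu)%E]_z (\1_(~` A) z * (f z.1 * g z.2)).
  by rewrite Rint_fubini1//; apply: eq_Rintegral => r _; rewrite -eC.
rewrite RintD// e1 e2 -RintD// -tot; apply: eq_Rintegral => z _.
rewrite -mulrDl !indicE in_setC; case: (z \in A); rewrite /= ?addr0 ?add0r mul1r//.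
Qed.

End cumul_product.

(** * Laws of the process and means of products *)

Section law.
Context {R : realType} {T : {posnum R}} {E : ptopologicalType} (hE : polish R E).
Variables (Pr : timeI T -> E -> probability (cpath T E) R) (V : clock T).
Variable P : timeI T -> timeI T -> R.-pker (borel E) ~> (borel E).
Hypothesis law : forall s x (t : timeI T) (A : set (borel E)), measurable A ->
    Pr s x [set w | A (w t)] = P s t x A.
Variables (s : timeI T) (x : E).
Local Notation rho := (Pr s x).
Local Notation lam := (clk V s \x rho)%E.

Lemma ge0_law_integral t (h : borel E -> \bar R) : measurable_fun setT h ->
  (forall y, 0 <= h y)%E -> (\int[P s t x]_y h y = \int[rho]_w h (w t))%E.
Proof.
move=> mh h0; have me := @measurable_eval R T E t.
transitivity (\int[pushforward rho (fun w : cpath T E => w t : borel E)]_y h y)%E; last first.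
  by rewrite ge0_integral_pushforward.
by apply: eq_measure_integral => A mA _; rewrite -law.
Qed.

Lemma law_integral t (h : borel E -> R) : measurable_fun setT h ->
  (\int[P s t x]_y (h y)%:E = \int[rho]_w (h (w t))%:E)%E.
Proof.
move=> mh; have mEh : measurable_fun setT (EFin \o h) by exact/measurable_EFinP.
rewrite integralE [RHS]integralE; congr (_ - _)%E.
- rewrite ge0_law_integral//; last exact: measurable_funepos.
  by apply: eq_integral => w _; rewrite !funeposE.
- rewrite ge0_law_integral//; last exact: measurable_funeneg.
  by apply: eq_integral => w _; rewrite !funenegE.
Qed.

Lemma clock_law_integral (h : timeI T * borel E -> R) : measurable_fun setT h ->
  rintegrable lam (along h) ->
  clock_int V s tmax (fun r => (\int[P s r x]_y (h (r, y))%:E)%E) =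
  (\int[lam]_z h (graph z))%:E.
Proof.
move=> mh ih.
have -> : (fun r => (\int[P s r x]_y (h (r, y))%:E)%E) =
    fubini_F rho (EFin \o (along h)).
  apply/funext => r; rewrite (law_integral r (h := fun y => h (r, y)))//.
  by apply: (measurableT_comp mh); exact: measurable_fun_pair.
rewrite clock_intE ?upto_tmax; last exact: (measurable_fubini_F ih).
by rewrite EFin_Rint// integral12_prod_meas1.
Qed.

End law.

Section identities.
Context {R : realType} {T : {posnum R}} {E : ptopologicalType} (hE : polish R E).
Variables (Pr : timeI T -> E -> probability (cpath T E) R) (V : clock T).
Variables (s : timeI T) (x : E).
Implicit Types (phi chi psi beta h v : timeI T * borel E -> R) (M N : timeI T -> cpath T E -> R).
Local Notation rho := (Pr s x).
Local Notation lam := (clk V s \x rho)%E.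
Local Notation Y phi chi := (compensated V phi chi s x).
Local Notation L2 h := (sq_integrable lam (along h)).

Lemma cumul_tmin h (w : cpath T E) : measurable_fun setT h ->
  cumul V s (fun r => h (r, w r)) tmin = 0.
Proof.
move=> mh; rewrite /cumul /Rintegral null_set_integral//; first exact: measurable_upto.
- by apply: measurable_funTS; apply/measurable_EFinP; exact: measurable_along_path.
- rewrite (_ : upto tmin = [set tmin]); first exact: clk_set1.
  apply/seteqP; split => r /=; last by move=> ->; rewrite /upto/=.
  by rewrite /upto /= => r0; apply: tval_inj; apply/eqP; rewrite eq_le r0 tval_ge0.
Qed.

(** The vanishing at 0 is known under the completed measure. The mean of the square, equal under
    both measures, carries it back to the raw one. *)
Lemma compensated_tmin phi chi M : measurable_fun setT phi -> measurable_fun setT chi ->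
  cadlag_modification Pr V phi chi s x M -> {ae rho, forall w, Y phi chi tmin w = 0}.
Proof.
move=> mp mc hM; have [sM ae0 [mY iY]] := cadlag_modification_ae hE mp mc hM tmin.
have [[_ M0] _] := hM.
have : \int[rho]_w (Y phi chi tmin w ^+ 2) = 0.
  rewrite -Rint_Prc; last exact: measurable_funX.
  rewrite -(@Rint0 _ _ _ (Prc Pr s x)); apply: ae_eq_Rint.
  - exact: (measurable_fun_Prc (measurable_funX 2 mY)).
  - exact: measurable_cst.
  - by apply: sub_ae (ae_and M0 ae0) => w [-> <-]; rewrite expr0n.
move=> /(Rint_ge0_eq0 iY (fun w => sqr_ge0 _)); apply: sub_ae => w /eqP.
by rewrite sqrf_eq0 => /eqP.
Qed.

Lemma mean_path_Rint h : L2 h -> \int[rho]_w (\int[clk V s]_r h (r, w r)) =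
  \int[lam]_z h (graph z).
Proof. by move=> hh; rewrite (Rint_fubini2 (sq_integrable_r (prod_clk_finite V s rho) hh)). Qed.

Lemma mean_martingale_product phi chi psi beta v M N :
  measurable_fun setT phi -> measurable_fun setT chi ->
  measurable_fun setT psi -> measurable_fun setT beta -> measurable_fun setT v ->
  cadlag_modification Pr V phi chi s x M -> cadlag_modification Pr V psi beta s x N ->
  bracket_density V s rho (Y phi chi) (Y psi beta) v ->
  rintegrable lam (along v) ->
  \int[rho]_w (Y phi chi tmax w * Y psi beta tmax w) = \int[lam]_z v (graph z).
Proof.
move=> mp mc mp' mc' mv hM hN hv iv.
have h1 : measurable_wrt (cylinders tmin) (fun _ : cpath T E => 1 : R).
  exact: (measurable_cst _).
have c1 : exists c : R, forall w : cpath T E, `|1 : R| <= c by exists `|1|.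
have := hv tmin tmax (fun=> 1) (tval_ge0 tmax : tval tmin <= tval tmax) h1 c1.
under eq_Rintegral do rewrite mul1r.
under [X in _ = X -> _]eq_Rintegral do rewrite mul1r cumul_tmin// subr0 cumul_tmax.
rewrite (Rint_fubini2 iv) => <-.
have [_ _ [mYT _]] := cadlag_modification_ae hE mp mc hM tmax.
have [_ _ [mZT _]] := cadlag_modification_ae hE mp' mc' hN tmax.
have [_ _ [mY0 _]] := cadlag_modification_ae hE mp mc hM tmin.
have [_ _ [mZ0 _]] := cadlag_modification_ae hE mp' mc' hN tmin.
apply: ae_eq_Rint; first exact: measurable_funM.
  by apply: measurable_funM; exact: measurable_funB.
have a1 := compensated_tmin mp mc hM; have a2 := compensated_tmin mp' mc' hN.
by apply: sub_ae (ae_and a1 a2) => w [-> ->]; rewrite !subr0.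
Qed.

(** By Fubini the time integral comes outside; for fixed r the weight h(r, X_r) is known at r, so
    Y_T may be replaced by Y_r. *)
Lemma mean_martingale_drift phi chi h M :
  measurable_fun setT phi -> measurable_fun setT chi -> measurable_fun setT h ->
  cadlag_modification Pr V phi chi s x M -> L2 h ->
  \int[rho]_w (Y phi chi tmax w * \int[clk V s]_r h (r, w r)) =
  \int[lam]_z (Y phi chi z.1 z.2 * h (graph z)).
Proof.
move=> mp mc mh hM hh.
have [_ _ sYT] := cadlag_modification_ae hE mp mc hM tmax.
have sY := compensated_sq_integrable hE mp mc hM.
have iTh := sq_integrable_rM (sq_integrable_snd V s sYT) hh.
have iYh := sq_integrable_rM sY hh.
have [mhg ih2] := hh.
transitivity (\int[lam]_z (Y phi chi tmax z.2 * h (graph z))).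
  rewrite (Rint_fubini2 iTh); apply: ae_eq_Rint.
  - apply: measurable_funM; first by case: sYT.
    exact: (rintegrable_measurable (rintegrable_fubini2 (sq_integrable_r (prod_clk_finite V s rho) hh))).
  - exact: rintegrable_measurable (rintegrable_fubini2 iTh).
  - apply: sub_ae (ae_integrable2 (sq_integrable_r (prod_clk_finite V s rho) hh)) => w iw.
    by rewrite /= RintZ.
rewrite (Rint_fubini1 iTh) (Rint_fubini1 iYh); apply: ae_eq_Rint.
- exact: rintegrable_measurable (rintegrable_fubini1 iTh).
- exact: rintegrable_measurable (rintegrable_fubini1 iYh).
(* Only for almost every r is h(r, X_r) square integrable under [rho], which the conditioning
   requires. *)
apply: sub_ae (ae_integrable1 ih2) => r ir /=.
pose W (w : cpath T E) := h (r, w r).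
have mW : measurable_wrt (cylinders r) W.
  move=> _ B mB; rewrite setTI; apply: sub_sigma_algebra; exists r.
  exists [set y | B (h (r, y))]; split => //.
  have mr : measurable_fun setT (fun y : borel E => h (r, y)).
    by apply: (measurableT_comp mh); exact: measurable_fun_pair.
  by have := mr measurableT B mB; rewrite setTI.
have sW : sq_integrable rho W by split => //; exact: measurable_state.
have := compensated_condexp hE mp mc hM (tval_le r : tval r <= tval tmax) mW sW.
under eq_Rintegral do rewrite mulrC.
by under [X in _ = X -> _]eq_Rintegral do rewrite mulrC.
Qed.

Lemma cumul_sq_integrable h : measurable_fun setT h -> L2 h ->
  sq_integrable lam (fun z : timeI T * cpath T E => cumul V s (fun r => h (r, z.2 r)) z.1).
Proof.
move=> mh hh; have sI := sq_integrable_snd V s (sq_integrable_Rint (sq_integrable_norm hh)).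
have bound : {ae lam, forall z : timeI T * cpath T E, `|cumul V s (fun r => h (r, z.2 r)) z.1| <= `|\int[clk V s]_r `|h (graph (r, z.2))| |}.
  apply: sub_ae (ae_snd V s (ae_integrable2 (sq_integrable_r (prod_clk_finite V s rho) hh))) => -[t w] /= iw.
  apply: le_trans (ler_norm _); rewrite cumulE.
  have i1 : rintegrable (clk V s) (fun r => \1_(upto t) r * h (r, w r)).
    by apply: rintegrable_indic => //; exact: measurable_upto.
  apply: (le_trans (le_normr_Rintegral _ i1)) => //.
  apply: le_Rint; [exact: rintegrable_norm|exact: rintegrable_norm|].
  by move=> r; rewrite normrM indicE ger0_norm// ler_piMl//; case: (_ \in _).
by apply: ae_le_sq_integrable bound sI; exact: measurable_cumul_joint.
Qed.

Lemma mean_drift_product chi beta : measurable_fun setT chi -> measurable_fun setT beta ->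
  L2 chi -> L2 beta ->
  \int[rho]_w ((\int[clk V s]_r chi (r, w r)) * (\int[clk V s]_r beta (r, w r))) =
  \int[lam]_z (cumul V s (fun r => chi (r, z.2 r)) z.1 * beta (graph z) +
               cumul V s (fun r => beta (r, z.2 r)) z.1 * chi (graph z)).
Proof.
move=> mc mb hc hb.
have i1 := sq_integrable_rM (cumul_sq_integrable mc hc) hb.
have i2 := sq_integrable_rM (cumul_sq_integrable mb hb) hc.
have i12 := rintegrableD i1 i2.
have ic := sq_integrable_r (prod_clk_finite V s rho) hc; have ib := sq_integrable_r (prod_clk_finite V s rho) hb.
rewrite (Rint_fubini2 i12); apply: ae_eq_Rint.
- exact: (measurable_funM (rintegrable_measurable (rintegrable_fubini2 ic)) (rintegrable_measurable (rintegrable_fubini2 ib))).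
- exact: rintegrable_measurable (rintegrable_fubini2 i12).
- by apply: sub_ae (ae_and (ae_integrable2 ic) (ae_integrable2 ib)) => w [icw ibw]; exact: cumul_product.
Qed.

End identities.

Section terminal.
Context {R : realType} {T : {posnum R}} {E : ptopologicalType} (hE : polish R E).
Variables (Pr : timeI T -> E -> probability (cpath T E) R) (V : clock T).
Variables (s : timeI T) (x : E).
Local Notation rho := (Pr s x).
Local Notation lam := (clk V s \x rho)%E.
Local Notation L2 h := (sq_integrable lam (along h)).
Local Notation A h w := (\int[clk V s]_r h (r, w r)).

Let rfin : (rho setT < +oo)%E. Proof. exact: probability_lty. Qed.

Section one.
Variables (phi chi : timeI T * borel E -> R) (M : timeI T -> cpath T E -> R).
Hypotheses (mphi : measurable_fun setT phi) (mchi : measurable_fun setT chi)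
  (hM : cadlag_modification Pr V phi chi s x M) (hchi : L2 chi).
Local Notation Y := (compensated V phi chi s x).

Lemma terminalE (w : cpath T E) :
  phi (tmax, w tmax) = phi (s, x) + Y tmax w + A chi w.
Proof. by rewrite /compensated (tval_le s) drift_intE// cumul_tmax; ring. Qed.

Lemma pathE (t : timeI T) (w : cpath T E) : tval s <= tval t ->
  phi (t, w t) = phi (s, x) + Y t w + cumul V s (fun r => chi (r, w r)) t.
Proof. by move=> st; rewrite /compensated st drift_intE//; ring. Qed.

Lemma terminal_martingale_sq : sq_integrable rho (Y tmax).
Proof. by have [] := cadlag_modification_ae hE mphi mchi hM tmax. Qed.

Lemma drift_sq : sq_integrable rho (fun w => A chi w).
Proof. exact: (sq_integrable_Rint hchi). Qed.

Lemma terminal_sq_integrable : sq_integrable rho (fun w => phi (tmax, w tmax)).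
Proof.
rewrite (funext terminalE); apply: sq_integrableD; last exact: drift_sq.
apply: sq_integrableD; last exact: terminal_martingale_sq.
exact: (sq_integrable_cst rfin).
Qed.

Lemma mean_terminal :
  phi (s, x) = \int[rho]_w phi (tmax, w tmax) - \int[lam]_z chi (graph z).
Proof.
have i1 := sq_integrable_r rfin terminal_martingale_sq.
have i2 := sq_integrable_r rfin drift_sq.
have i0 := rintegrable_cst rfin (phi (s, x)).
rewrite (funext terminalE) RintD//; last exact: rintegrableD.
rewrite RintD// (compensated_mean hE tmax mphi mchi hM) addr0 Rint_cst.
have /= -> := @probability_setT _ _ _ rho.
by rewrite mulr1 mean_path_Rint// addrK.
Qed.

Lemma mean_path_mul h : L2 phi -> L2 h ->
  \int[lam]_z (phi (graph z) * h (graph z)) =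
  phi (s, x) * \int[lam]_z h (graph z) + \int[lam]_z (Y z.1 z.2 * h (graph z)) +
  \int[lam]_z (cumul V s (fun r => chi (r, z.2 r)) z.1 * h (graph z)).
Proof.
move=> hphi hh; have ih := sq_integrable_r (prod_clk_finite V s rho) hh.
have iYh := sq_integrable_rM (compensated_sq_integrable hE mphi mchi hM) hh.
have iAh := sq_integrable_rM (cumul_sq_integrable hE mchi hchi) hh.
have iph := rintegrableZ (phi (s, x)) ih.
rewrite -(RintZ (phi (s, x)) ih) -(RintD iph iYh) -(RintD (rintegrableD iph iYh) iAh).
apply: ae_eq_Rint.
- exact: rintegrable_measurable (sq_integrable_rM hphi hh).
- exact: rintegrable_measurable (rintegrableD (rintegrableD iph iYh) iAh).
- apply: sub_ae (ae_fst rho (ae_from V s)) => -[t w] /= st.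
  by rewrite /graph /= (pathE w st) !mulrDl.
Qed.

End one.

Section two.
Variables (phi chi psi beta v : timeI T * borel E -> R) (M N : timeI T -> cpath T E -> R).
Hypotheses (mphi : measurable_fun setT phi) (mchi : measurable_fun setT chi)
  (mpsi : measurable_fun setT psi) (mbeta : measurable_fun setT beta)
  (mv : measurable_fun setT v).
Hypotheses (hM : cadlag_modification Pr V phi chi s x M)
  (hN : cadlag_modification Pr V psi beta s x N).
Hypotheses (hphi : L2 phi) (hpsi : L2 psi) (hchi : L2 chi) (hbeta : L2 beta)
  (iv : rintegrable lam (along v)).
Hypothesis bv : bracket_density V s rho (compensated V phi chi s x) (compensated V psi beta s x) v.
Local Notation Y := (compensated V phi chi s x).
Local Notation Z := (compensated V psi beta s x).
Local Notation p0 := (phi (s, x)).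
Local Notation q0 := (psi (s, x)).

(** The grouping follows the nested uses of [RintD] in the next proof. *)
Lemma expand_product (R' : realFieldType) (p y a q z b : R') :
  (p + y + a) * (q + z + b) =
  ((p * q + p * z) + (p * b + q * y)) + ((y * z + y * b) + (q * a + (z * a + a * b))).
Proof. by ring. Qed.

Lemma mean_terminal_product :
  \int[rho]_w (phi (tmax, w tmax) * psi (tmax, w tmax)) =
  p0 * q0 + p0 * \int[rho]_w A beta w + q0 * \int[rho]_w A chi w +
  (\int[rho]_w (Y tmax w * Z tmax w) + \int[rho]_w (Y tmax w * A beta w) +
   \int[rho]_w (Z tmax w * A chi w) + \int[rho]_w (A chi w * A beta w)).
Proof.
have sY := terminal_martingale_sq mphi mchi hM; have sZ := terminal_martingale_sq mpsi mbeta hN.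
have sA := drift_sq hchi; have sB := drift_sq hbeta.
have iY := sq_integrable_r rfin sY; have iZ := sq_integrable_r rfin sZ.
have iA := sq_integrable_r rfin sA; have iB := sq_integrable_r rfin sB.
have iYZ := sq_integrable_rM sY sZ; have iYB := sq_integrable_rM sY sB.
have iZA := sq_integrable_rM sZ sA; have iAB := sq_integrable_rM sA sB.
have ic := rintegrable_cst rfin (p0 * q0).
have ipZ := rintegrableZ p0 iZ; have ipB := rintegrableZ p0 iB.
have iqY := rintegrableZ q0 iY; have iqA := rintegrableZ q0 iA.
under eq_Rintegral do rewrite (terminalE phi mchi) (terminalE psi mbeta) expand_product.
rewrite RintD; first last.
- by apply: rintegrableD; apply: rintegrableD => //; exact: rintegrableD.
- by apply: rintegrableD; exact: rintegrableD.
rewrite (RintD (rintegrableD ic ipZ) (rintegrableD ipB iqY)) (RintD ic ipZ) (RintD ipB iqY).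
rewrite (RintD (rintegrableD iYZ iYB) (rintegrableD iqA (rintegrableD iZA iAB))) (RintD iYZ iYB).
rewrite (RintD iqA (rintegrableD iZA iAB)) (RintD iZA iAB).
rewrite (RintZ p0 iZ) (RintZ p0 iB) (RintZ q0 iY) (RintZ q0 iA).
rewrite (compensated_mean hE tmax mphi mchi hM) (compensated_mean hE tmax mpsi mbeta hN).
rewrite Rint_cst; have /= -> := @probability_setT _ _ _ rho.
by rewrite /=; ring.
Qed.

(** The terms recombine: those carrying [beta] add up to the integral of (p0 + Y + A) beta, that is
    of phi beta, and those carrying [chi] to that of psi chi. Only E[Y_T Z_T], the integral of v, is
    left over. *)
Lemma product_formula :
  p0 * q0 = \int[rho]_w (phi (tmax, w tmax) * psi (tmax, w tmax)) -
  \int[lam]_z (v (graph z) + phi (graph z) * beta (graph z) + psi (graph z) * chi (graph z)).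
Proof.
have lfin := prod_clk_finite V s rho.
have iAb := sq_integrable_rM (cumul_sq_integrable hE mchi hchi) hbeta.
have iBc := sq_integrable_rM (cumul_sq_integrable hE mbeta hbeta) hchi.
have iub := sq_integrable_rM hphi hbeta; have ipc := sq_integrable_rM hpsi hchi.
rewrite RintD//; last exact: rintegrableD.
rewrite RintD// (mean_path_mul mphi mchi hM hchi hphi hbeta).
rewrite (mean_path_mul mpsi mbeta hN hbeta hpsi hchi) mean_terminal_product.
rewrite (mean_martingale_product hE mphi mchi mpsi mbeta mv hM hN bv iv).
rewrite (mean_martingale_drift hE mphi mchi mbeta hM hbeta).
rewrite (mean_martingale_drift hE mpsi mbeta mchi hN hchi).
rewrite (mean_drift_product hE mchi mbeta hchi hbeta) (RintD iAb iBc).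
rewrite !mean_path_Rint//.
by ring.
Qed.

End two.

End terminal.

(** * Martingale solutions solve the identification problem *)

Section carre_du_champ.
Context {R : realType} {T : {posnum R}} {E : ptopologicalType} (hE : polish R E).
Variables (Pr : timeI T -> E -> probability (cpath T E) R) (V : clock T).
Variables (s : timeI T) (x : E).
Variables (phi psi chi beta : timeI T * borel E -> R) (M N : timeI T -> cpath T E -> R).
Hypotheses (aphi : is_frak_a Pr V phi chi) (apsi : is_frak_a Pr V psi beta).
Hypotheses (hM : cadlag_modification Pr V phi chi s x M)
  (hN : cadlag_modification Pr V psi beta s x N).
Local Notation rho := (Pr s x).
Local Notation lam := (clk V s \x rho)%E.
Local Notation L2 h := (sq_integrable lam (along h)).

Lemma frak_G_density G : is_frak_G Pr V psi phi G ->
  bracket_density V s rho (compensated V phi chi s x) (compensated V psi beta s x) G.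
Proof.
move=> hG p q W pq mW bW; rewrite (compensated_bracket hE aphi apsi hM hN hG pq mW bW).
by have [_ _ mG _] := hG; apply: eq_Rintegral => w _; rewrite !drift_intE.
Qed.

Lemma frak_G_unique G G' : is_frak_G Pr V psi phi G -> is_frak_G Pr V psi phi G' ->
  {ae lam, forall z : timeI T * cpath T E, G (graph z) = G' (graph z)}.
Proof.
move=> hG hG'; have [_ _ mG _] := hG; have [_ _ mG' _] := hG'.
exact: (bracket_density_unique hE mG mG' (frak_G_rintegrable hE aphi apsi hM hN hG)
  (frak_G_rintegrable hE aphi apsi hM hN hG') (frak_G_density hG) (frak_G_density hG')).
Qed.

End carre_du_champ.

Section carre_du_champ_bound.
Context {R : realType} {T : {posnum R}} {E : ptopologicalType} (hE : polish R E).
Variables (Pr : timeI T -> E -> probability (cpath T E) R) (V : clock T).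
Variables (s : timeI T) (x : E).
Variables (phi psi chi beta : timeI T * borel E -> R) (M N : timeI T -> cpath T E -> R).
Hypotheses (aphi : is_frak_a Pr V phi chi) (apsi : is_frak_a Pr V psi beta).
Hypotheses (hM : cadlag_modification Pr V phi chi s x M)
  (hN : cadlag_modification Pr V psi beta s x N).
Local Notation rho := (Pr s x).
Local Notation lam := (clk V s \x rho)%E.

Lemma frak_G_sq_integrable G G0 : is_frak_G Pr V psi phi G -> is_frak_G Pr V psi psi G0 ->
  (exists C : R, forall z, `|G0 z| <= C) ->
  sq_integrable lam (along G).
Proof.
move=> hG hG0 [C G0C]; have [_ _ mG _] := hG; have [_ _ mG0 _] := hG0.
have [mphi [mchi _] _] := aphi; have [mpsi [mbeta _] _] := apsi.
(* Young's inequality divides by the bound, so it must be positive. *)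
have K0 : 0 < `|C| + 1 by exact: ltr_wpDl.
have G0K z : `|G0 z| <= `|C| + 1.
  by rewrite (le_trans (G0C z))// (le_trans (ler_norm _))// lerDl.
apply: (density_sq_integrable hE mG mG0 (frak_G_rintegrable hE aphi apsi hM hN hG) K0 G0K
  _ _ _ (frak_G_density hE aphi apsi hM hN hG) (frak_G_density hE apsi apsi hN hN hG0)).
- by move=> t; have [] := cadlag_modification_ae hE mphi mchi hM t.
- by move=> t; have [] := cadlag_modification_ae hE mpsi mbeta hN t.
- by move=> p q pq; exact: (mean_sqr_increment hE mphi mchi hM pq).
Qed.

End carre_du_champ_bound.

Lemma euclidean_norm_le (R : realType) n (z : n.-tuple R) :
  euclidean_norm z <= \sum_(i < n) `|tnth z i|.
Proof.
have s0 : 0 <= \sum_(i < n) `|tnth z i| by exact: sumr_ge0.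
rewrite /euclidean_norm -(ger0_norm s0) -sqrtr_sqr ler_wsqrtr//.
rewrite expr2 mulr_suml; apply: ler_sum => i _.
rewrite -real_normK ?num_real// expr2 ler_wpM2l//.
by rewrite (bigD1 i)//= lerDl sumr_ge0.
Qed.

Section pseudo_pde.
Context {R : realType} {T : {posnum R}} {E : ptopologicalType} (hE : polish R E).
Variable n : nat.
Variable f : timeI T * borel E * R * n.-tuple R -> R.
Implicit Types (u : timeI T * borel E -> R) (v : 'I_n -> timeI T * borel E -> R).

Lemma measurable_fcomp u v : measurable_fun setT f -> measurable_fun setT u ->
  (forall i, measurable_fun setT (v i)) -> measurable_fun setT (fcomp f u v).
Proof.
move=> mf mu mv; apply: (measurableT_comp mf).
apply: measurable_fun_pair; last first.
  apply/measurable_fun_tnthP => i; rewrite (_ : _ \o _ = v i)//.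
  by apply/funext => z; rewrite /= tnth_mktuple.
by apply: measurable_fun_pair => //; exact: measurable_fun_pair.
Qed.

Lemma fcomp_growth (zeta eta : borel E -> R) (g : borel E -> R) :
  Hgrowth f g zeta eta -> exists2 C : R, 0 < C & forall u v z,
  `|fcomp f u v z| <= C * ((1 + eta z.2 + \sum_(i < n) `|v i z|) + `|u z|).
Proof.
move=> [_ _ _ [C C0 hC]]; exists C => // u v z; apply: (le_trans (hC _ _ _ _)).
rewrite ler_pM2l// [leRHS]addrAC lerD2l.
apply: (le_trans (euclidean_norm_le _)); apply: ler_sum => i _.
by rewrite tnth_mktuple.
Qed.

End pseudo_pde.

Section moments.
Context {R : realType} {T : {posnum R}} {E : ptopologicalType} (hE : polish R E).
Variables (Pr : timeI T -> E -> probability (cpath T E) R) (V : clock T).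

Lemma Hmom_sq_integrable (zeta eta : borel E -> R) s x : measurable_fun setT eta ->
  Hmom Pr V zeta eta ->
  sq_integrable (clk V s \x Pr s x)%E (fun z : timeI T * cpath T E => eta (graph z).2).
Proof.
move=> meta /(_ s x)[_ hm].
have me2 : measurable_fun setT (fun z : timeI T * borel E => eta z.2).
  exact: (measurableT_comp meta measurable_snd).
apply/(calL2P hE Pr V s x me2); apply: le_lt_trans hm.
apply: ge0_le_integral_nm => w; first by apply: integral_ge0 => r _; rewrite lee_fin.
rewrite /clock_int /=.
have e2 r : `|eta (w (clamp r))| `^ 2 = eta (w (clamp r)) ^+ 2.
  by rewrite (powR_mulrn 2)// real_normK// num_real.
under eq_integral do rewrite e2.
(* The moment hypothesis integrates from 0, the claim from s. *)
apply: ge0_subset_integral; [exact: measurable_itv|exact: measurable_itv| | |].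
- apply: measurable_funTS; apply/measurable_EFinP.
  apply: (@measurableT_comp _ _ _ _ _ _ (fun r : timeI T => eta (w r) ^+ 2)).
    by apply: measurable_funX; exact: (measurable_along_path hE w me2).
  exact: measurable_clamp.
- by move=> r _; rewrite lee_fin sqr_ge0.
- by apply: subset_itvr; rewrite bnd_simp tval_ge0.
Qed.

Lemma zero_potential0 : zero_potential Pr V set0.
Proof.
split => // s x; apply: integral0_eq => w _; rewrite /clock_int.
by apply: integral0_eq => r _; rewrite indicE in_set0.
Qed.

End moments.

Lemma ae_forall_fin d (X : measurableType d) (R : realType) (mu : {measure set X -> \bar R})
    (I : finType) (Q : I -> X -> Prop) : (forall i, {ae mu, forall x, Q i x}) ->
  {ae mu, forall x, forall i, Q i x}.
Proof. by move=> aeQ; exact: filter_forall. Qed.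

Section solution.
Context {R : realType} {T : {posnum R}} {E : ptopologicalType} (hE : polish R E).
Variables (P : timeI T -> timeI T -> R.-pker (borel E) ~> (borel E)).
Variables (Pr : timeI T -> E -> probability (cpath T E) R) (V : clock T).
Hypothesis hPr : is_canonical_markov_class Pr P.
Variables (Da : set (timeI T * borel E -> R))
  (a : (timeI T * borel E -> R) -> (timeI T * borel E -> R)).
Hypotheses (ha : is_operator Da a) (hMP : solves_martingale_problem Pr V Da a).
Variables (n : nat) (psi : 'I_n -> timeI T * borel E -> R).
Hypotheses (hpsi : forall i, Da (psi i)) (hapsi : forall i, calL Pr V 2 (a (psi i)))
  (hGpsi : forall i, exists2 G, is_frak_G Pr V (psi i) (psi i) G &
     exists C : R, forall z, `|G z| <= C).
Variables (zeta eta : borel E -> R).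
Hypotheses (meta : measurable_fun setT eta) (eta0 : forall x, 0 <= eta x)
  (hmom : Hmom Pr V zeta eta).
Variables (f : timeI T * borel E * R * n.-tuple R -> R) (g : borel E -> R).
Hypothesis hgrowth : Hgrowth f g zeta eta.
Variable u : timeI T * borel E -> R.
Hypothesis hu : martingale_solution f g Pr V psi u.
Variable v : 'I_n -> timeI T * borel E -> R.
Hypothesis hv : forall i, is_frak_G Pr V (psi i) u (v i).

Let apsi i : is_frak_a Pr V (psi i) (a (psi i)).
Proof. exact: (domain_is_frak_a hE ha hMP (hpsi i)). Qed.

Let mv i : measurable_fun setT (v i). Proof. by case: (hv i). Qed.
Let mf : measurable_fun setT f. Proof. by case: hgrowth. Qed.
Let mg : measurable_fun setT g. Proof. by case: hgrowth. Qed.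
Let mu : measurable_fun setT u. Proof. by case: hu. Qed.
Let uT y : u (tmax, y) = g y. Proof. by case: hu. Qed.
Let mfuv : measurable_fun setT (fcomp f u v). Proof. exact: measurable_fcomp. Qed.

Section point.
Variables (s : timeI T) (x : E).
Local Notation rho := (Pr s x).
Local Notation lam := (clk V s \x rho)%E.
Local Notation L2 h := (sq_integrable lam (along h)).

(** v0 is the representative supplied with the solution and v an arbitrary one. The growth bound on
    chi is available for v0; uniqueness then transports the equation to v. *)
Lemma solution_sq_integrable chi v0 :
  is_frak_a Pr V u chi -> (forall i, is_frak_G Pr V (psi i) u (v0 i)) ->
  eq_zero_potential Pr V chi (fun z => - fcomp f u v0 z) ->
  [/\ L2 u, forall i, L2 (v i), forall i, L2 (psi i), L2 chi &
    {ae lam, forall z : timeI T * cpath T E, fcomp f u v (graph z) = - chi (graph z)}].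
Proof.
move=> au hv0 [A zA chiA]; have [_ [mchi fchi] hM'] := au; have [M hM] := hM' s x.
have hN i := compensated_modification hE ha hMP s x (hpsi i).
have Lv w0 : (forall i, is_frak_G Pr V (psi i) u (w0 i)) -> forall i, L2 (w0 i).
  move=> hw i; have [G0 hG0 bG0] := hGpsi i.
  exact: (frak_G_sq_integrable hE au (apsi i) hM (hN i) (hw i) hG0 bG0).
have mv0 i : measurable_fun setT (v0 i) by case: (hv0 i).
have [C C0 hC] := fcomp_growth hgrowth.
pose b (z : timeI T * borel E) := 1 + eta z.2 + \sum_(i < n) `|v0 i z|.
have b0 z : 0 <= b z by rewrite !addr_ge0// sumr_ge0.
have lfin := prod_clk_finite V s rho.
have Lb : L2 b.
  apply: sq_integrableD.
    apply: sq_integrableD; first exact: sq_integrable_cst.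
    exact: (Hmom_sq_integrable hE s x meta hmom).
  apply: sq_integrable_sum => i; apply: sq_integrable_norm; exact: Lv.
have chib z : ~ A z -> `|chi z| <= C * (b z + `|u z|).
  by move=> nA; rewrite chiA// normrN; exact: hC.
have Lu : L2 u := growth_sq_integrable hE mu mchi b0 C0 hM (fchi s x) Lb zA chib.
have aeA := zero_potential_ae hE s x zA.
have Lchi : L2 chi.
  apply: (@ae_le_sq_integrable _ _ _ _ _ (fun z => C * (b (graph z) + `|u (graph z)|))).
  - exact: measurable_path_fun.
  - apply: sub_ae aeA => z /chib /le_trans; apply; exact: ler_norm.
  - by apply: sq_integrableZ; apply: sq_integrableD => //; exact: sq_integrable_norm.
split => //; first exact: Lv.
- move=> i; have [mpsi [mapsi fapsi] _] := apsi i.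
  (* For psi_i the growth bound is trivial: C = 1, b = |a(psi_i)| and no exceptional set. *)
  apply: (growth_sq_integrable hE mpsi mapsi (b := fun z => `|a (psi i) z|) _ ltr01 (hN i)
    (fapsi s x) _ (zero_potential0 Pr V)) => //.
  + apply: sq_integrable_norm; apply/(calL2P hE Pr V s x mapsi).
    by have [_] := hapsi i; exact.
  + by move=> z _; rewrite mul1r lerDl.
- have aev : {ae lam, forall z : timeI T * cpath T E, forall i, v i (graph z) = v0 i (graph z)}.
    have aei i := frak_G_unique hE au (apsi i) hM (hN i) (hv i) (hv0 i).
    exact: ae_forall_fin aei.
  apply: sub_ae (ae_and aeA aev) => z [nA vv0]; rewrite chiA// opprK /fcomp.
  by congr (f (_, _)); apply: eq_from_tnth => i; rewrite !tnth_mktuple.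
Qed.

(** Both equations are proved on path space: [law_integral] and [clock_law_integral] turn kernel
    integrals into means, [chi] is replaced by [- fcomp f u v] almost everywhere, and [uT] puts g
    for the terminal value of u. *)
Lemma solution_equations :
  ((u (s, x))%:E = \int[P s tmax x]_y (g y)%:E +
    clock_int V s tmax (fun r => \int[P s r x]_y (fcomp f u v (r, y))%:E))%E /\
  (forall i, (u (s, x) * psi i (s, x))%:E =
    \int[P s tmax x]_y (g y * psi i (tmax, y))%:E -
    clock_int V s tmax (fun r =>
      \int[P s r x]_y (v i (r, y) + u (r, y) * a (psi i) (r, y)
                       - psi i (r, y) * fcomp f u v (r, y))%:E))%E.
Proof.
have [_ [chi [v0 [au hv0 chiE]]] _] := hu.
have [Lu Lv Lpsi Lchi aechi] := solution_sq_integrable au hv0 chiE.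
have [_ [mchi _] hM'] := au; have [M hM] := hM' s x.
have law := hPr.1; have lfin := prod_clk_finite V s rho.
have rfin := probability_lty rho.
have aechi' : {ae lam, forall z : timeI T * cpath T E, - chi (graph z) = fcomp f u v (graph z)}.
  by apply: sub_ae aechi => z ->.
have Lf : L2 (fcomp f u v).
  apply: ae_sq_integrable aechi' _; first exact: measurable_path_fun.
  exact: sq_integrableN.
have ic := sq_integrable_r lfin Lchi; have if_ := sq_integrable_r lfin Lf.
have mcg := measurable_path_fun hE mchi; have mfg := measurable_path_fun hE mfuv.
have suT := terminal_sq_integrable hE mu mchi hM Lchi.
split.
  rewrite (law_integral law s x tmax mg) (clock_law_integral law mfuv if_).
  rewrite -EFin_Rint; last first.
    by apply: (eq_rintegrable _ (sq_integrable_r rfin suT)) => w; exact: uT.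
  rewrite -EFinD; congr EFin; rewrite (mean_terminal hE mu mchi hM Lchi).
  congr (_ + _); first by apply: eq_Rintegral => w _; rewrite uT.
  rewrite -RintN//; apply: ae_eq_Rint => //; exact: measurable_funN.
move=> i; have [mpsi [mapsi _] _] := apsi i.
have hN := compensated_modification hE ha hMP s x (hpsi i).
have Lbeta : L2 (a (psi i)) by apply/(calL2P hE Pr V s x mapsi); have [_] := hapsi i; exact.
have iv := sq_integrable_r lfin (Lv i).
have bv := frak_G_density hE au (apsi i) hM hN (hv i).
have spT := terminal_sq_integrable hE mpsi mapsi hN Lbeta.
have mgp : measurable_fun setT (fun y : borel E => g y * psi i (tmax, y)).
  apply: measurable_funM => //; apply: (measurableT_comp mpsi); exact: measurable_fun_pair.
pose h (z : timeI T * borel E) := v i z + u z * a (psi i) z - psi i z * fcomp f u v z.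
have mh : measurable_fun setT h.
  apply: measurable_funB; last exact: measurable_funM.
  by apply: measurable_funD => //; exact: measurable_funM.
have iub := sq_integrable_rM Lu Lbeta.
have ipf := sq_integrable_rM (Lpsi i) Lf; have ipc := sq_integrable_rM (Lpsi i) Lchi.
have ih : rintegrable lam (along h).
  by apply: rintegrableB => //; exact: rintegrableD.
rewrite (law_integral law s x tmax mgp) (clock_law_integral law mh ih).
rewrite -EFin_Rint; last first.
  apply: (eq_rintegrable _ (sq_integrable_rM suT spT)) => w; by rewrite uT.
rewrite -EFinB; congr EFin.
rewrite (product_formula hE mu mchi mpsi mapsi (mv i) hM hN Lu (Lpsi i) Lchi Lbeta iv bv).
congr (_ - _); first by apply: eq_Rintegral => w _; rewrite uT.
apply: ae_eq_Rint.
- exact: rintegrable_measurable (rintegrableD (rintegrableD iv iub) ipc).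
- exact: rintegrable_measurable ih.
- by apply: sub_ae aechi => z hz; rewrite /h hz mulrN opprK.
Qed.

End point.

Lemma frak_G_solution_IP : solution_IP f g Pr V psi P a u v.
Proof.
have [_ [chi [v0 [au hv0 chiE]]] _] := hu.
split.
- split => // s x; apply/(calL2P hE Pr V s x mu).
  by have [] := solution_sq_integrable s x au hv0 chiE.
- move=> i; split => // s x; apply/(calL2P hE Pr V s x (mv i)).
  by have [_ + _ _ _] := solution_sq_integrable s x au hv0 chiE; exact.
- exact: solution_equations.
Qed.

End solution.

Theorem proposition5p15 (R : realType) (T : {posnum R}) (E : ptopologicalType)
  (hE : polish R E)
  (P : timeI T -> timeI T -> R.-pker (borel E) ~> (borel E))
  (hP : is_transition_kernel P) (hPt : measurable_in_time P)
  (Pr : timeI T -> E -> probability (cpath T E) R)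
  (hPr : is_canonical_markov_class Pr P)
  (V : clock T) (Da : set (timeI T * borel E -> R))
  (a : (timeI T * borel E -> R) -> (timeI T * borel E -> R))
  (ha : is_operator Da a) (hMP : solves_martingale_problem Pr V Da a)
  (n : nat) (psi : 'I_n -> timeI T * borel E -> R)
  (hpsi : forall i, Da (psi i))
  (hac : forall i, bracket_ac Pr V (psi i))
  (hapsi : forall i, calL Pr V 2 (a (psi i)))
  (hGpsi : forall i, exists2 G, is_frak_G Pr V (psi i) (psi i) G &
     exists C : R, forall z, `|G z| <= C)
  (zeta eta : borel E -> R)
  (mzeta : measurable_fun setT zeta) (meta : measurable_fun setT eta)
  (zeta0 : forall x, 0 <= zeta x) (eta0 : forall x, 0 <= eta x)
  (hmom : Hmom Pr V zeta eta)
  (f : timeI T * borel E * R * n.-tuple R -> R) (g : borel E -> R)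
  (hgrowth : Hgrowth f g zeta eta)
  (u : timeI T * borel E -> R)
  (hu : martingale_solution f g Pr V psi u) :
  (forall v : 'I_n -> timeI T * borel E -> R,
     (forall i, is_frak_G Pr V (psi i) u (v i)) ->
     solution_IP f g Pr V psi P a u v) /\
  decoupled_mild_solution f g Pr V psi P a u.
Proof.
have sol (v : 'I_n -> timeI T * borel E -> R) :
    (forall i, is_frak_G Pr V (psi i) u (v i)) -> solution_IP f g Pr V psi P a u v.
  move=> hv; exact: (frak_G_solution_IP hE hPr ha hMP hpsi hapsi hGpsi meta eta0 hmom hgrowth hu hv).
split => //; have [_ [chi [v [_ hv _]]] _] := hu.
by exists v; exact: sol.
Qed.
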